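(* Let $W$ be a pointed Frölicher space and let $i:A\hookrightarrow X$ be a cofibration in the category of pointed Frölicher spaces, with basepoint $x_0\in A\subseteq X$. Let $j:X\to\mathbf T_i$, $x\mapsto[x]$, be the inclusion into the flattened mapping cone and $k:\mathbf T_i\to\Sigma A$ the map collapsing $j(X)$ to a point followed by the canonical isomorphism $\mathbf T_i/X\cong\Sigma A$. Then the sequence of pointed sets $$\cdots\to[\Sigma^{n+1}A,W]\xrightarrow{(\Sigma^nk)^*}[\Sigma^n\mathbf T_i,W]\xrightarrow{(\Sigma^nj)^*}[\Sigma^nX,W]\xrightarrow{(\Sigma^ni)^*}[\Sigma^nA,W]\xrightarrow{(\Sigma^{n-1}k)^*}\cdots\to[\Sigma A,W]\xrightarrow{k^*}[\mathbf T_i,W]\xrightarrow{j^*}[X,W]\xrightarrow{i^*}[A,W]$$ is exact.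
   Context: A Frölicher space is a triple $(X,\mathcal C_X,\mathcal F_X)$ with $\mathcal C_X\subseteq X^{\mathbb R}$, $\mathcal F_X\subseteq\mathbb R^X$, such that $\mathcal F_X=\{f\mid f\circ c\in C^\infty(\mathbb R,\mathbb R)\ \forall c\in\mathcal C_X\}$ and $\mathcal C_X=\{c\mid f\circ c\in C^\infty(\mathbb R,\mathbb R)\ \forall f\in\mathcal F_X\}$. Smooth maps: $g\circ\varphi\in\mathcal F_X$ for all $g\in\mathcal F_Y$. Subspaces carry the initial structure, products the structure generated by $f\circ\pi_i$, coproducts, quotients and pushouts the final structure. $I$ is $[0,1]$ with the subspace structure from $\mathbb R$; $\mathbf I$ is $[0,1]$ with the structure generated by those structure functions of $I$ that are constant on $[0,\epsilon)$ and on $(1-\epsilon,1]$ for some $0<\epsilon<1/4$. Braking function: for $0<\epsilon<\frac12$, $\alpha_\epsilon:\mathbb R\to\mathbb R$ smooth, $=0$ on $(-\infty,\epsilon]$, strictly increasing with values in $(0,1)$ on $(\epsilon,1-\epsilon)$, $=1$ on $[1-\epsilon,\infty)$. A smooth map $i:A\to X$ is a smooth cofibration if for every $Z$, smooth $f:X\to Z$ and smooth $G:I\times A\to Z$ with $G(0,a)=f(i(a))$, there exist $\epsilon$, a braking function $\alpha_\epsilon$ and a smooth $F:I\times X\to Z$ with $F(0,x)=f(x)$ and $F(t,i(a))=G(\alpha_\epsilon(t),a)$ (in the pointed category all maps and homotopies preserve basepoints). For smooth $f:X\to Y$, the flattened mapping cylinder $\mathbf I_f$ is the quotient of $(\mathbf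 I\times X)\sqcup Y$ by $(1,x)\sim f(x)$, elements $[t,x]$, $[y]$; the pointed flattened mapping cone $\mathbf T_f$ is the quotient of $\mathbf I_f$ collapsing $(\{0\}\times X)\cup(\mathbf I\times\{x_0\})$ to its basepoint. The reduced flattened suspension is $\Sigma A=(\mathbf I/\{0,1\})\wedge A$ with $0$ the basepoint of $\mathbf I$; for a pointed smooth map $g$, $\Sigma g=1\wedge g$, and $\Sigma^n$ denotes $n$-fold iteration. For pointed $X,W$, $[X,W]$ is the set of basepoint-preserving smooth maps modulo pointed smooth homotopy (smooth $H:I\times X\to W$ with $H(t,x_0)=w_0$), pointed by the class of the constant map; $g^*$ is precomposition. Exactness at each term means the image of the incoming map equals the preimage of the basepoint under the outgoing map. *)

(* Defs.v *)
From Stdlib Require Import Reals Relations ClassicalEpsilon.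
Open Scope R_scope.

Definition smoothRR (f : R -> R) : Prop :=
  exists d : nat -> R -> R,
    d O = f /\ forall (n : nat) (x : R), derivable_pt_lim (d n) x (d (S n) x).

Record Frol := mkFrol {
  car :> Type;
  curv : (R -> car) -> Prop;
  fns : (car -> R) -> Prop;
  fns_ax : forall f, fns f <-> (forall c, curv c -> smoothRR (fun t => f (c t)));
  curv_ax : forall c, curv c <-> (forall f, fns f -> smoothRR (fun t => f (c t)))
}.

Definition genF_curv {X : Type} (F0 : (X -> R) -> Prop) (c : R -> X) : Prop :=
  forall f, F0 f -> smoothRR (fun t => f (c t)).
Definition genF_fns {X : Type} (F0 : (X -> R) -> Prop) (f : X -> R) : Prop :=
  forall c, genF_curv F0 c -> smoothRR (fun t => f (c t)).
Lemma genF_curv_ax {X : Type} (F0 : (X -> R) -> Prop) :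
  forall c, genF_curv F0 c <-> (forall f, genF_fns F0 f -> smoothRR (fun t => f (c t))).
Proof.
  intros c; split.
  - intros Hc f Hf. apply Hf, Hc.
  - intros H f Hf. apply H. intros c' Hc'. apply Hc', Hf.
Qed.
Definition genF (X : Type) (F0 : (X -> R) -> Prop) : Frol :=
  @mkFrol X (genF_curv F0) (genF_fns F0) (fun f => iff_refl _) (genF_curv_ax F0).

Definition genC_fns {X : Type} (C0 : (R -> X) -> Prop) (f : X -> R) : Prop :=
  forall c, C0 c -> smoothRR (fun t => f (c t)).
Definition genC_curv {X : Type} (C0 : (R -> X) -> Prop) (c : R -> X) : Prop :=
  forall f, genC_fns C0 f -> smoothRR (fun t => f (c t)).
Lemma genC_fns_ax {X : Type} (C0 : (R -> X) -> Prop) :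
  forall f, genC_fns C0 f <-> (forall c, genC_curv C0 c -> smoothRR (fun t => f (c t))).
Proof.
  intros f; split.
  - intros Hf c Hc. apply Hc, Hf.
  - intros H c Hc0. apply H. intros f' Hf'. apply Hf', Hc0.
Qed.
Definition genC (X : Type) (C0 : (R -> X) -> Prop) : Frol :=
  @mkFrol X (genC_curv C0) (genC_fns C0) (genC_fns_ax C0) (fun c => iff_refl _).

Arguments genF : clear implicits.
Arguments genC : clear implicits.

Definition smooth_map (X Y : Frol) (phi : X -> Y) : Prop :=
  forall g, fns Y g -> fns X (fun x => g (phi x)).

Definition Rfr : Frol := genF R smoothRR.

Definition subF (X : Frol) (S : X -> Prop) : Frol :=
  genF {x : X | S x}
       (fun g => exists f, fns X f /\ forall y, g y = f (proj1_sig y)).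

Definition prodF (X Y : Frol) : Frol :=
  genF (car X * car Y)
       (fun g => (exists f, fns X f /\ forall p, g p = f (fst p)) \/
                 (exists f, fns Y f /\ forall p, g p = f (snd p))).

Definition sumF (X Y : Frol) : Frol :=
  genC (car X + car Y)
       (fun c => (exists c', curv X c' /\ forall t, c t = inl (c' t)) \/
                 (exists c', curv Y c' /\ forall t, c t = inr (c' t))).

Definition qcls {X : Type} (Rl : X -> X -> Prop) (x : X) : X -> Prop :=
  fun y => clos_refl_sym_trans X Rl x y.
Definition qcar {X : Type} (Rl : X -> X -> Prop) : Type :=
  {P : X -> Prop | exists x, P = qcls Rl x}.
Definition qproj {X : Type} (Rl : X -> X -> Prop) (x : X) : qcar Rl :=
  exist _ (qcls Rl x) (ex_intro _ x eq_refl).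
Definition qrep {X : Type} (Rl : X -> X -> Prop) (q : qcar Rl) : X :=
  proj1_sig (constructive_indefinite_description _ (proj2_sig q)).

Definition quotF (X : Frol) (Rl : X -> X -> Prop) : Frol :=
  genC (qcar Rl) (fun c => exists c', curv X c' /\ forall t, c t = qproj Rl (c' t)).

Definition collapse {X : Type} (P : X -> Prop) : X -> X -> Prop :=
  fun u v => P u /\ P v.

Definition Iset : Type := {t : R | 0 <= t <= 1}.
Definition Ifr : Frol := subF Rfr (fun t => 0 <= t <= 1).
Definition I0 : Iset := exist _ 0 (conj (Rle_refl 0) Rle_0_1).
Definition I1 : Iset := exist _ 1 (conj Rle_0_1 (Rle_refl 1)).

Definition boldI : Frol :=
  genF Iset
    (fun f => fns Ifr f /\
       exists eps, 0 < eps < 1/4 /\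
         (forall s t : Iset, proj1_sig s < eps -> proj1_sig t < eps -> f s = f t) /\
         (forall s t : Iset, 1 - eps < proj1_sig s -> 1 - eps < proj1_sig t -> f s = f t)).

Record PFrol := mkP { psp :> Frol; ppt : psp }.

Definition psmooth (X Y : PFrol) (phi : X -> Y) : Prop :=
  smooth_map X Y phi /\ phi (ppt X) = ppt Y.

Definition subP (X : PFrol) (S : X -> Prop) (h : S (ppt X)) : PFrol :=
  mkP (subF X S) (exist _ (ppt X) h).
Definition incl (X : PFrol) (S : X -> Prop) (h : S (ppt X)) : subP X S h -> X :=
  fun a => proj1_sig a.

Definition cylRel {X Y : Frol} (f : X -> Y) : car (sumF (prodF boldI X) Y) -> car (sumF (prodF boldI X) Y) -> Prop :=
  fun u v => exists (t : Iset) (x : X),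
    proj1_sig t = 1 /\ u = inl (t, x) /\ v = inr (f x).
Definition cylF {X Y : Frol} (f : X -> Y) : Frol :=
  quotF (sumF (prodF boldI X) Y) (cylRel f).
Definition cylproj {X Y : Frol} (f : X -> Y) (u : car (sumF (prodF boldI X) Y)) : cylF f :=
  qproj (cylRel f) u.

Definition coneSet {X Y : PFrol} (f : X -> Y) (q : cylF f) : Prop :=
  exists (t : Iset) (x : X), (proj1_sig t = 0 \/ x = ppt X) /\
                             q = cylproj f (inl (t, x)).
Definition coneF {X Y : PFrol} (f : X -> Y) : PFrol :=
  mkP (quotF (cylF f) (collapse (coneSet f)))
      (qproj (collapse (coneSet f)) (cylproj f (inl (I0, ppt X)))).

Definition endpts (s : Iset) : Prop := proj1_sig s = 0 \/ proj1_sig s = 1.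
Definition circP : PFrol :=
  mkP (quotF boldI (collapse endpts)) (qproj (collapse endpts) I0).

Definition wedgeSet (P A : PFrol) (u : car (prodF P A)) : Prop :=
  fst u = ppt P \/ snd u = ppt A.
Definition smashP (P A : PFrol) : PFrol :=
  mkP (quotF (prodF P A) (collapse (wedgeSet P A)))
      (qproj (collapse (wedgeSet P A)) (ppt P, ppt A)).

Definition SigP (A : PFrol) : PFrol := smashP circP A.

Definition Sigm {A B : PFrol} (g : A -> B) : SigP A -> SigP B :=
  fun q => let r := qrep (collapse (wedgeSet circP A)) q in
           qproj (collapse (wedgeSet circP B)) (fst r, g (snd r)).

Fixpoint Sig_n (n : nat) (A : PFrol) : PFrol :=
  match n with O => A | S m => Sig_n m (SigP A) end.
Fixpoint Sig_nm (n : nat) : forall (A B : PFrol), (A -> B) -> Sig_n n A -> Sig_n n B :=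
  match n return forall (A B : PFrol), (A -> B) -> Sig_n n A -> Sig_n n B with
  | O => fun A B g => g
  | S m => fun A B g => Sig_nm m (SigP A) (SigP B) (@Sigm A B g)
  end.
Arguments Sig_nm n {A B} g _.

Definition coneJ {X Y : PFrol} (f : X -> Y) : Y -> coneF f :=
  fun y => qproj (collapse (coneSet f)) (cylproj f (inr y)).
Definition coneK {X Y : PFrol} (f : X -> Y) : coneF f -> SigP X :=
  fun q =>
    match qrep (cylRel f) (qrep (collapse (coneSet f)) q) with
    | inl p => qproj (collapse (wedgeSet circP X))
                     (qproj (collapse endpts) (fst p), snd p)
    | inr _ => ppt (SigP X)
    end.

Definition braking (eps : R) (a : R -> R) : Prop :=
  0 < eps < 1/2 /\ smoothRR a /\
  (forall t, t <= eps -> a t = 0) /\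
  (forall t, eps < t < 1 - eps -> 0 < a t < 1) /\
  (forall s t, eps < s -> s < t -> t < 1 - eps -> a s < a t) /\
  (forall t, 1 - eps <= t -> a t = 1).

Definition pcofibration {A X : PFrol} (i : A -> X) : Prop :=
  psmooth A X i /\
  forall (Z : PFrol) (f : X -> Z) (G : Iset * A -> Z),
    psmooth X Z f -> smooth_map (prodF Ifr A) Z G ->
    (forall a, G (I0, a) = f (i a)) -> (forall t, G (t, ppt A) = ppt Z) ->
    exists (eps : R) (al : R -> R) (F : Iset * X -> Z),
      braking eps al /\ smooth_map (prodF Ifr X) Z F /\
      (forall x, F (I0, x) = f x) /\ (forall t, F (t, ppt X) = ppt Z) /\
      (forall (t s : Iset) (a : A), proj1_sig s = al (proj1_sig t) ->
         F (t, i a) = G (s, a)).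

(** Pointed smooth homotopy, and exactness of [Z,W] -h*-> [Y,W] -g*-> [X,W] *)
Definition phtpy (X W : PFrol) (f g : X -> W) : Prop :=
  exists H : Iset * X -> W,
    smooth_map (prodF Ifr X) W H /\
    (forall x, H (I0, x) = f x) /\ (forall x, H (I1, x) = g x) /\
    (forall t, H (t, ppt X) = ppt W).

Definition exact_at {X Y Z : PFrol} (W : PFrol) (g : X -> Y) (h : Y -> Z) : Prop :=
  forall phi : Y -> W, psmooth Y W phi ->
    (phtpy X W (fun x => phi (g x)) (fun _ => ppt W) <->
     exists psi : Z -> W, psmooth Z W psi /\ phtpy Y W phi (fun y => psi (h y))).

(* Main.v *)
Require Import Defs.
From Stdlib Require Import Reals Arith Lra Lia Relations Classical ClassicalEpsilon.
From Stdlib Require Import FunctionalExtensionality PropExtensionality ProofIrrelevance.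
From Coquelicot Require Import Coquelicot.
Open Scope R_scope.

(** This is the Puppe sequence of a smooth map, with every homotopy written down explicitly; the
    cofibration hypothesis only supplies a braking function.  The paths used in the cone and the
    suspension are reparametrised by the braking function, which makes them flat at the ends of the
    flattened interval and lets them be concatenated smoothly.  Exactness after suspension reduces
    to exactness before it, since pointed maps and homotopies out of the suspension of [A] into [W]
    correspond to those out of [A] into the smooth loop space of [W].

    Both the loop space adjunction and the smoothness of homotopies on [I] times a quotient rest on
    one analytic fact, the cartesian closedness of Froelicher spaces ([weakly_smooth_diag]): if
    [t |-> u t] is a curve of smooth functions such that [Phi (u t)] is smooth in [t] for every
    functional [Phi] preserving smooth families, then [r |-> u r r] is smooth.  Testing against
    suitable [Phi] bounds all pure derivatives of [u] locally; interpolation inequalities then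
    bound the mixed ones. *)

(** * Smooth functions of one variable *)

(** A curve in a quotient is characterised by the functions on the quotient and need not lift to
    representatives, so the smoothness of a homotopy on [I] times a cone cannot be read off lifts.
    The way out is to give the two factors independent times: for the parameter factor at time [x]
    and the quotient point at time [t], a functional applied in [x] yields a function on the
    quotient, and such a function can be tested on lifted curves. What remains is a question about a
    family [u t x] on the plane, where only the diagonal is wanted; everything is tested along
    one-dimensional curves.

    The second obstacle is that the coordinate of [boldI] is not a structure function: a curve in
    [boldI] need not be differentiable where it meets an end. Hence a coordinate passes through a
    function flat at the ends before it is used, and the passage from the plain coordinate to the
    flattened one is itself a homotopy.

    The braking function comes from the extension property with a one-point target, where any lift
    exists and only [al] carries information. It is also the raw material of every bump and cut-off
    in the analysis. *)

Lemma smooth_coind (P : (R -> R) -> Prop) :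
  (forall f, P f -> exists f', (forall x, is_derive f x (f' x)) /\ P f') ->
  forall f, P f -> smoothRR f.
Proof.
  intros HP f Hf.
  (* A class of functions stable under differentiation consists of smooth functions: choose a
     derivative inside the class again and again. The membership proof travels with the function so
     that the choice can be iterated. *)
  set (nxt := fun g : {g | P g} =>
    exist P (proj1_sig (constructive_indefinite_description _ (HP (proj1_sig g) (proj2_sig g))))
      (proj2 (proj2_sig (constructive_indefinite_description _ (HP (proj1_sig g) (proj2_sig g)))))).
  exists (fun n => proj1_sig (Nat.iter n nxt (exist P f Hf))).
  split; [reflexivity|]. intros n x. apply is_derive_Reals. simpl.
  unfold nxt at 2; simpl.
  exact (proj1 (proj2_sig (constructive_indefinite_description _
           (HP (proj1_sig (Nat.iter n nxt (exist P f Hf))) (proj2_sig (Nat.iter n nxt (exist P f Hf)))))) x).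
Qed.

Lemma smooth_derive f x : smoothRR f -> is_derive f x (Derive f x).
Proof.
  intros [d [H0 Hd]]. apply Derive_correct. exists (d 1%nat x).
  apply is_derive_Reals. rewrite <- H0. apply Hd.
Qed.

Lemma smooth_Derive f : smoothRR f -> smoothRR (Derive f).
Proof.
  intros [d [H0 Hd]]. exists (fun n => d (S n)). split.
  - apply functional_extensionality; intro x. symmetry. apply is_derive_unique.
    apply is_derive_Reals. rewrite <- H0. apply Hd.
  - intros n x. apply Hd.
Qed.

Lemma smooth_Derive_n f n : smoothRR f -> smoothRR (Derive_n f n).
Proof.
  intros Hf; induction n as [|n IH]; [exact Hf|]. exact (smooth_Derive _ IH).
Qed.

Lemma smooth_is_derive_n f n x :
  smoothRR f -> is_derive (Derive_n f n) x (Derive_n f (S n) x).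
Proof. intros Hf. apply smooth_derive, smooth_Derive_n, Hf. Qed.

Lemma Derive_n_Derive f n x : Derive_n (Derive f) n x = Derive_n f (S n) x.
Proof.
  revert x; induction n as [|n IH]; intros x; [reflexivity|].
  simpl. apply Derive_ext. intros t. apply IH.
Qed.

(** A class shaped so that [smooth_coind] applies. The outer function of [se_comp] is smooth rather
    than an expression, so that its derivative is at hand and the chain rule gives an expression
    again. *)
Inductive smooth_expr : (R -> R) -> Prop :=
| se_base f : smoothRR f -> smooth_expr f
| se_plus f g : smooth_expr f -> smooth_expr g -> smooth_expr (fun x => f x + g x)
| se_mult f g : smooth_expr f -> smooth_expr g -> smooth_expr (fun x => f x * g x)
| se_comp f g : smoothRR f -> smooth_expr g -> smooth_expr (fun x => f (g x)).

Lemma smooth_expr_smooth f : smooth_expr f -> smoothRR f.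
Proof.
  revert f. apply smooth_coind. intros f Hf.
  induction Hf as [f Hf|f g _ [f' [Hf Pf]] _ [g' [Hg Pg]]|f g Ef [f' [Hf Pf]] Eg [g' [Hg Pg]]|f g Hf Eg [g' [Hg Pg]]].
  - exists (Derive f). split; [intro; apply smooth_derive, Hf|].
    apply se_base, smooth_Derive, Hf.
  - exists (fun x => f' x + g' x). split; [|apply se_plus; assumption].
    intros x. apply (is_derive_plus f g); auto.
  - exists (fun x => f' x * g x + f x * g' x). split.
    + intros x. apply is_derive_Reals. apply (derivable_pt_lim_mult f g); apply is_derive_Reals; auto.
    + apply se_plus; apply se_mult; assumption.
  - exists (fun x => Derive f (g x) * g' x). split.
    + intros x. apply is_derive_Reals. apply (derivable_pt_lim_comp g f); apply is_derive_Reals; auto.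
      apply smooth_derive, Hf.
    + apply se_mult; [|assumption]. apply (se_comp (Derive f)); [apply smooth_Derive, Hf|assumption].
Qed.

Lemma smooth_const c : smoothRR (fun _ => c).
Proof.
  apply (smooth_coind (fun f => exists c, f = fun _ => c)); [|eauto].
  intros f [c' ->]. exists (fun _ => 0). split; [|eauto]. intro x. apply @is_derive_const.
Qed.

Lemma smooth_id : smoothRR (fun x => x).
Proof.
  apply (smooth_coind (fun f => f = (fun x => x) \/ exists c, f = fun _ => c)); [|eauto].
  intros f [->|[c ->]].
  - exists (fun _ => 1). split; [|eauto]. intro x. apply @is_derive_id.
  - exists (fun _ => 0). split; [|eauto]. intro x. apply @is_derive_const.
Qed.

Lemma smooth_plus f g : smoothRR f -> smoothRR g -> smoothRR (fun x => f x + g x).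
Proof. intros Hf Hg. apply smooth_expr_smooth, se_plus; apply se_base; assumption. Qed.

Lemma smooth_mult f g : smoothRR f -> smoothRR g -> smoothRR (fun x => f x * g x).
Proof. intros Hf Hg. apply smooth_expr_smooth, se_mult; apply se_base; assumption. Qed.

Lemma smooth_comp f g : smoothRR f -> smoothRR g -> smoothRR (fun x => f (g x)).
Proof. intros Hf Hg. apply smooth_expr_smooth, se_comp; [|apply se_base]; assumption. Qed.

Lemma smooth_scal c f : smoothRR f -> smoothRR (fun x => c * f x).
Proof. intros Hf. apply smooth_mult; [apply smooth_const|exact Hf]. Qed.

Lemma smooth_opp f : smoothRR f -> smoothRR (fun x => - f x).
Proof.
  intros Hf. replace (fun x => - f x) with (fun x => (-1) * f x) by (apply functional_extensionality; intro; ring).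
  apply smooth_scal, Hf.
Qed.

Lemma smooth_minus f g : smoothRR f -> smoothRR g -> smoothRR (fun x => f x - g x).
Proof. intros Hf Hg. apply smooth_plus; [|apply smooth_opp]; assumption. Qed.

Lemma smooth_ext f g : (forall x, f x = g x) -> smoothRR f -> smoothRR g.
Proof. intros E. apply functional_extensionality in E. subst; auto. Qed.

Ltac smooth_tac := repeat first
  [ assumption | apply smooth_const | apply smooth_id | apply smooth_plus | apply smooth_minus
  | apply smooth_mult | apply smooth_opp ].

(** Agreeing near every point with some smooth function is inherited by the derivative, so
    [smooth_coind] applies to this property itself. *)
Lemma smooth_local f :
  (forall x, exists d g, 0 < d /\ smoothRR g /\ forall y, Rabs (y - x) < d -> f y = g y) ->
  smoothRR f.
Proof.
  revert f. apply smooth_coind. intros f Hf.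
  assert (Hd : forall x d g, 0 < d -> smoothRR g -> (forall y, Rabs (y - x) < d -> f y = g y) ->
             is_derive f x (Derive g x)).
  { intros x d g Hd Hg E. apply (is_derive_ext_loc g).
    - exists (mkposreal d Hd). intros y Hy. symmetry. apply E. exact Hy.
    - apply smooth_derive, Hg. }
  exists (Derive f). split.
  - intros x. destruct (Hf x) as [d [g [H1 [H2 H3]]]]. apply Derive_correct. eexists. eauto.
  - intros x. destruct (Hf x) as [d [g [H1 [H2 H3]]]].
    exists d, (Derive g). split; [exact H1|]. split; [apply smooth_Derive, H2|].
    intros y Hy. apply is_derive_unique.
    apply (Hd y (d - Rabs (y - x)) g); [lra|exact H2|].
    intros z Hz. apply H3. replace (z - x) with ((z - y) + (y - x)) by ring.
    eapply Rle_lt_trans; [apply Rabs_triang|]. lra.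
Qed.

Lemma smooth_continuous f x : smoothRR f -> continuous f x.
Proof. intros Hf. apply @ex_derive_continuous. eexists. apply smooth_derive, Hf. Qed.

Lemma smooth_near f x e :
  smoothRR f -> 0 < e -> exists d, 0 < d /\ forall y, Rabs (y - x) < d -> Rabs (f y - f x) < e.
Proof.
  intros Hf He. destruct (smooth_continuous f x Hf (fun z => Rabs (z - f x) < e)) as [d Hd].
  - exists (mkposreal e He). intros z Hz. exact Hz.
  - exists d. split; [apply cond_pos|]. intros y Hy. apply Hd. exact Hy.
Qed.

Lemma smooth_bounded_near f x :
  smoothRR f -> exists d B, 0 < d /\ 0 < B /\ forall y, Rabs (y - x) < d -> Rabs (f y) <= B.
Proof.
  intros Hf. destruct (smooth_near f x 1 Hf Rlt_0_1) as [d [Hd H]].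
  exists d, (Rabs (f x) + 1). split; [exact Hd|]. split; [pose proof (Rabs_pos (f x)); lra|].
  intros y Hy. specialize (H y Hy).
  replace (f y) with ((f y - f x) + f x) by ring. eapply Rle_trans; [apply Rabs_triang|]. lra.
Qed.

Lemma smooth_MVT f a b M :
  smoothRR f -> (forall c, Rmin a b <= c <= Rmax a b -> Rabs (Derive f c) <= M) ->
  Rabs (f b - f a) <= M * Rabs (b - a).
Proof.
  intros Hf HM. destruct (MVT_gen f a b (Derive f)) as [c [Hc E]].
  - intros x _. apply smooth_derive, Hf.
  - intros x _. apply continuity_pt_filterlim, smooth_continuous, Hf.
  - rewrite E, Rabs_mult. apply Rmult_le_compat_r; [apply Rabs_pos|]. apply HM, Hc.
Qed.

(** * Series of smooth functions *)

Lemma pow_half_pos n : 0 < (1/2)^n.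
Proof. apply pow_lt; lra. Qed.

Lemma pow_half_le1 n : (1/2)^n <= 1.
Proof. pose proof (pow_incr (1/2) 1 n) as H. rewrite pow1 in H. apply H. lra. Qed.

Lemma series_half : is_series (fun n => (1/2)^n) 2.
Proof.
  assert (H : is_series (fun n => (1/2)^n) (/ (1 - 1/2))) by (apply is_series_geom; rewrite Rabs_pos_eq; lra).
  replace (/ (1 - 1/2)) with 2 in H by field. exact H.
Qed.

Lemma ex_series_half B : ex_series (fun n => B * (1/2)^n).
Proof. apply (ex_series_scal (V := R_NormedModule) B). exists 2. apply series_half. Qed.

Lemma ex_series_dominated (a : nat -> R) B :
  (forall n, Rabs (a n) <= B * (1/2)^n) -> ex_series a.
Proof.
  intros H. apply (@ex_series_le R_AbsRing R_CompleteNormedModule a (fun n => B * (1/2)^n)).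
  - exact H.
  - apply ex_series_half.
Qed.

Lemma Series_dominated (a : nat -> R) B :
  (forall n, Rabs (a n) <= B * (1/2)^n) -> Rabs (Series a) <= 2 * B.
Proof.
  intros H.
  assert (Hb : ex_series (fun n => B * (1/2)^n)) by apply ex_series_half.
  eapply Rle_trans.
  - apply Series_Rabs. apply (@ex_series_le R_AbsRing R_CompleteNormedModule _ (fun n => B * (1/2)^n)); [|exact Hb].
    intros n. change (Rabs (Rabs (a n)) <= B * (1/2)^n). rewrite Rabs_Rabsolu. apply H.
  - eapply Rle_trans; [apply (Series_le _ (fun n => B * (1/2)^n)); [|exact Hb]|].
    + intros n. split; [apply Rabs_pos|apply H].
    + rewrite (Series_scal_l B (fun n => (1/2)^n)). right. rewrite Rmult_comm. f_equal.
      apply is_series_unique, series_half.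
Qed.

Lemma Series_tail_dominated (a : nat -> R) B N :
  (forall n, Rabs (a n) <= B * (1/2)^n) ->
  Rabs (Series a - sum_n a N) <= B * (1/2)^N.
Proof.
  intros H. rewrite (Series_incr_n a (S N)); [|lia|eapply ex_series_dominated, H].
  rewrite <- sum_n_Reals. simpl pred.
  replace (sum_n a N + Series (fun k => a (S N + k)%nat) - sum_n a N)
    with (Series (fun k => a (S N + k)%nat)) by ring.
  replace (B * (1/2)^N) with (2 * (B * (1/2)^(S N))) by (simpl; field).
  apply Series_dominated. intros n.
  eapply Rle_trans; [apply H|]. rewrite pow_add. lra.
Qed.

(* Tannery's theorem applied to the difference quotients. *)
Lemma is_derive_Series (c : nat -> R) (f : nat -> R -> R) t0 d B :
  (forall n, Rabs (c n) <= (1/2)^n) -> (forall n, smoothRR (f n)) -> 0 < d ->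
  (forall n t, Rabs (t - t0) < d -> Rabs (f n t) <= B) ->
  (forall n t, Rabs (t - t0) < d -> Rabs (Derive (f n) t) <= B) ->
  is_derive (fun t => Series (fun n => c n * f n t)) t0 (Series (fun n => c n * Derive (f n) t0)).
Proof.
  intros Hc Hf Hd H0 H1. apply is_derive_Reals. intros eps Heps.
  assert (Hdom : forall B' g, (forall n, Rabs (g n) <= B') -> forall n, Rabs (c n * g n) <= B' * (1/2)^n).
  { intros B' g Hg n. rewrite Rabs_mult, Rmult_comm. apply Rmult_le_compat; auto using Rabs_pos. }
  (* The defect of the [n]-th difference quotient. By the mean value theorem it is dominated by
     [2 * B * (1/2)^n] whatever [h] is, and each single one tends to 0 with [h]. *)
  set (a := fun h n => c n * ((f n (t0 + h) - f n t0) / h - Derive (f n) t0)).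
  assert (HB : 0 <= B). { eapply Rle_trans; [apply Rabs_pos|apply (H0 O t0)]. rewrite Rminus_diag, Rabs_R0; lra. }
  assert (Ha : forall h, h <> 0 -> Rabs h < d -> forall n, Rabs (a h n) <= (2 * B) * (1/2)^n).
  { intros h Hh Hhd. apply Hdom. intros n.
    assert (Rabs ((f n (t0 + h) - f n t0) / h) <= B).
    { unfold Rdiv. rewrite Rabs_mult, Rabs_inv.
      apply Rmult_le_reg_r with (Rabs h); [apply Rabs_pos_lt, Hh|].
      rewrite Rmult_assoc, Rinv_l, Rmult_1_r by (apply Rabs_no_R0, Hh).
      replace (Rabs h) with (Rabs (t0 + h - t0)) by (f_equal; ring).
      apply smooth_MVT; [apply Hf|]. intros x Hx. apply H1.
      revert Hx Hhd. unfold Rmin, Rmax, Rabs. repeat destruct Rle_dec; repeat destruct Rcase_abs; lra. }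
    assert (Rabs (Derive (f n) t0) <= B) by (apply H1; rewrite Rminus_diag, Rabs_R0; lra).
    eapply Rle_trans; [apply Rabs_triang|]. rewrite Rabs_Ropp. lra. }
  assert (Hhead : forall N e, 0 < e -> exists dl, 0 < dl /\ forall h, h <> 0 -> Rabs h < dl -> Rabs (sum_n (a h) N) < e).
  { assert (Hone : forall n e, 0 < e -> exists dl, 0 < dl /\ forall h, h <> 0 -> Rabs h < dl -> Rabs (a h n) < e).
    { intros n e He. pose proof (smooth_derive _ t0 (Hf n)) as D. apply is_derive_Reals in D.
      destruct (D e He) as [dl Hdl]. exists dl. split; [apply cond_pos|]. intros h Hh Hhd.
      unfold a. rewrite Rabs_mult. eapply Rle_lt_trans; [|apply (Hdl h Hh Hhd)].
      rewrite <- (Rmult_1_l (Rabs (_ / _ - _))) at 2. apply Rmult_le_compat_r; [apply Rabs_pos|].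
      eapply Rle_trans; [apply Hc|]. apply pow_half_le1. }
    induction N as [|N IH]; intros e He.
    - destruct (Hone O e He) as [dl [? Hdl]]. exists dl. split; [assumption|]. intros h Hh Hhd.
      rewrite sum_O. auto.
    - destruct (IH (e/2)) as [d1 [? Hd1]]; [lra|]. destruct (Hone (S N) (e/2)) as [d2 [? Hd2]]; [lra|].
      exists (Rmin d1 d2). split; [apply Rmin_glb_lt; assumption|]. intros h Hh Hhd.
      pose proof (Rmin_l d1 d2). pose proof (Rmin_r d1 d2).
      rewrite sum_Sn. change (Rabs (sum_n (a h) N + a h (S N)) < e).
      eapply Rle_lt_trans; [apply Rabs_triang|].
      specialize (Hd1 h Hh). specialize (Hd2 h Hh). lra. }
  destruct (pow_lt_1_zero (1/2) ltac:(rewrite Rabs_pos_eq; lra) (eps / (2 * (2 * B + 1)))) as [N HN].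
  { apply Rdiv_lt_0_compat; lra. }
  destruct (Hhead N (eps/2)) as [dl [Hdl HH]]; [lra|].
  assert (Hmin : 0 < Rmin dl d) by (apply Rmin_glb_lt; assumption).
  exists (mkposreal _ Hmin). intros h Hh Hhd. simpl in Hhd.
  pose proof (Rmin_l dl d). pose proof (Rmin_r dl d).
  assert (Hex : forall t, Rabs (t - t0) < d -> ex_series (fun n => c n * f n t)).
  { intros t Ht. eapply ex_series_dominated, (Hdom B). intros n; apply H0, Ht. }
  assert (Hex' : ex_series (fun n => c n * Derive (f n) t0)).
  { eapply ex_series_dominated, (Hdom B). intros n; apply H1. rewrite Rminus_diag, Rabs_R0; lra. }
  assert (E1 : ex_series (fun n => c n * f n (t0 + h))) by (apply Hex; replace (t0 + h - t0) with h by ring; lra).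
  assert (E2 : ex_series (fun n => c n * f n t0)) by (apply Hex; rewrite Rminus_diag, Rabs_R0; lra).
  assert (E : (Series (fun n => c n * f n (t0 + h)) - Series (fun n => c n * f n t0)) / h
    - Series (fun n => c n * Derive (f n) t0) = Series (a h)).
  { unfold Rdiv. rewrite <- Series_minus by assumption. rewrite <- Series_scal_r. rewrite <- Series_minus.
    - apply Series_ext. intros n. unfold a. field. exact Hh.
    - apply (ex_series_ext (fun n => scal (/ h) (c n * f n (t0 + h) - c n * f n t0))).
      + intros n. apply Rmult_comm.
      + apply (ex_series_scal (V := R_NormedModule) (/ h)). apply (ex_series_minus (V := R_NormedModule)); assumption.
    - exact Hex'. }
  rewrite E.
  replace (Series (a h)) with ((Series (a h) - sum_n (a h) N) + sum_n (a h) N) by ring.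
  eapply Rle_lt_trans; [apply Rabs_triang|].
  assert (T1 := Series_tail_dominated (a h) (2 * B) N (Ha h Hh ltac:(lra))).
  assert (T2 := HH h Hh ltac:(lra)).
  assert (T3 := HN N (le_n N)). rewrite Rabs_pos_eq in T3 by (apply Rlt_le, pow_half_pos).
  assert (2 * B * (1/2)^N <= eps / 2).
  { apply Rle_trans with ((2 * B + 1) * (eps / (2 * (2 * B + 1)))).
    - apply Rmult_le_compat; try lra. apply Rlt_le, pow_half_pos.
    - right. field. lra. }
  lra.
Qed.

Definition loc_unif_bounded (f : nat -> R -> R) : Prop :=
  forall j t0, exists d B, 0 < d /\ forall n t, Rabs (t - t0) < d -> Rabs (Derive_n (f n) j t) <= B.

(** The termwise derivative is a series of the same kind with the same weights, so such series form
    a class stable under differentiation. *)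
Lemma smooth_Series (c : nat -> R) (f : nat -> R -> R) :
  (forall n, Rabs (c n) <= (1/2)^n) -> (forall n, smoothRR (f n)) -> loc_unif_bounded f ->
  smoothRR (fun t => Series (fun n => c n * f n t)).
Proof.
  intros Hc Hf Hb.
  apply (smooth_coind (fun F => exists f, (forall n, smoothRR (f n)) /\ loc_unif_bounded f /\
            F = fun t => Series (fun n => c n * f n t))); [|eauto].
  clear f Hf Hb. intros F [f [Hf [Hb ->]]].
  exists (fun t => Series (fun n => c n * Derive (f n) t)). split.
  - intros t. destruct (Hb O t) as [d0 [B0 [? H0]]]. destruct (Hb 1%nat t) as [d1 [B1 [? H1]]].
    pose proof (Rmin_l d0 d1). pose proof (Rmin_r d0 d1). pose proof (Rmax_l B0 B1). pose proof (Rmax_r B0 B1).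
    apply (is_derive_Series c f t (Rmin d0 d1) (Rmax B0 B1)); auto.
    + apply Rmin_glb_lt; assumption.
    + intros n s Hs. eapply Rle_trans; [apply (H0 n s)|]; lra.
    + intros n s Hs. eapply Rle_trans; [apply (H1 n s)|]; lra.
  - exists (fun n => Derive (f n)). split; [intro; apply smooth_Derive, Hf|]. split; [|reflexivity].
    intros j t0. destruct (Hb (S j) t0) as [d [B [Hd H]]]. exists d, B. split; [exact Hd|].
    intros n t Ht. rewrite Derive_n_Derive. auto.
Qed.

(** * Families smooth along smooth curves *)

Lemma Derive_n_affine f k al be j x :
  smoothRR f -> Derive_n (fun r => k * f (al * r + be)) j x = k * al^j * Derive_n f j (al * x + be).
Proof.
  intros Hf. revert x; induction j as [|j IH]; intros x; [simpl; ring|].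
  simpl Derive_n at 1. rewrite (Derive_ext _ _ _ IH).
  apply is_derive_unique, is_derive_Reals.
  replace (k * al ^ S j * Derive_n f (S j) (al * x + be)) with
    ((k * al^j) * (Derive_n f (S j) (al * x + be) * al)) by (simpl; ring).
  apply (derivable_pt_lim_scal (fun r => Derive_n f j (al * r + be))).
  apply (derivable_pt_lim_comp (fun r => al * r + be) (Derive_n f j)).
  - apply is_derive_Reals. auto_derive; [exact I|ring].
  - apply is_derive_Reals, smooth_is_derive_n, Hf.
Qed.

Lemma smooth_interval_bounded f a b :
  a <= b -> smoothRR f -> exists B, forall x, a <= x <= b -> Rabs (f x) <= B.
Proof.
  intros Hab Hf.
  assert (Hc : forall c, a <= c <= b -> continuity_pt f c)
    by (intros; apply continuity_pt_filterlim, smooth_continuous, Hf).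
  destruct (continuity_ab_maj f a b Hab Hc) as [M [HM _]].
  destruct (continuity_ab_min f a b Hab Hc) as [m [Hm _]].
  exists (Rmax (f M) (- f m)). intros x Hx. specialize (HM x Hx). specialize (Hm x Hx).
  pose proof (Rmax_l (f M) (- f m)). pose proof (Rmax_r (f M) (- f m)). apply Rabs_le. lra.
Qed.

Lemma is_series_finite (a : nat -> R) N :
  (forall n, (N < n)%nat -> a n = 0) -> is_series a (sum_n a N).
Proof.
  intros H. apply (filterlim_ext_loc (fun _ => sum_n a N)); [|apply filterlim_const].
  exists N. intros n Hn. induction Hn as [|n Hn IH]; [reflexivity|].
  rewrite sum_Sn, <- IH, H by lia. symmetry. apply Rplus_0_r.
Qed.

Lemma Series_single (a : nat -> R) m : (forall n, n <> m -> a n = 0) -> Series a = a m.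
Proof.
  intros H. rewrite (is_series_unique _ _ (is_series_finite a m ltac:(intros; apply H; lia))).
  destruct m as [|m]; [apply sum_O|]. rewrite sum_Sn.
  replace (sum_n a m) with 0; [apply Rplus_0_l|].
  symmetry. rewrite (sum_n_ext_loc a (fun _ => 0)) by (intros; apply H; lia).
  rewrite sum_n_const. ring.
Qed.

(** Differentiating a dilate by [2^n] repeatedly costs powers of [2^n]; the weight [(1/2)^(n*n)]
    beats any fixed power, with a bound independent of [n]. *)
Lemma pow_half_sqr_bound n k : 2^(n*k) * (1/2)^(n*n) <= 2^(k*k).
Proof.
  assert (H2 : forall i, 0 < 2^i) by (intro; apply pow_lt; lra).
  assert (Hh : forall i, (1/2)^i = / 2^i) by (intro; rewrite <- pow_inv; f_equal; field).
  destruct (le_lt_dec k n) as [Hkn|Hkn].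
  - rewrite Hh. apply Rle_trans with 1.
    + apply Rmult_le_reg_r with (2^(n*n)); [apply H2|]. rewrite Rmult_assoc, Rinv_l, Rmult_1_r, Rmult_1_l by (apply Rgt_not_eq, H2).
      apply Rle_pow; [lra|]. apply Nat.mul_le_mono_l, Hkn.
    + apply pow_R1_Rle. lra.
  - rewrite <- (Rmult_1_r (2^(k*k))). apply Rmult_le_compat; try apply Rlt_le, H2.
    + apply Rlt_le, pow_half_pos.
    + apply Rle_pow; [lra|]. apply Nat.mul_le_mono_r. lia.
    + apply pow_half_le1.
Qed.

(* The dilates [r |-> chi (2^n r)] live on disjoint intervals accumulating at [0]. *)
Lemma smooth_dilates (chi : R -> R) (y : nat -> R) :
  smoothRR chi -> (forall z, z <= 2/3 \/ 4/3 <= z -> chi z = 0) ->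
  (forall n, Rabs (y n) <= (1/2)^(n*n)) ->
  smoothRR (fun r => Series (fun n => y n * chi (2^n * r))).
Proof.
  intros Hs Hz Hy.
  assert (Hb : forall j, exists B, 0 <= B /\ forall z, Rabs (Derive_n chi j z) <= B).
  { intros j. destruct (smooth_interval_bounded (Derive_n chi j) 0 2) as [B HB]; [lra|apply smooth_Derive_n, Hs|].
    assert (B0 : 0 <= B) by (eapply Rle_trans; [apply Rabs_pos|apply (HB 1); lra]).
    exists B. split; [exact B0|]. intros z.
    assert (Hout : z < 2/3 \/ 4/3 < z -> Derive_n chi j z = 0).
    { intros Hzz. rewrite (Derive_n_ext_loc _ (fun _ => 0)).
      - destruct j as [|j]; [reflexivity|]. apply Derive_n_const.
      - destruct Hzz.
        + apply (locally_interval _ z m_infty (2/3)); simpl; auto. intros u _ Hu. apply Hz. simpl in Hu. lra.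
        + apply (locally_interval _ z (4/3) p_infty); simpl; auto. intros u Hu _. apply Hz. simpl in Hu. lra. }
    destruct (Rlt_dec z (2/3)); [rewrite Hout, Rabs_R0; lra|].
    destruct (Rlt_dec (4/3) z); [rewrite Hout, Rabs_R0; lra|]. apply HB. lra. }
  (* The summable weight is split off and the coefficient grows by [2^n] in exchange, which is why
     the exponent [j + 1] and not [j] appears in the bound. *)
  apply (smooth_ext (fun r => Series (fun n => (1/2)^n * ((2^n * y n) * chi (2^n * r + 0))))).
  { intros r. apply Series_ext. intros n. rewrite Rplus_0_r.
    replace (y n * chi (2^n * r)) with (((1/2)^n * 2^n) * y n * chi (2^n * r)); [ring|].
    rewrite <- Rpow_mult_distr. replace (1/2*2) with 1 by field. rewrite pow1. ring. }
  apply smooth_Series.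
  - intros n. rewrite Rabs_pos_eq; [lra|apply Rlt_le, pow_half_pos].
  - intros n. apply smooth_scal, (smooth_comp chi); [exact Hs|].
    apply smooth_plus; [apply smooth_scal, smooth_id|apply smooth_const].
  - intros j t0. destruct (Hb j) as [B [B0 HB]]. exists 1, (2^((j+1)*(j+1)) * B). split; [lra|].
    intros n t _. rewrite Derive_n_affine by exact Hs. rewrite Rabs_mult.
    apply Rmult_le_compat; auto using Rabs_pos.
    rewrite !Rabs_mult, <- !RPow_abs, (Rabs_pos_eq 2) by lra.
    eapply Rle_trans; [|apply (pow_half_sqr_bound n (j+1))].
    rewrite (Nat.add_comm j 1), Nat.mul_add_distr_l, Nat.mul_1_r, pow_add, pow_mult.
    assert (0 < 2^n) by (apply pow_lt; lra). assert (0 < (2^n)^j) by (apply pow_lt; assumption).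
    specialize (Hy n).
    apply Rle_trans with (2^n * (1/2)^(n*n) * (2^n)^j); [|right; ring].
    apply Rmult_le_compat_r; [lra|]. apply Rmult_le_compat_l; lra.
Qed.

(** The smooth maps from the plane to the line in the sense of Frölicher spaces; by Boman's theorem,
    the smooth functions of two variables. *)
Definition FS (w : R -> R -> R) : Prop :=
  forall a b, smoothRR a -> smoothRR b -> smoothRR (fun r => w (a r) (b r)).

Lemma FS_swap w : FS w -> FS (fun x t => w t x).
Proof. intros H a b Ha Hb. exact (H b a Hb Ha). Qed.

(** One factor rises on [[2/3, 1]], the other falls on [[1, 4/3]]. The ratio 2 of the ends of the
    support makes the dilates by powers of 2 disjoint. *)
Lemma braking_bump eps al : braking eps al ->
  exists chi, smoothRR chi /\ (forall z, z <= 2/3 \/ 4/3 <= z -> chi z = 0) /\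
    exists d, 0 < d <= 1/6 /\ forall z, Rabs (z - 1) <= d -> chi z = 1.
Proof.
  intros [He [Hs [H0 [_ [_ H1]]]]].
  exists (fun z => al (3 * z - 2) * al (4 - 3 * z)). split; [|split].
  - apply smooth_mult; apply (smooth_comp al); auto; smooth_tac.
  - intros z [Hz|Hz]; [rewrite H0|rewrite (H0 (4 - 3 * z))]; try ring; lra.
  - exists (eps/3). split; [lra|]. intros z Hz. apply Rabs_le_between in Hz.
    rewrite !H1; lra.
Qed.

(* Otherwise some smooth curve runs through points [(t_n, x_n)] of fast growing derivative,
   slowly and in the [t]-direction near the [n]-th one. *)
Lemma FS_loc_bounded eps al w : braking eps al -> FS w ->
  forall j t0 x0, exists d B, 0 < d /\
    forall t x, Rabs (t - t0) < d -> Rabs (x - x0) < d -> Rabs (Derive_n (fun s => w s x) j t) <= B.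
Proof.
  intros Hal Hw j t0 x0. apply NNPP. intros Hno.
  assert (Hbad : forall n : nat, exists p : R * R,
    Rabs (fst p - t0) < (1/2)^(n*n) /\ Rabs (snd p - x0) < (1/2)^(n*n) /\
    INR n * (2^(n*n))^j < Rabs (Derive_n (fun s => w s (snd p)) j (fst p))).
  { intros n. apply NNPP. intros Hn. apply Hno.
    exists ((1/2)^(n*n)), (INR n * (2^(n*n))^j). split; [apply pow_half_pos|].
    intros t x Ht Hx. apply Rnot_lt_le. intros Hlt. apply Hn. exists (t, x). auto. }
  destruct (choice _ Hbad) as [p Hp]. clear Hno Hbad.
  destruct (braking_bump eps al Hal) as [chi [Hchi [Hchi0 [d [Hd Hchi1]]]]].
  (* Near [r = (1/2)^m] only the [m]-th bump is alive and it equals 1, so the curve passes through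
     [p m] with constant second coordinate and speed [(1/2)^(m*m) * 2^m]. The small speed makes the
     curve smooth at 0; its [j]-th power is made up for by the growth [(2^(n*n))^j] imposed in
     [Hbad]. *)
  set (a := fun r => t0 + (Series (fun n => (fst (p n) - t0) * chi (2^n * r))
     + Series (fun n => (1/2)^(n*n) * ((2^n * r - 1) * chi (2^n * r))))).
  set (b := fun r => x0 + Series (fun n => (snd (p n) - x0) * chi (2^n * r))).
  assert (Ha : smoothRR a).
  { apply smooth_plus; [apply smooth_const|]. apply smooth_plus.
    - apply smooth_dilates; auto. intros n. apply Rlt_le, Hp.
    - apply (smooth_dilates (fun z => (z - 1) * chi z)).
      + smooth_tac.
      + intros z Hz. rewrite Hchi0 by exact Hz. ring.
      + intros n. rewrite Rabs_pos_eq; [lra|apply Rlt_le, pow_half_pos]. }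
  assert (Hb : smoothRR b).
  { apply smooth_plus; [apply smooth_const|].
    apply smooth_dilates; auto. intros n. apply Rlt_le, Hp. }
  assert (HF := Hw a b Ha Hb).
  (* Since [d <= 1/6], multiplying or dividing [2^m * r] by at least 2 leaves the support of
     [chi]. *)
  assert (Hnear : forall m r, Rabs (2^m * r - 1) < d -> forall n, n <> m -> chi (2^n * r) = 0).
  { intros m r Hr n Hn. apply Rabs_lt_between in Hr. apply Hchi0.
    destruct (le_lt_dec n m) as [Hnm|Hnm].
    - left. assert (E : m = (n + S (m - S n))%nat) by lia. rewrite E in Hr.
      rewrite pow_add in Hr. simpl pow in Hr. 
      assert (1 <= 2^(m - S n)) by (apply pow_R1_Rle; lra).
      assert (0 < 2^n * r). 
      { destruct (Rlt_dec 0 (2^n * r)); [assumption|]. exfalso.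
        assert (2^n * (2 * 2^(m - S n)) * r <= 0); [|lra].
        replace (2^n * (2 * 2^(m - S n)) * r) with ((2^n * r) * (2 * 2^(m - S n))) by ring. nra. }
      nra.
    - right. assert (E : n = (m + S (n - S m))%nat) by lia. rewrite E.
      rewrite pow_add. simpl pow.
      assert (1 <= 2^(n - S m)) by (apply pow_R1_Rle; lra).
      replace (2^m * (2 * 2^(n - S m)) * r) with ((2^m * r) * (2 * 2^(n - S m))) by ring. nra. }
  destruct (smooth_bounded_near (Derive_n (fun r => w (a r) (b r)) j) 0 (smooth_Derive_n _ _ HF)) as [dl [B [Hdl [HB0 HB]]]].
  destruct (pow_lt_1_zero (1/2) ltac:(rewrite Rabs_pos_eq; lra) dl Hdl) as [N HN].
  destruct (INR_unbounded B) as [N' HN'].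
  set (m := max N N').
  assert (Hm : B < INR m) by (eapply Rlt_le_trans; [exact HN'|apply le_INR, Nat.le_max_r]).
  specialize (HN m (Nat.le_max_l _ _)). specialize (HB ((1/2)^m)). rewrite Rminus_0_r in HB. specialize (HB HN).
  assert (E2 : 2^m * (1/2)^m = 1) by (rewrite <- Rpow_mult_distr; replace (2 * (1/2)) with 1 by field; apply pow1).
  assert (P2 : 0 < 2^m) by (apply pow_lt; lra).
  set (e := (1/2)^(m*m)).
  rewrite (Derive_n_ext_loc _ (fun r => 1 * w ((e * 2^m) * r + (fst (p m) - e)) (snd (p m)))) in HB.
  2:{ assert (Hd' : 0 < d / 2^m) by (apply Rdiv_lt_0_compat; lra).
      exists (mkposreal _ Hd'). intros r Hr. 
      assert (Hr' : Rabs (2^m * r - 1) < d).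
      { change (Rabs (r - (1/2)^m) < d / 2^m) in Hr. rewrite <- E2, <- Rmult_minus_distr_l, Rabs_mult, (Rabs_pos_eq (2^m)) by lra.
        apply Rmult_lt_reg_r with (/ 2^m); [apply Rinv_0_lt_compat; lra|].
        replace (2^m * Rabs (r - (1/2)^m) * / 2^m) with (Rabs (r - (1/2)^m)) by (field; lra). exact Hr. }
      unfold a, b.
      rewrite !(Series_single _ m) by (intros n Hn; rewrite (Hnear m r Hr' n Hn); ring).
      rewrite Hchi1 by lra. rewrite Rmult_1_l. f_equal; unfold e; ring. }
  assert (Hf : smoothRR (fun s => w s (snd (p m)))) by (apply (Hw (fun s => s) (fun _ => snd (p m))); smooth_tac).
  rewrite (Derive_n_affine (fun s => w s (snd (p m))) 1 (e * 2^m) (fst (p m) - e) j _ Hf) in HB.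
  replace (e * 2^m * (1/2)^m + (fst (p m) - e)) with (fst (p m)) in HB by (rewrite Rmult_assoc, E2; ring).
  destruct (Hp m) as [_ [_ Hbig]].
  rewrite Rmult_1_l, Rabs_mult in HB. rewrite Rabs_pos_eq in HB
    by (apply pow_le, Rmult_le_pos; [apply Rlt_le, pow_half_pos|lra]).
  assert (E3 : e * 2^(m*m) = 1) by (unfold e; rewrite <- Rpow_mult_distr; replace (1/2*2) with 1 by field; apply pow1).
  assert (Q : 0 < (e * 2^m)^j) by (apply pow_lt, Rmult_lt_0_compat; [apply pow_half_pos|lra]).
  assert (INR m <= (e * 2^m)^j * (INR m * (2^(m*m))^j)).
  { replace ((e * 2^m)^j * (INR m * (2^(m*m))^j)) with (INR m * ((e * 2^(m*m)) * 2^m)^j) by (rewrite !Rpow_mult_distr; ring).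
    rewrite E3, Rmult_1_l. rewrite <- (Rmult_1_r (INR m)) at 1. apply Rmult_le_compat_l; [apply pos_INR|].
    rewrite <- pow_mult. apply pow_R1_Rle. lra. }
  nra.
Qed.

(** * Scalarwise smooth curves of functions *)

Lemma braking_range eps al t : braking eps al -> 0 <= al t <= 1.
Proof.
  intros [He [_ [H0 [Hm [_ H1]]]]].
  destruct (Rle_dec t eps); [rewrite H0; lra|].
  destruct (Rle_dec (1 - eps) t); [rewrite H1; lra|].
  destruct (Hm t); lra.
Qed.

(** The [k]-th divided forward difference. It involves finitely many values of [g], so functionals
    built from it are visibly smooth along smooth families, while by the mean value theorem it
    equals a nearby value of the [k]-th derivative. *)
Fixpoint dq (k : nat) (h : R) (g : R -> R) (x : R) : R :=
  match k with O => g x | S k => dq k h (fun y => (g (y + h) - g y) / h) x end.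

Lemma smooth_shift_quotient g h : smoothRR g -> smoothRR (fun y => (g (y + h) - g y) / h).
Proof.
  intros Hg. apply smooth_mult; [|apply smooth_const]. apply smooth_minus; [|exact Hg].
  apply (smooth_comp g); [exact Hg|]. smooth_tac.
Qed.

Lemma Derive_n_shift_quotient g h j y : smoothRR g ->
  Derive_n (fun y => (g (y + h) - g y) / h) j y = (Derive_n g j (y + h) - Derive_n g j y) / h.
Proof.
  intros Hg. revert y; induction j as [|j IH]; intros y; [reflexivity|].
  simpl Derive_n at 1. rewrite (Derive_ext _ _ _ IH). apply is_derive_unique.
  apply (is_derive_ext (fun y => / h * (Derive_n g j (y + h) - Derive_n g j y))).
  { intros t. unfold Rdiv. apply Rmult_comm. }
  unfold Rdiv. rewrite Rmult_comm. apply (is_derive_scal (fun y => Derive_n g j (y + h) - Derive_n g j y)).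
  apply (is_derive_minus (V := R_NormedModule)).
  - apply is_derive_Reals.
    replace (Derive_n g (S j) (y + h)) with (Derive_n g (S j) (y + h) * 1) by ring.
    apply (derivable_pt_lim_comp (fun y => y + h) (Derive_n g j)).
    + apply is_derive_Reals. auto_derive; [exact I|ring].
    + apply is_derive_Reals, smooth_is_derive_n, Hg.
  - apply smooth_is_derive_n, Hg.
Qed.

Lemma smooth_MVT_eq f a b : smoothRR f -> a < b ->
  exists c, a <= c <= b /\ f b - f a = Derive f c * (b - a).
Proof.
  intros Hf Hab. destruct (MVT_gen f a b (Derive f)) as [c [Hc E]].
  - intros x _. apply smooth_derive, Hf.
  - intros x _. apply continuity_pt_filterlim, smooth_continuous, Hf.
  - exists c. rewrite Rmin_left, Rmax_right in Hc by lra. auto.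
Qed.

Lemma dq_MVT k h g x : smoothRR g -> 0 < h ->
  exists xi, x <= xi <= x + INR k * h /\ dq k h g x = Derive_n g k xi.
Proof.
  intros Hg Hh. revert g Hg; induction k as [|k IH]; intros g Hg.
  - exists x. split; [simpl; lra|reflexivity].
  - simpl dq. destruct (IH _ (smooth_shift_quotient g h Hg)) as [xi [Hxi E]].
    rewrite E, Derive_n_shift_quotient by exact Hg.
    destruct (smooth_MVT_eq (Derive_n g k) xi (xi + h)) as [c [Hc Ec]]; [apply smooth_Derive_n, Hg|lra|].
    exists c. rewrite S_INR. split; [lra|]. rewrite Ec. simpl. field. lra.
Qed.

Lemma smooth_dq (v : R -> R -> R) k h x :
  (forall x, smoothRR (fun t => v t x)) -> smoothRR (fun t => dq k h (v t) x).
Proof.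
  revert v; induction k as [|k IH]; intros v Hv; [apply Hv|].
  simpl. apply (IH (fun t y => (v t (y + h) - v t y) / h)). intros y.
  apply smooth_mult; [|apply smooth_const]. apply smooth_minus; apply Hv.
Qed.

Lemma smooth_sum_n (f : nat -> R -> R) N :
  (forall n, smoothRR (f n)) -> smoothRR (fun t => sum_n (fun n => f n t) N).
Proof.
  intros Hf. induction N as [|N IH].
  - apply (smooth_ext (f O)); [intros; now rewrite sum_O|apply Hf].
  - apply (smooth_ext (fun t => sum_n (fun n => f n t) N + f (S N) t)).
    + intros t. now rewrite sum_Sn.
    + apply smooth_plus; [exact IH|apply Hf].
Qed.

Lemma sum_n_nonneg_ge (a : nat -> R) m N : (forall n, 0 <= a n) -> (m <= N)%nat -> a m <= sum_n a N.
Proof.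
  intros Ha. assert (H0 : forall N, 0 <= sum_n a N).
  { induction N0 as [|N0 IH]; [rewrite sum_O; apply Ha|rewrite sum_Sn].
    change (0 <= sum_n a N0 + a (S N0)). specialize (Ha (S N0)). lra. }
  induction 1 as [|N HmN IH].
  - destruct m; [rewrite sum_O; lra|]. rewrite sum_Sn. change (a (S m) <= sum_n a m + a (S m)).
    specialize (H0 m). lra.
  - rewrite sum_Sn. change (a m <= sum_n a N + a (S N)). specialize (Ha (S N)). lra.
Qed.

(** The structure functions of the function space on the line whose generating curves are the [FS]
    families. In [weakly_smooth] they play the part of test functions. *)
Definition Ffun (Phi : (R -> R) -> R) : Prop :=
  forall w, FS w -> smoothRR (fun t => Phi (w t)).

Definition weakly_smooth (u : R -> R -> R) : Prop :=
  (forall t, smoothRR (u t)) /\ (forall Phi, Ffun Phi -> smoothRR (fun t => Phi (u t))).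

Lemma FS_smooth_l w x : FS w -> smoothRR (fun t => w t x).
Proof. intros H. apply (H (fun t => t) (fun _ => x)); smooth_tac. Qed.

Lemma FS_smooth_r w t : FS w -> smoothRR (w t).
Proof. intros H. apply (H (fun _ => t) (fun x => x)); smooth_tac. Qed.

Lemma inv_succ_eventually d : 0 < d -> exists N, forall n, (N <= n)%nat -> / INR (S n) < d.
Proof.
  intros Hd. destruct (INR_unbounded (/ d)) as [N HN]. exists N. intros n Hn.
  rewrite <- (Rinv_inv d). apply Rinv_lt_contravar.
  - apply Rmult_lt_0_compat; [apply Rinv_0_lt_compat, Hd|apply lt_0_INR; lia].
  - eapply Rlt_le_trans; [exact HN|]. apply le_INR. lia.
Qed.

(* If the claim failed along [(t_n, x_n)], the functional
   [g |-> sum_n n * theta (dq k h_n g x_n / (n+1))], with [theta] vanishing near [0],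
   would be a locally finite sum along every [FS] family, yet unbounded along [u]. *)
Lemma weakly_smooth_bounded_r eps al u : braking eps al -> weakly_smooth u ->
  forall k t0 x0, exists d B, 0 < d /\
    forall t x, Rabs (t - t0) < d -> Rabs (x - x0) < d -> Rabs (Derive_n (u t) k x) <= B.
Proof.
  intros Hal [Hu HPhi] k t0 x0. apply NNPP. intros Hno.
  assert (Hbad : forall n : nat, exists p : R * (R * R),
    Rabs (fst p - t0) < / INR (S n) /\ Rabs (fst (snd p) - x0) < / INR (S n) /\
    0 < snd (snd p) < / INR (S n) /\
    INR (S n) < Rabs (dq k (snd (snd p)) (u (fst p)) (fst (snd p)))).
  { intros n. apply NNPP. intros Hn. apply Hno.
    assert (Hi : 0 < / INR (S n)) by (apply Rinv_0_lt_compat, lt_0_INR; lia).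
    exists (/ INR (S n)), (INR (S n)). split; [exact Hi|].
    intros t x Ht Hx. apply Rnot_lt_le. intros Hlt. apply Hn.
    destruct (smooth_near (Derive_n (u t) k) x (Rabs (Derive_n (u t) k x) - INR (S n))) as [d [Hd Hnear]];
      [apply smooth_Derive_n, Hu|lra|].
    pose proof (pos_INR k) as Hk.
    (* The difference of step [h] reaches no further than [x + k * h]; this [h] keeps its
       intermediate point where the [k]-th derivative still exceeds [INR (S n)]. *)
    set (h := Rmin (/ INR (S n) / 2) (d / (2 * (INR k + 1)))).
    assert (Hh0 : 0 < h) by (apply Rmin_glb_lt; apply Rdiv_lt_0_compat; lra).
    assert (Hh1 : h <= / INR (S n) / 2) by apply Rmin_l.
    assert (Hh2 : h <= d / (2 * (INR k + 1))) by apply Rmin_r.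
    exists (t, (x, h)). simpl fst; simpl snd. repeat split; auto; try lra.
    destruct (dq_MVT k h (u t) x (Hu t) Hh0) as [xi [Hxi ->]].
    assert (Hkh : INR k * h < d).
    { apply Rle_lt_trans with (INR k * (d / (2 * (INR k + 1)))); [apply Rmult_le_compat_l; lra|].
      apply Rmult_lt_reg_r with (2 * (INR k + 1)); [lra|].
      replace (INR k * (d / (2 * (INR k + 1))) * (2 * (INR k + 1))) with (INR k * d) by (field; lra). nra. }
    specialize (Hnear xi). rewrite Rabs_pos_eq in Hnear by lra. specialize (Hnear ltac:(lra)).
    pose proof (Rabs_triang_inv (Derive_n (u t) k x) (Derive_n (u t) k xi)) as T.
    rewrite Rabs_minus_sym in T. lra. }
  destruct (choice _ Hbad) as [p Hp]. clear Hno Hbad.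
  destruct Hal as [He [Hals Hal']]. assert (Hal : braking eps al) by (repeat split; try apply He; try apply Hal'; assumption).
  (* Here [theta z] is [al (z * z)]: it vanishes for [Rabs z <= eps], as [eps * eps <= eps], and
     equals 1 for [Rabs z >= 1]. Division by [INR (S n)] sends bounded quotients into the zero
     region eventually, and the bad ones beyond 1. *)
  set (a := fun (g : R -> R) n => INR n * al ((dq k (snd (snd (p n))) g (fst (snd (p n))) / INR (S n))
                                   * (dq k (snd (snd (p n))) g (fst (snd (p n))) / INR (S n)))).
  (* The index [N] depends on [d] and [B] alone, so it serves all members of a family with a common
     local bound; this is the local finiteness. *)
  assert (Htail : forall d B, 0 < d -> exists N, forall g, smoothRR g ->
     (forall x, Rabs (x - x0) < d -> Rabs (Derive_n g k x) <= B) -> forall n, (N < n)%nat -> a g n = 0).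
  { intros d B Hd. pose proof (pos_INR k) as Hk.
    destruct (inv_succ_eventually (d / (INR k + 1))) as [N1 HN1]; [apply Rdiv_lt_0_compat; lra|].
    destruct (inv_succ_eventually (eps / (Rabs B + 1))) as [N2 HN2].
    { apply Rdiv_lt_0_compat; pose proof (Rabs_pos B); lra. }
    exists (max N1 N2). intros g Hg HB n Hn. specialize (HN1 n ltac:(lia)). specialize (HN2 n ltac:(lia)).
    destruct (Hp n) as [_ [Hx [Hh _]]].
    destruct (dq_MVT k _ g (fst (snd (p n))) Hg (proj1 Hh)) as [xi [Hxi E]].
    unfold a. rewrite E.
    assert (Hi : 0 < / INR (S n)) by (apply Rinv_0_lt_compat, lt_0_INR; lia).
    set (q := / INR (S n)) in *. 
    assert (Hkq : INR k * snd (snd (p n)) <= INR k * q) by (apply Rmult_le_compat_l; lra).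
    assert (Hq : (INR k + 1) * q < d).
    { replace d with ((INR k + 1) * (d / (INR k + 1))) by (field; lra). apply Rmult_lt_compat_l; lra. }
    assert (HBx : Rabs (Derive_n g k xi) <= B).
    { apply HB. apply Rabs_lt_between in Hx. apply Rabs_lt_between. lra. }
    assert (Rabs B = B) by (apply Rabs_pos_eq; eapply Rle_trans; [apply Rabs_pos|exact HBx]).
    assert (Hz : Rabs (Derive_n g k xi / INR (S n)) <= eps).
    { unfold Rdiv. rewrite Rabs_mult. fold q. rewrite (Rabs_pos_eq q) by lra.
      apply Rle_trans with ((Rabs B + 1) * q); [apply Rmult_le_compat_r; lra|].
      pose proof (Rabs_pos B) as HB0. replace eps with ((Rabs B + 1) * (eps / (Rabs B + 1))) by (field; lra).
      apply Rmult_le_compat_l; lra. }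
    destruct Hal' as [Z _]. rewrite Z; [ring|].
    apply Rle_trans with (eps * eps); [|nra].
    rewrite <- (Rabs_pos_eq (_ * _)) by apply Rle_0_sqr. rewrite Rabs_mult.
    apply Rmult_le_compat; auto using Rabs_pos. }
  assert (HF : Ffun (fun g => Series (a g))).
  { intros w Hw. apply smooth_local. intros t1.
    destruct (FS_loc_bounded eps al _ Hal (FS_swap _ Hw) k x0 t1) as [d [B [Hd HB]]].
    destruct (Htail d B Hd) as [N HN].
    exists d, (fun t => sum_n (fun n => a (w t) n) N). split; [exact Hd|]. split.
    - apply (smooth_sum_n (fun n t => a (w t) n)). intros n. unfold a. apply smooth_scal.
      apply (smooth_comp al); [exact Hals|].
      assert (smoothRR (fun t => dq k (snd (snd (p n))) (w t) (fst (snd (p n))))).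
      { apply smooth_dq. intros x. apply FS_smooth_l, Hw. }
      unfold Rdiv. smooth_tac.
    - intros t Ht. apply is_series_unique, is_series_finite, HN; [apply FS_smooth_r, Hw|].
      intros x Hx. apply HB; assumption. }
  destruct (smooth_bounded_near _ t0 (HPhi _ HF)) as [d [B [Hd [HB0 HB]]]].
  destruct (inv_succ_eventually d Hd) as [N1 HN1]. destruct (INR_unbounded B) as [N2 HN2].
  set (m := max N1 N2). specialize (HN1 m (Nat.le_max_l _ _)).
  assert (Hm : B < INR m) by (eapply Rlt_le_trans; [exact HN2|apply le_INR, Nat.le_max_r]).
  destruct (Hp m) as [Ht [Hx [Hh Hbig]]].
  specialize (HB (fst (p m)) ltac:(lra)). simpl in HB.
  (* The single function [u (fst (p m))] is smooth, so its series is a finite sum too. Its terms are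
     nonnegative and the [m]-th one is [INR m], above the bound [B]. *)
  destruct (smooth_bounded_near _ x0 (smooth_Derive_n _ k (Hu (fst (p m))))) as [d' [B' [Hd' [_ HB']]]].
  destruct (Htail d' B' Hd') as [N HN]. specialize (HN _ (Hu (fst (p m))) HB').
  assert (HN' : forall n, (max m N < n)%nat -> a (u (fst (p m))) n = 0) by (intros; apply HN; lia).
  rewrite (is_series_unique _ _ (is_series_finite _ _ HN')) in HB.
  assert (Ha0 : forall n, 0 <= a (u (fst (p m))) n).
  { intros n. apply Rmult_le_pos; [apply pos_INR|]. apply (braking_range eps al _ Hal). }
  pose proof (sum_n_nonneg_ge _ m (max m N) Ha0 ltac:(lia)) as Hge.
  assert (Hone : a (u (fst (p m))) m = INR m).
  { unfold a. destruct Hal' as [_ [_ [_ O]]]. rewrite O; [ring|].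
    set (z := dq k _ _ _) in *. assert (HS : 0 < INR (S m)) by (apply lt_0_INR; lia).
    assert (1 <= Rabs (z / INR (S m))).
    { unfold Rdiv. rewrite Rabs_mult, Rabs_inv, (Rabs_pos_eq (INR (S m))) by lra.
      apply Rmult_le_reg_r with (INR (S m)); [exact HS|].
      rewrite Rmult_assoc, Rinv_l, Rmult_1_r, Rmult_1_l by lra. lra. }
    rewrite <- (Rabs_pos_eq (_ * _)) by apply Rle_0_sqr. rewrite Rabs_mult. nra. }
  apply Rabs_le_between in HB. lra.
Qed.

(** * Derivatives in the curve parameter, bounded through weighted sums *)

Lemma bounded_from_tail (g : nat -> R -> R) t0 :
  (forall n, smoothRR (g n)) ->
  (exists d B N, 0 < d /\ forall n t, (N <= n)%nat -> Rabs (t - t0) < d -> Rabs (g n t) <= B) ->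
  exists d B, 0 < d /\ forall n t, Rabs (t - t0) < d -> Rabs (g n t) <= B.
Proof.
  intros Hg [d [B [N [Hd H]]]]. revert d B Hd H; induction N as [|N IH]; intros d B Hd H.
  - exists d, B. split; [exact Hd|]. intros; apply H; [lia|assumption].
  - destruct (smooth_bounded_near (g N) t0 (Hg N)) as [d' [B' [Hd' [_ H']]]].
    pose proof (Rmin_l d d'). pose proof (Rmin_r d d'). pose proof (Rmax_l B B'). pose proof (Rmax_r B B').
    apply (IH (Rmin d d') (Rmax B B')); [apply Rmin_glb_lt; assumption|].
    intros n t Hn Ht. destruct (Nat.eq_dec n N) as [->|Hne].
    + eapply Rle_trans; [apply H'|]; lra.
    + eapply Rle_trans; [apply H; [lia|]|]; lra.
Qed.

Lemma pow_half_eventually d : 0 < d -> exists N, forall n, (N <= n)%nat -> (1/2)^n < d.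
Proof.
  intros Hd. destruct (pow_lt_1_zero (1/2) ltac:(rewrite Rabs_pos_eq; lra) d Hd) as [N HN].
  exists N. intros n Hn. specialize (HN n Hn). rewrite Rabs_pos_eq in HN; [exact HN|].
  apply Rlt_le, pow_half_pos.
Qed.

(** A consequence of weak smoothness that visibly passes to the [t]-derivative, so that an induction
    on the order of the derivative can run. The geometric rates make the weighted sums of values
    instances of [Ffun]. *)
Definition smooth_sums_at (x0 : R) (v : R -> R -> R) : Prop :=
  (forall x, smoothRR (fun t => v t x)) /\
  (forall xs c, (forall n, Rabs (xs n - x0) <= (1/2)^n) -> (forall n : nat, Rabs (c n) <= (1/2)^n) ->
     smoothRR (fun t => Series (fun n => c n * v t (xs n)))) /\
  (forall t, exists d B, 0 < d /\ 0 < B /\ forall x, Rabs (x - x0) < d -> Rabs (v t x) <= B).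

Lemma weakly_smooth_sums eps al u x0 : braking eps al -> weakly_smooth u -> smooth_sums_at x0 u.
Proof.
  intros Hal [Hu HPhi]. split; [|split].
  - intros x. apply (HPhi (fun g => g x)). intros w Hw. apply FS_smooth_l, Hw.
  - intros xs c Hxs Hc. apply (HPhi (fun g => Series (fun n => c n * g (xs n)))).
    intros w Hw. apply (smooth_Series c (fun n t => w t (xs n))); [exact Hc|intro; apply FS_smooth_l, Hw|].
    intros j t0. apply (bounded_from_tail (fun n => Derive_n (fun t => w t (xs n)) j)).
    + intros n. apply smooth_Derive_n, FS_smooth_l, Hw.
    + destruct (FS_loc_bounded eps al w Hal Hw j t0 x0) as [d [B [Hd HB]]].
      destruct (pow_half_eventually d Hd) as [N HN]. exists d, B, N. split; [exact Hd|].
      intros n t Hn Ht. apply HB; [exact Ht|]. eapply Rle_lt_trans; [apply Hxs|auto].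
  - intros t. destruct (smooth_bounded_near (u t) x0 (Hu t)) as [d [B H]]. eauto.
Qed.

(* Gliding hump: the weights [kappa], once chosen, are so small that on the [n]-th
   pair of times the [n]-th summand dominates the others. *)
Lemma smooth_sums_lipschitz x0 v t0 : smooth_sums_at x0 v ->
  exists d L, 0 < d /\ forall x t t', Rabs (x - x0) < d -> Rabs (t - t0) < d -> Rabs (t' - t0) < d ->
    Rabs (v t x - v t' x) <= L * Rabs (t - t').
Proof.
  intros [Hv [Hsum Hbd]]. apply NNPP. intros Hno.
  assert (Hbad : forall d L, 0 < d -> exists x t t', Rabs (x - x0) < d /\ Rabs (t - t0) < d /\
     Rabs (t' - t0) < d /\ L * Rabs (t - t') < Rabs (v t x - v t' x)).
  { intros d L Hd. apply NNPP. intros Hn. apply Hno. exists d, L. split; [exact Hd|].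
    intros x t t' Hx Ht Ht'. apply Rnot_lt_le. intros Hlt. apply Hn. exists x, t, t'. auto. }
  clear Hno.
  (* Stage [n] receives a Lipschitz constant [Sg] of the summands already fixed (for times within 1
     of [t0]), the weight [ka] of the next one and the radius [de] its point must keep; it returns
     the point, the two times and the next state. Positivity is a premise so that every state has an
     answer and [choice] applies. In [INR n + Sg + 3], [Sg] pays for the earlier summands, 3 exceeds
     the constant 2 of the later ones, and [INR n] makes the surplus unbounded. *)
  set (good := fun (q : nat * (R * R * R)) (r : (R * R * R) * (R * R * R)) =>
    let '(n, (Sg, ka, de)) := q in let '((x, t, t'), (Sg', ka', de')) := r in
    0 < ka -> 0 < de ->
    Rabs (x - x0) < de /\ Rabs (x - x0) <= (1/2)^n /\
    Rabs (t - t0) < (1/2)^n /\ Rabs (t' - t0) < (1/2)^n /\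
    (INR n + Sg + 3) * Rabs (t - t') < ka * Rabs (v t x - v t' x) /\
    (forall s s', Rabs (s - t0) <= 1 -> Rabs (s' - t0) <= 1 ->
       ka * Rabs (v s x - v s' x) <= (Sg' - Sg) * Rabs (s - s')) /\
    0 < ka' <= ka / 2 /\ 0 < de' <= de /\
    (forall y, Rabs (y - x0) < de' -> ka' * (Rabs (v t y) + Rabs (v t' y)) <= Rabs (t - t'))).
  assert (Hex : forall q, exists r, good q r).
  { intros [n [[Sg ka] de]]. unfold good.
    destruct (Rlt_dec 0 ka) as [Hka|]; [|exists ((0,0,0),(0,0,0)); intros; exfalso; lra].
    destruct (Rlt_dec 0 de) as [Hde|]; [|exists ((0,0,0),(0,0,0)); intros; exfalso; lra].
    pose proof (pow_half_pos n) as Hn.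
    destruct (Hbad (Rmin de ((1/2)^n)) ((INR n + Sg + 3) / ka)) as [x [t [t' [Hx [Ht [Ht' Hlt]]]]]];
      [apply Rmin_glb_lt; assumption|].
    pose proof (Rmin_l de ((1/2)^n)). pose proof (Rmin_r de ((1/2)^n)).
    assert (Hlt' : (INR n + Sg + 3) * Rabs (t - t') < ka * Rabs (v t x - v t' x)).
    { apply (Rmult_lt_compat_l ka) in Hlt; [|exact Hka].
      replace (ka * ((INR n + Sg + 3) / ka * Rabs (t - t'))) with ((INR n + Sg + 3) * Rabs (t - t')) in Hlt by (field; lra).
      exact Hlt. }
    assert (HD : 0 < Rabs (t - t')).
    { apply Rabs_pos_lt. intros E. assert (t = t') by lra. subst t'.
      rewrite !Rminus_diag, Rabs_R0 in Hlt'. lra. }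
    destruct (smooth_interval_bounded (Derive (fun s => v s x)) (t0 - 1) (t0 + 1)) as [L HL];
      [lra|apply smooth_Derive, Hv|].
    destruct (Hbd t) as [d1 [B1 [Hd1 [HB1 H1]]]]. destruct (Hbd t') as [d2 [B2 [Hd2 [HB2 H2]]]].
    pose proof (Rmin_l de (Rmin d1 d2)). pose proof (Rmin_r de (Rmin d1 d2)).
    pose proof (Rmin_l d1 d2). pose proof (Rmin_r d1 d2).
    pose proof (Rmin_l (ka/2) (Rabs (t - t') / (B1 + B2))). pose proof (Rmin_r (ka/2) (Rabs (t - t') / (B1 + B2))).
    (* The next weight is so small that any point in the next radius contributes at most
       [Rabs (t - t')] between these two times; halving at each stage then sums the later
       contributions to at most twice that. *)
    exists ((x, t, t'), (Sg + ka * L, Rmin (ka/2) (Rabs (t - t') / (B1 + B2)), Rmin de (Rmin d1 d2))).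
    intros _ _. repeat split; try lra.
    - intros s s' Hs Hs'. replace (Sg + ka * L - Sg) with (ka * L) by ring. rewrite Rmult_assoc.
      apply Rmult_le_compat_l; [lra|]. apply (smooth_MVT (fun s => v s x)); [apply Hv|].
      intros c Hc. apply HL. apply Rabs_le_between in Hs. apply Rabs_le_between in Hs'.
      revert Hc. unfold Rmin, Rmax. repeat destruct Rle_dec; lra.
    - apply Rmin_glb_lt; [lra|]. apply Rdiv_lt_0_compat; lra.
    - apply Rmin_glb_lt; [lra|]. apply Rmin_glb_lt; assumption.
    - intros y Hy. specialize (H1 y ltac:(lra)). specialize (H2 y ltac:(lra)).
      apply Rle_trans with (Rabs (t - t') / (B1 + B2) * (B1 + B2)); [|right; field; lra].
      pose proof (Rabs_pos (v t y)). pose proof (Rabs_pos (v t' y)).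
      apply Rmult_le_compat; try lra.
      apply Rmin_glb; [lra|]. apply Rlt_le, Rdiv_lt_0_compat; lra. }
  destruct (choice _ Hex) as [F HF]. clear Hex Hbad.
  set (st := fix st n := match n with O => (0, 1, 1) | S n => snd (F (n, st n)) end).
  set (Sn := fun n => fst (fst (st n))). set (ka := fun n => snd (fst (st n))). set (de := fun n => snd (st n)).
  set (xs := fun n => fst (fst (fst (F (n, st n))))). set (ts := fun n => snd (fst (fst (F (n, st n))))).
  set (ts' := fun n => snd (fst (F (n, st n)))).
  assert (HG : forall n, 0 < ka n -> 0 < de n ->
    Rabs (xs n - x0) < de n /\ Rabs (xs n - x0) <= (1/2)^n /\
    Rabs (ts n - t0) < (1/2)^n /\ Rabs (ts' n - t0) < (1/2)^n /\
    (INR n + Sn n + 3) * Rabs (ts n - ts' n) < ka n * Rabs (v (ts n) (xs n) - v (ts' n) (xs n)) /\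
    (forall s s', Rabs (s - t0) <= 1 -> Rabs (s' - t0) <= 1 ->
       ka n * Rabs (v s (xs n) - v s' (xs n)) <= (Sn (S n) - Sn n) * Rabs (s - s')) /\
    0 < ka (S n) <= ka n / 2 /\ 0 < de (S n) <= de n /\
    (forall y, Rabs (y - x0) < de (S n) -> ka (S n) * (Rabs (v (ts n) y) + Rabs (v (ts' n) y)) <= Rabs (ts n - ts' n))).
  { intros n. specialize (HF (n, st n)). unfold xs, ts, ts', Sn, ka, de in *.
    change (st (S n)) with (snd (F (n, st n))).
    destruct (st n) as [[S0 k0] d0]. destruct (F (n, (S0, k0, d0))) as [[[x t] t'] [[S1 k1] d1]].
    simpl in *. exact HF. }
  assert (Hinit : Sn O = 0 /\ ka O = 1 /\ de O = 1) by (repeat split).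
  clearbody Sn ka de xs ts ts'. destruct Hinit as [IS [Ik Id]].
  assert (Hpos : forall n, 0 < ka n /\ 0 < de n).
  { induction n as [|n [H1 H2]]; [lra|]. destruct (HG n H1 H2) as [_ [_ [_ [_ [_ [_ [[H3 _] [[H4 _] _]]]]]]]]. auto. }
  assert (HG' := fun n => HG n (proj1 (Hpos n)) (proj2 (Hpos n))). clear HG HF F st good.
  assert (Hkhalf : forall n m, ka (m + n)%nat <= ka n * (1/2)^m /\ de (m + n)%nat <= de n).
  { intros n; induction m as [|m [IH1 IH2]]; [simpl; lra|].
    destruct (HG' (m + n)%nat) as [_ [_ [_ [_ [_ [_ [[_ H3] [[_ H4] _]]]]]]]]. simpl. lra. }
  assert (Hc : forall n, Rabs (ka n) <= (1/2)^n).
  { intros n. destruct (Hkhalf O n) as [H _]. rewrite Nat.add_0_r, Ik, Rmult_1_l in H.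
    destruct (Hpos n). rewrite Rabs_pos_eq; lra. }
  assert (HV := Hsum xs ka (fun n => proj1 (proj2 (HG' n))) Hc).
  destruct (smooth_bounded_near _ t0 (smooth_Derive _ HV)) as [d [B [Hd [HB0 HB]]]].
  destruct (pow_half_eventually d Hd) as [N1 HN1]. destruct (INR_unbounded B) as [N2 HN2].
  (* [sum_n a p] includes the index [p], so taking [n] as a successor makes it the sum over the
     indices strictly below [n]. *)
  set (p := max N1 N2). set (n := S p).
  assert (Hn : B < INR n) by (eapply Rlt_le_trans; [exact HN2|apply le_INR; unfold n, p; lia]).
  specialize (HN1 n ltac:(unfold n, p; lia)).
  destruct (HG' n) as [_ [_ [Ht [Ht' [Hbig [_ [_ [_ Hsmall]]]]]]]].
  assert (Hn1 := pow_half_le1 n).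
  set (D := Rabs (ts n - ts' n)) in *. assert (HD : 0 <= D) by apply Rabs_pos.
  assert (HLip : Rabs (Series (fun m => ka m * v (ts n) (xs m)) - Series (fun m => ka m * v (ts' n) (xs m))) <= B * D).
  { apply (smooth_MVT (fun t => Series (fun m => ka m * v t (xs m)))); [exact HV|].
    intros c Hcc. apply HB. apply Rabs_lt_between in Ht. apply Rabs_lt_between in Ht'. apply Rabs_lt_between.
    revert Hcc. unfold Rmin, Rmax. repeat destruct Rle_dec; lra. }
  assert (Hexs : forall t, ex_series (fun m => ka m * v t (xs m))).
  { intros t. destruct (bounded_from_tail (fun m _ => v t (xs m)) 0) as [d' [B' [Hd' HB']]].
    - intros m. apply smooth_const.
    - destruct (Hbd t) as [d1 [B1 [Hd1 [_ H1]]]]. destruct (pow_half_eventually d1 Hd1) as [N HN].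
      exists 1, B1, N. split; [lra|]. intros m _ Hm _. apply H1.
      eapply Rle_lt_trans; [apply (HG' m)|apply HN, Hm].
    - apply (ex_series_dominated _ B'). intros m. rewrite Rabs_mult, Rmult_comm.
      apply Rmult_le_compat; auto using Rabs_pos. apply (HB' m 0). rewrite Rminus_0_r, Rabs_R0. exact Hd'. }
  rewrite <- Series_minus in HLip by apply Hexs.
  set (a := fun m => ka m * v (ts n) (xs m) - ka m * v (ts' n) (xs m)) in HLip.
  assert (Ha : forall m, Rabs (a m) = ka m * Rabs (v (ts n) (xs m) - v (ts' n) (xs m))).
  { intros m. unfold a. rewrite <- Rmult_minus_distr_l, Rabs_mult, (Rabs_pos_eq (ka m)); [reflexivity|].
    apply Rlt_le, Hpos. }
  assert (Hhead : forall m, Rabs (sum_n a m) <= Sn (S m) * D).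
  { assert (Hm : forall m, Rabs (a m) <= (Sn (S m) - Sn m) * D).
    { intros m. rewrite Ha. apply (HG' m); lra. }
    induction m as [|m IH].
    - rewrite sum_O. specialize (Hm O). rewrite IS in Hm. lra.
    - rewrite sum_Sn. eapply Rle_trans; [apply Rabs_triang|]. specialize (Hm (S m)). lra. }
  assert (Hexa : ex_series a) by (apply (ex_series_minus (V := R_NormedModule)); apply Hexs).
  rewrite (Series_incr_n a (S n)) in HLip by (lia || exact Hexa).
  rewrite <- sum_n_Reals in HLip. simpl pred in HLip. change (sum_n a n) with (sum_n a (S p)) in HLip. rewrite sum_Sn in HLip. fold n in HLip.
  assert (Htail : Rabs (Series (fun k => a (S n + k)%nat)) <= 2 * D).
  { apply Series_dominated. intros k. rewrite Ha.
    destruct (Hkhalf (S n) k) as [K1 K2]. rewrite Nat.add_comm in K1, K2.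
    destruct (Hpos (S n + k)%nat) as [K0 _].
    specialize (Hsmall (xs (S n + k)%nat)).
    assert (Hx : Rabs (xs (S n + k)%nat - x0) < de (S n)) by (destruct (HG' (S n + k)%nat); lra).
    specialize (Hsmall Hx).
    apply Rle_trans with ((ka (S n) * (1/2)^k) * (Rabs (v (ts n) (xs (S n + k)%nat)) + Rabs (v (ts' n) (xs (S n + k)%nat)))).
    - apply Rmult_le_compat; [lra|apply Rabs_pos|exact K1|].
      eapply Rle_trans; [apply Rabs_triang|]. rewrite Rabs_Ropp. lra.
    - replace (D * (1/2)^k) with ((1/2)^k * D) by ring.
      replace (ka (S n) * (1/2)^k) with ((1/2)^k * ka (S n)) by ring. rewrite Rmult_assoc.
      apply Rmult_le_compat_l; [apply Rlt_le, pow_half_pos|exact Hsmall]. }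
  specialize (Hhead p). rewrite <- Ha in Hbig.
  change (Rabs (sum_n a p + a n + Series (fun k => a (S n + k)%nat)) <= B * D) in HLip. fold n in Hhead.
  assert (Rabs (a n) <= B * D + Sn n * D + 2 * D).
  { replace (a n) with ((sum_n a p + a n + Series (fun k => a (S n + k)%nat)) - sum_n a p - Series (fun k => a (S n + k)%nat)) by ring.
    eapply Rle_trans; [apply Rabs_triang|]. rewrite Rabs_Ropp.
    apply Rplus_le_compat; [|exact Htail].
    eapply Rle_trans; [apply Rabs_triang|]. rewrite Rabs_Ropp. lra. }
  nra.
Qed.

Lemma Derive_le_lipschitz f t0 L d : smoothRR f -> 0 < d ->
  (forall t, Rabs (t - t0) < d -> Rabs (f t - f t0) <= L * Rabs (t - t0)) -> Rabs (Derive f t0) <= L.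
Proof.
  intros Hf Hd HL. apply Rnot_lt_le. intros Hlt.
  pose proof (smooth_derive f t0 Hf) as Df. apply is_derive_Reals in Df.
  destruct (Df (Rabs (Derive f t0) - L)) as [e He]; [lra|].
  pose proof (cond_pos e). pose proof (Rmin_l e d). pose proof (Rmin_r e d).
  assert (0 < Rmin e d) by (apply Rmin_glb_lt; assumption).
  set (h := Rmin e d / 2). assert (Hh : 0 < h) by (unfold h; lra).
  specialize (He h ltac:(lra)). rewrite (Rabs_pos_eq h) in He by lra. specialize (He ltac:(unfold h; lra)).
  specialize (HL (t0 + h)). replace (t0 + h - t0) with h in HL by ring. rewrite (Rabs_pos_eq h) in HL by lra.
  specialize (HL ltac:(unfold h; lra)).
  assert (Rabs ((f (t0 + h) - f t0) / h) <= L).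
  { unfold Rdiv. rewrite Rabs_mult, Rabs_inv, (Rabs_pos_eq h) by lra.
    apply Rmult_le_reg_r with h; [exact Hh|]. rewrite Rmult_assoc, Rinv_l, Rmult_1_r by lra. exact HL. }
  pose proof (Rabs_triang_inv (Derive f t0) ((f (t0 + h) - f t0) / h)) as T.
  rewrite Rabs_minus_sym in T. lra.
Qed.

(** The Lipschitz constant is common to a whole box: it spreads the bound at the single time [t0] to
    nearby times and dominates the [t]-derivative. *)
Lemma smooth_sums_bounded x0 v : smooth_sums_at x0 v -> forall t0,
  exists d B, 0 < d /\ forall t x, Rabs (t - t0) < d -> Rabs (x - x0) < d ->
    Rabs (v t x) <= B /\ Rabs (Derive (fun s => v s x) t) <= B.
Proof.
  intros Hv t0. destruct (smooth_sums_lipschitz x0 v t0 Hv) as [d [L [Hd HL]]].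
  destruct Hv as [Hv [_ Hbd]]. destruct (Hbd t0) as [d' [B [Hd' [HB0 HB]]]].
  pose proof (Rmin_l d d'). pose proof (Rmin_r d d').
  assert (Hm : 0 < Rmin d d') by (apply Rmin_glb_lt; assumption).
  exists (Rmin d d'), (B + Rabs L * d + Rabs L). split; [exact Hm|].
  intros t x Ht Hx. pose proof (Rabs_pos L). pose proof (Rle_abs L).
  specialize (HB x ltac:(lra)).
  assert (0 <= Rabs L * d) by (apply Rmult_le_pos; lra). split.
  - assert (HLt := HL x t t0 ltac:(lra) ltac:(lra) ltac:(rewrite Rminus_diag, Rabs_R0; lra)).
    replace (v t x) with ((v t x - v t0 x) + v t0 x) by ring. eapply Rle_trans; [apply Rabs_triang|].
    assert (L * Rabs (t - t0) <= Rabs L * d) by (apply Rle_trans with (Rabs L * Rabs (t - t0));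
      [apply Rmult_le_compat_r; [apply Rabs_pos|lra]|apply Rmult_le_compat_l; lra]).
    lra.
  - apply Rle_trans with L; [|lra].
    apply (Derive_le_lipschitz _ t L (Rmin d d' - Rabs (t - t0))); [apply Hv|lra|].
    intros s Hs. apply HL; try lra. replace (s - t0) with ((s - t) + (t - t0)) by ring.
    eapply Rle_lt_trans; [apply Rabs_triang|]. lra.
Qed.

(** The bound on the [t]-derivative, uniform in [x], permits termwise differentiation, so a weighted
    sum of derivatives is the derivative of a smooth sum. *)
Lemma smooth_sums_Derive x0 v :
  smooth_sums_at x0 v -> smooth_sums_at x0 (fun t x => Derive (fun s => v s x) t).
Proof.
  intros Hv. pose proof (smooth_sums_bounded x0 v Hv) as Hb. destruct Hv as [Hv [Hsum Hbd]].
  split; [|split].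
  - intros x. apply (smooth_Derive (fun t => v t x)), Hv.
  - intros xs c Hxs Hc.
    apply (smooth_ext (Derive (fun t => Series (fun n => c n * v t (xs n))))); [|apply smooth_Derive, Hsum; assumption].
    intros t. apply is_derive_unique.
    destruct (Hb t) as [d [B [Hd HB]]]. destruct (pow_half_eventually d Hd) as [N HN].
    destruct (bounded_from_tail (fun n s => v s (xs n)) t) as [d0 [B0 [Hd0 H0]]]; [intro; apply Hv| |].
    { exists d, B, N. split; [exact Hd|]. intros n s Hn Hs. apply HB; [exact Hs|].
      eapply Rle_lt_trans; [apply Hxs|auto]. }
    destruct (bounded_from_tail (fun n s => Derive (fun s => v s (xs n)) s) t) as [d1 [B1 [Hd1 H1]]];
      [intro; apply smooth_Derive, Hv| |].
    { exists d, B, N. split; [exact Hd|]. intros n s Hn Hs. apply HB; [exact Hs|].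
      eapply Rle_lt_trans; [apply Hxs|auto]. }
    pose proof (Rmin_l d0 d1). pose proof (Rmin_r d0 d1). pose proof (Rmax_l B0 B1). pose proof (Rmax_r B0 B1).
    apply (is_derive_Series c (fun n s => v s (xs n)) t (Rmin d0 d1) (Rmax B0 B1)); auto.
    + apply Rmin_glb_lt; assumption.
    + intros n s Hs. eapply Rle_trans; [apply (H0 n s)|]; lra.
    + intros n s Hs. eapply Rle_trans; [apply (H1 n s)|]; lra.
  - intros t. destruct (Hb t) as [d [B [Hd HB]]]. exists d, (Rabs B + 1). split; [exact Hd|].
    pose proof (Rabs_pos B). pose proof (Rle_abs B). split; [lra|].
    intros x Hx. destruct (HB t x) as [_ H1]; [rewrite Rminus_diag, Rabs_R0; lra|exact Hx|]. lra.
Qed.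

Lemma weakly_smooth_bounded_l eps al u : braking eps al -> weakly_smooth u ->
  forall j t0 x0, exists d B, 0 < d /\
    forall t x, Rabs (t - t0) < d -> Rabs (x - x0) < d -> Rabs (Derive_n (fun s => u s x) j t) <= B.
Proof.
  intros Hal Hu j t0 x0.
  assert (H : smooth_sums_at x0 (fun t x => Derive_n (fun s => u s x) j t)).
  { induction j as [|j IH]; [exact (weakly_smooth_sums eps al u x0 Hal Hu)|].
    exact (smooth_sums_Derive x0 _ IH). }
  destruct (smooth_sums_bounded x0 _ H t0) as [d [B [Hd HB]]]. exists d, B. split; [exact Hd|].
  intros t x Ht Hx. apply HB; assumption.
Qed.

(** * Mixed derivatives from pure ones *)

(** On a window of length [h] the mean value theorem finds a point where
    [h * Rabs (Derive g c) <= 2 * A0]; the second derivative carries this to [x]. The condition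
    [2 * h <= b - a] lets the window start or end at [x]. *)
Lemma landau_step g a b h A0 A2 : smoothRR g -> 0 < h -> 2 * h <= b - a ->
  (forall x, a <= x <= b -> Rabs (g x) <= A0) ->
  (forall x, a <= x <= b -> Rabs (Derive_n g 2 x) <= A2) ->
  forall x, a <= x <= b -> h * Rabs (Derive g x) <= 2 * A0 + h * h * A2.
Proof.
  intros Hg Hh Hab H0 H2 x Hx.
  assert (Key : forall p q, a <= p -> p < q -> q <= b -> q - p = h -> x = p \/ x = q ->
     h * Rabs (Derive g x) <= 2 * A0 + h * h * A2).
  { intros p q Hp Hpq Hq E Hxe.
    destruct (smooth_MVT_eq g p q Hg Hpq) as [c [Hc Ec]]. rewrite E in Ec.
    assert (T1 : Rabs (Derive g c) * h <= 2 * A0).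
    { rewrite <- (Rabs_pos_eq h) by lra. rewrite <- Rabs_mult, <- Ec.
      eapply Rle_trans; [apply Rabs_triang|]. rewrite Rabs_Ropp.
      pose proof (H0 p ltac:(lra)). pose proof (H0 q ltac:(lra)). lra. }
    assert (HA2 : 0 <= A2) by (eapply Rle_trans; [apply Rabs_pos|apply (H2 x Hx)]).
    assert (T2 : Rabs (Derive g x - Derive g c) <= A2 * h).
    { apply Rle_trans with (A2 * Rabs (x - c)).
      - apply smooth_MVT; [apply smooth_Derive, Hg|]. intros z Hz. apply H2.
        revert Hz. unfold Rmin, Rmax. repeat destruct Rle_dec; lra.
      - apply Rmult_le_compat_l; [exact HA2|]. apply Rabs_le. lra. }
    assert (T3 : Rabs (Derive g x) <= Rabs (Derive g c) + A2 * h).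
    { replace (Derive g x) with (Derive g c + (Derive g x - Derive g c)) by ring.
      eapply Rle_trans; [apply Rabs_triang|]. lra. }
    apply (Rmult_le_compat_l h) in T3; [|lra]. lra. }
  destruct (Rle_dec (x + h) b).
  - apply (Key x (x + h)); lra.
  - apply (Key (x - h) x); lra.
Qed.

(* The top derivative reappears on the right with a factor 1/2 and is absorbed at its maximum. *)
Lemma landau_interpolation k eps : 0 < eps -> exists C, 0 <= C /\ forall g a b h A0 A,
  smoothRR g -> 0 < h -> h <= b - a ->
  (forall x, a <= x <= b -> Rabs (g x) <= A0) ->
  (forall x, a <= x <= b -> Rabs (Derive_n g (S (S k)) x) <= A) ->
  forall x, a <= x <= b -> h^(S k) * Rabs (Derive_n g (S k) x) <= C * A0 + eps * (h^(S (S k)) * A).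
Proof.
  revert eps; induction k as [|k IH]; intros eps Heps.
  - set (eta := Rmin eps (1/2)). assert (He : 0 < eta) by (apply Rmin_glb_lt; lra).
    assert (He1 : eta <= eps) by apply Rmin_l. assert (He2 : eta <= 1/2) by apply Rmin_r.
    exists (2 / eta). split; [apply Rlt_le, Rdiv_lt_0_compat; lra|].
    intros g a b h A0 A Hg Hh Hab H0 H2 x Hx.
    assert (HA : 0 <= A) by (eapply Rle_trans; [apply Rabs_pos|apply (H2 x Hx)]).
    assert (Heh : 0 < eta * h) by (apply Rmult_lt_0_compat; lra).
    assert (Heh' : eta * h <= 1/2 * h) by (apply Rmult_le_compat_r; lra).
    pose proof (landau_step g a b (eta * h) A0 A Hg Heh ltac:(lra) H0 H2 x Hx) as T.
    change (Derive_n g 1 x) with (Derive g x). simpl.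
    set (D := Rabs (Derive g x)) in *.
    apply Rmult_le_reg_l with eta; [exact He|].
    replace (eta * (2 / eta * A0 + eps * (h * (h * 1) * A))) with (2 * A0 + eta * eps * (h * h * A)) by (field; lra).
    replace (eta * (h * 1 * D)) with (eta * h * D) by ring.
    assert (HZ : 0 <= h * h * A) by (apply Rmult_le_pos; nra).
    replace (eta * h * (eta * h) * A) with (eta * eta * (h * h * A)) in T by ring.
    assert (eta * eta * (h * h * A) <= eta * eps * (h * h * A)) by (apply Rmult_le_compat_r; nra). lra.
  (* Absorbing half of the top term doubles the rest, hence [eps / 2]; the bound 1/2 makes the
     window [eta * h] fit. The induction hypothesis is taken at [eta / 4] because [landau_step]
     doubles the bound it receives. *)
  - set (eta := Rmin (eps / 2) (1/2)). assert (He : 0 < eta) by (apply Rmin_glb_lt; lra).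
    assert (He1 : eta <= eps / 2) by apply Rmin_l. assert (He2 : eta <= 1/2) by apply Rmin_r.
    destruct (IH (eta / 4) ltac:(lra)) as [C [HC HL]].
    exists (4 * C / eta). split; [apply Rle_div_r; nra|].
    intros g a b h A0 A Hg Hh Hab H0 HA x Hx.
    assert (HA' : 0 <= A) by (eapply Rle_trans; [apply Rabs_pos|apply (HA x Hx)]).
    destruct (continuity_ab_maj (fun x => Rabs (Derive_n g (S (S k)) x)) a b) as [xm [HM Hxm]]; [lra| |].
    { intros c _. apply (continuity_pt_comp (Derive_n g (S (S k))) Rabs).
      - apply continuity_pt_filterlim, smooth_continuous, smooth_Derive_n, Hg.
      - apply Rcontinuity_abs. }
    set (M := Rabs (Derive_n g (S (S k)) xm)) in *. assert (M0 : 0 <= M) by apply Rabs_pos.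
    assert (Hk : 0 < h^(S k)) by (apply pow_lt, Hh).
    specialize (HL g a b h A0 M Hg Hh Hab H0 HM).
    set (A1 := (C * A0 + eta / 4 * (h^(S (S k)) * M)) / h^(S k)).
    assert (HA1 : forall x, a <= x <= b -> Rabs (Derive_n g (S k) x) <= A1).
    { intros z Hz. specialize (HL z Hz). unfold A1. apply Rle_div_r; [exact Hk|]. lra. }
    assert (T : forall x, a <= x <= b ->
       eta * (h^(S (S k)) * Rabs (Derive_n g (S (S k)) x)) <= 2 * C * A0 + eta / 2 * (h^(S (S k)) * M) + eta * eta * (h^(S (S (S k))) * A)).
    { intros z Hz.
      assert (Heh : 0 < eta * h) by (apply Rmult_lt_0_compat; lra).
      assert (Heh' : eta * h <= 1/2 * h) by (apply Rmult_le_compat_r; lra).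
      pose proof (landau_step (Derive_n g (S k)) a b (eta * h) A1 A (smooth_Derive_n _ _ Hg) Heh ltac:(lra) HA1) as L.
      assert (L' := L ltac:(intros; apply HA; assumption) z Hz). clear L.
      change (Derive (Derive_n g (S k)) z) with (Derive_n g (S (S k)) z) in L'.
      apply (Rmult_le_compat_l (h^(S k))) in L'; [|lra].
      replace (h^(S k) * (2 * A1 + eta * h * (eta * h) * A)) with
         (2 * C * A0 + eta / 2 * (h^(S (S k)) * M) + eta * eta * (h^(S (S (S k))) * A)) in L'.
      - eapply Rle_trans; [|exact L']. right. simpl. ring.
      - unfold A1. simpl. field. split; [apply pow_nonzero|]; lra. }
    assert (Tm := T xm Hxm). fold M in Tm.
    set (Q := h^(S (S k)) * M) in *. set (Z := h^(S (S (S k))) * A) in *.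
    assert (HZ : 0 <= Z) by (apply Rmult_le_pos; [apply pow_le; lra|exact HA']).
    apply Rle_trans with Q; [apply Rmult_le_compat_l; [apply pow_le; lra|apply HM, Hx]|].
    apply Rmult_le_reg_l with eta; [exact He|].
    replace (eta * (4 * C / eta * A0 + eps * Z)) with (4 * C * A0 + eta * eps * Z) by (field; lra).
    assert (eta * eta * Z <= eta * (eps / 2) * Z) by (apply Rmult_le_compat_r; nra). lra.
Qed.

(** Descends from the top order to the first one by [landau_interpolation] with constant 1, so the
    coefficient of the top term stays 1 and only [C] accumulates. *)
Lemma landau_first k : exists C, 0 <= C /\ forall g a b h A0 A,
  smoothRR g -> 0 < h -> h <= b - a ->
  (forall x, a <= x <= b -> Rabs (g x) <= A0) ->
  (forall x, a <= x <= b -> Rabs (Derive_n g (S (S k)) x) <= A) ->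
  forall x, a <= x <= b -> h * Rabs (Derive g x) <= C * A0 + h^(S (S k)) * A.
Proof.
  induction k as [|k [C [HC IH]]].
  - destruct (landau_interpolation 0 1 Rlt_0_1) as [C [HC H]]. exists C. split; [exact HC|].
    intros g a b h A0 A Hg Hh Hab H0 HA x Hx. specialize (H g a b h A0 A Hg Hh Hab H0 HA x Hx).
    change (Derive_n g 1 x) with (Derive g x) in H. rewrite pow_1, Rmult_1_l in H. exact H.
  - destruct (landau_interpolation (S k) 1 Rlt_0_1) as [C' [HC' H]]. exists (C + C'). split; [lra|].
    intros g a b h A0 A Hg Hh Hab H0 HA x Hx. specialize (H g a b h A0 A Hg Hh Hab H0 HA).
    assert (Hk : 0 < h^(S (S k))) by (apply pow_lt, Hh).
    assert (HM : forall x, a <= x <= b ->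
       Rabs (Derive_n g (S (S k)) x) <= (C' * A0 + 1 * (h^(S (S (S k))) * A)) / h^(S (S k))).
    { intros z Hz. apply Rle_div_r; [exact Hk|]. specialize (H z Hz). lra. }
    specialize (IH g a b h A0 _ Hg Hh Hab H0 HM x Hx).
    eapply Rle_trans; [exact IH|]. right. simpl. field. split; [apply pow_nonzero|]; lra.
Qed.

Lemma pow_le1 x p : 0 <= x <= 1 -> x^p <= 1.
Proof. intros Hx. pose proof (pow_incr x 1 p Hx) as H. rewrite pow1 in H. exact H. Qed.

Lemma is_lim_seq_rate (u : nat -> R) (l C : R) p :
  (1 <= p)%nat -> (forall m, Rabs (u m - l) <= C * ((1/2)^m)^p) -> is_lim_seq u l.
Proof.
  intros Hp H. apply is_lim_seq_spec. intros eps.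
  destruct (pow_half_eventually (eps / (Rabs C + 1))) as [N HN].
  { apply Rdiv_lt_0_compat; [apply cond_pos|]. pose proof (Rabs_pos C). lra. }
  exists N. intros n Hn. specialize (HN n Hn). specialize (H n).
  pose proof (Rabs_pos C). pose proof (Rle_abs C). pose proof (pow_half_pos n).
  assert (((1/2)^n)^p <= (1/2)^n).
  { destruct p as [|p]; [lia|]. simpl. rewrite <- (Rmult_1_r ((1/2)^n)) at 3.
    apply Rmult_le_compat_l; [lra|]. apply pow_le1. split; [lra|apply pow_half_le1]. }
  assert (0 <= ((1/2)^n)^p) by (apply pow_le; lra).
  eapply Rle_lt_trans; [exact H|].
  apply Rle_lt_trans with ((Rabs C + 1) * (1/2)^n); [apply Rle_trans with ((Rabs C + 1) * ((1/2)^n)^p)|].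
  - apply Rmult_le_compat_r; lra.
  - apply Rmult_le_compat_l; lra.
  - apply (Rmult_lt_compat_l (Rabs C + 1)) in HN; [|lra].
    replace ((Rabs C + 1) * (eps / (Rabs C + 1))) with (pos eps) in HN by (field; lra). exact HN.
Qed.

Lemma is_lim_seq_abs_le (u : nat -> R) (l a e : R) m :
  is_lim_seq u l -> (forall n, (m <= n)%nat -> Rabs (u n - a) <= e) -> Rabs (l - a) <= e.
Proof.
  intros Hl H.
  assert (L : is_lim_seq (fun n => Rabs (u n - a)) (Rabs (l - a))).
  { apply (is_lim_seq_abs (fun n => u n - a) (l - a)).
    apply (is_lim_seq_minus' _ _ l a); [exact Hl|apply is_lim_seq_const]. }
  apply (is_lim_seq_le_loc (fun n => Rabs (u n - a)) (fun _ => e) (Rabs (l - a)) e); [|exact L|apply is_lim_seq_const].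
  exists m. exact H.
Qed.

(* Since arbitrarily high derivatives grow only like [2^(m L)], interpolation costs a single order
   of approximation per derivative. *)
Lemma approx_derive L p C A l : (2 <= p <= L)%nat -> 0 < l -> exists C', forall a b g (gm : nat -> R -> R),
  l <= b - a -> (forall m, smoothRR (gm m)) ->
  (forall m x, a < x < b -> Rabs (gm m x - g x) <= C * ((1/2)^m)^p) ->
  (forall m x, a < x < b -> Rabs (Derive_n (gm m) (2 * L) x) <= A * (2^m)^L) ->
  forall x, a < x < b -> ex_derive g x /\
    forall m, Rabs (Derive (gm m) x - Derive g x) <= C' * ((1/2)^m)^(p - 1).
Proof.
  intros Hp Hl. destruct (landau_first (2 * L - 2)) as [C0 [HC0 HL]].
  (* The hypotheses hold on the open interval only, so the interpolation takes place on a closed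
     subinterval of length [l / 4], in which every step [c * (1/2)^m] fits. *)
  set (c := Rmin 1 (l / 4)). assert (Hc : 0 < c) by (apply Rmin_glb_lt; lra).
  assert (Hc1 : c <= 1) by apply Rmin_l. assert (Hc2 : c <= l / 4) by apply Rmin_r.
  set (C1 := (C0 * (2 * C) + c * (A * (2^L + 1))) / c).
  exists (2 * C1). intros a b g gm Hab Hgm Happ HA.
  assert (Hs : forall m, 0 < (1/2)^m) by apply pow_half_pos.
  assert (HC : 0 <= C).
  { specialize (Happ O ((a + b)/2) ltac:(lra)). simpl in Happ. rewrite pow1, Rmult_1_r in Happ.
    eapply Rle_trans; [apply Rabs_pos|exact Happ]. }
  assert (HA0 : 0 <= A).
  { specialize (HA O ((a + b)/2) ltac:(lra)). simpl (2^0) in HA. rewrite pow1, Rmult_1_r in HA.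
    eapply Rle_trans; [apply Rabs_pos|exact HA]. }
  assert (H2L : 0 < 2^L) by (apply pow_lt; lra).
  assert (HC1 : 0 <= C1).
  { unfold C1. apply Rle_div_r; [exact Hc|]. rewrite Rmult_0_l.
    assert (0 <= C0 * (2 * C)) by (apply Rmult_le_pos; lra).
    assert (0 <= c * (A * (2^L + 1))) by (apply Rmult_le_pos; [lra|apply Rmult_le_pos; lra]). lra. }
  assert (Hstep : forall m x, a < x < b -> Rabs (Derive (gm (S m)) x - Derive (gm m) x) <= C1 * ((1/2)^m)^(p-1)).
  { intros m x Hx.
    set (E := fun x => gm (S m) x - gm m x).
    assert (HE : smoothRR E) by (apply smooth_minus; apply Hgm).
    assert (HEd : forall j x, Derive_n E j x = Derive_n (gm (S m)) j x - Derive_n (gm m) j x).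
    { intros j z. revert z; induction j as [|j IH]; intros z; [reflexivity|].
      simpl. rewrite (Derive_ext _ _ _ IH). apply Derive_minus; eexists; apply smooth_is_derive_n, Hgm. }
    change (Derive (gm (S m)) x - Derive (gm m) x) with (Derive_n (gm (S m)) 1 x - Derive_n (gm m) 1 x).
    rewrite <- HEd. change (Derive_n E 1 x) with (Derive E x).
    set (s := (1/2)^m) in *. specialize (Hs m). fold s in Hs.
    assert (Hs1 : s <= 1) by apply pow_half_le1.
    assert (Ex : exists a' b', a < a' /\ a' <= x <= b' /\ b' < b /\ b' - a' = l / 4).
    { destruct (Rle_dec x ((a + b)/2)); [exists x, (x + l/4)|exists (x - l/4), x]; lra. }
    destruct Ex as [a' [b' [Ha' [Hx' [Hb' Hab']]]]].
    (* With step proportional to [s = (1/2)^m], the order [2 * L] of the high derivative turns its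
       growth [(2^m)^L] into [s^L], at most [s^p]. Both terms are then of order [s^p], and division
       by the step leaves [s^(p-1)]. *)
    assert (T := HL E a' b' (c * s) (2 * C * s^p) (A * (2^L + 1) * (2^m)^L) HE).
    assert (Hcs : 0 < c * s) by (apply Rmult_lt_0_compat; assumption).
    assert (Hcs1 : c * s <= b' - a') by nra.
    specialize (T Hcs Hcs1).
    assert (Hsp : s^p = s * s^(p-1)) by (replace p with (S (p-1)) at 1 by lia; reflexivity).
    assert (Hpp : 0 <= s^p) by (apply pow_le; lra).
    apply Rmult_le_reg_l with (c * s); [exact Hcs|].
    eapply Rle_trans; [apply (T)|].
    - intros z Hz. replace (E z) with ((gm (S m) z - g z) - (gm m z - g z)) by (unfold E; ring).
      eapply Rle_trans; [apply Rabs_triang|]. rewrite Rabs_Ropp.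
      assert (H1 := Happ (S m) z ltac:(lra)). assert (H2 := Happ m z ltac:(lra)). fold s in H2.
      assert (((1/2)^(S m))^p <= s^p).
      { apply pow_incr. simpl. fold s. lra. }
      assert (C * ((1/2)^(S m))^p <= C * s^p) by (apply Rmult_le_compat_l; lra). lra.
    - intros z Hz. replace (S (S (2 * L - 2))) with (2 * L)%nat by lia. rewrite HEd.
      eapply Rle_trans; [apply Rabs_triang|]. rewrite Rabs_Ropp.
      assert (H1 := HA (S m) z ltac:(lra)). assert (H2 := HA m z ltac:(lra)).
      replace ((2^(S m))^L) with (2^L * (2^m)^L) in H1 by (simpl; rewrite Rpow_mult_distr; ring). lra.
    - exact Hx'.
    - replace (S (S (2 * L - 2))) with (2 * L)%nat by lia.
      assert (Hc2L : (c * s)^(2 * L) * (2^m)^L <= c * s^p).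
      { rewrite Rpow_mult_distr. replace (2 * L)%nat with (L + L)%nat at 2 by lia. rewrite pow_add.
        assert (E1 : s^L * (2^m)^L = 1).
        { rewrite <- Rpow_mult_distr. unfold s. rewrite <- Rpow_mult_distr. replace (1/2*2) with 1 by field. now rewrite !pow1. }
        replace (c^(2*L) * (s^L * s^L) * (2^m)^L) with (c^(2*L) * s^L * (s^L * (2^m)^L)) by ring.
        rewrite E1, Rmult_1_r. apply Rmult_le_compat; try (apply pow_le; lra).
        - replace (2 * L)%nat with (S (2 * L - 1)) by lia. simpl pow. rewrite <- (Rmult_1_r c) at 3.
          apply Rmult_le_compat_l; [lra|]. apply pow_le1. lra.
        - replace L with (p + (L - p))%nat by lia. rewrite pow_add. rewrite <- (Rmult_1_r (s^p)) at 2.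
          apply Rmult_le_compat_l; [exact Hpp|]. apply pow_le1. lra. }
      replace (c * s * (C1 * s^(p-1))) with (c * C1 * s^p) by (rewrite Hsp; ring).
      replace (c * C1) with (C0 * (2 * C) + c * (A * (2^L + 1))) by (unfold C1; field; lra).
      replace ((c * s)^(2*L) * (A * (2^L + 1) * (2^m)^L)) with (A * (2^L + 1) * ((c * s)^(2*L) * (2^m)^L)) by ring.
      apply (Rmult_le_compat_l (A * (2^L + 1))) in Hc2L; [|apply Rmult_le_pos; lra]. lra. }
  assert (Hcauchy : forall x, a < x < b -> forall m n, (m <= n)%nat ->
     Rabs (Derive (gm n) x - Derive (gm m) x) <= 2 * C1 * ((1/2)^m)^(p-1)).
  { intros x Hx m n Hmn. replace n with (n - m + m)%nat by lia. generalize (n - m)%nat. clear n Hmn. intros n.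
    assert (H0 : 0 <= ((1/2)^m)^(p-1)) by (apply pow_le, Rlt_le, Hs).
    (* A partial geometric sum; the ratio is at most 1/2 because [p >= 2]. *)
    assert (T : Rabs (Derive (gm (n + m)%nat) x - Derive (gm m) x) <= (2 - 2 * (1/2)^n) * (C1 * ((1/2)^m)^(p-1))).
    { induction n as [|n IH]; [simpl; rewrite Rminus_diag, Rabs_R0; lra|].
      specialize (Hstep (n + m)%nat x Hx).
      assert (Hgeo : ((1/2)^(n+m))^(p-1) <= (1/2)^n * ((1/2)^m)^(p-1)).
      { rewrite pow_add, Rpow_mult_distr. apply Rmult_le_compat_r; [exact H0|].
        replace (p - 1)%nat with (S (p - 2)) by lia. simpl. rewrite <- (Rmult_1_r ((1/2)^n)) at 3.
        apply Rmult_le_compat_l; [apply Rlt_le, Hs|]. apply pow_le1.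
        split; [apply Rlt_le, Hs|apply pow_half_le1]. }
      apply (Rmult_le_compat_l C1) in Hgeo; [|exact HC1].
      simpl Nat.add. replace (Derive (gm (S (n + m))) x - Derive (gm m) x) with
        ((Derive (gm (S (n + m))) x - Derive (gm (n + m)%nat) x) + (Derive (gm (n + m)%nat) x - Derive (gm m) x)) by ring.
      eapply Rle_trans; [apply Rabs_triang|]. simpl pow at 1. lra. }
    eapply Rle_trans; [exact T|].
    assert (0 <= C1 * ((1/2)^m)^(p-1)) by (apply Rmult_le_pos; assumption).
    specialize (Hs n). nra. }
  intros x Hx.
  assert (Hlim : exists G : R, is_lim_seq (fun n => Derive (gm n) x) G).
  { destruct (proj2 (ex_lim_seq_cauchy_corr (fun n => Derive (gm n) x))) as [G HG]; [|exists G; exact HG].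
    intros eps.
    assert (Z : is_lim_seq (fun m => 2 * C1 * ((1/2)^m)^(p-1)) 0).
    { apply (is_lim_seq_rate _ 0 (2 * C1) (p-1)); [lia|]. intros m. rewrite Rminus_0_r, Rabs_pos_eq; [lra|].
      apply Rmult_le_pos; [lra|apply pow_le, Rlt_le, Hs]. }
    apply is_lim_seq_spec in Z. destruct (Z (pos_div_2 eps)) as [N HN].
    specialize (HN N (le_n N)). rewrite Rminus_0_r in HN. apply Rabs_lt_between in HN. simpl in HN.
    exists N. intros n m Hn Hm. assert (H1 := Hcauchy x Hx N n Hn). assert (H2 := Hcauchy x Hx N m Hm).
    replace (Derive (gm n) x - Derive (gm m) x) with
      ((Derive (gm n) x - Derive (gm N) x) - (Derive (gm m) x - Derive (gm N) x)) by ring.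
    eapply Rle_lt_trans; [apply Rabs_triang|]. rewrite Rabs_Ropp. lra. }
  destruct Hlim as [G HG].
  assert (HGm : forall m, Rabs (G - Derive (gm m) x) <= 2 * C1 * ((1/2)^m)^(p-1)).
  { intros m. apply (is_lim_seq_abs_le _ _ _ _ m HG). intros n Hn. apply Hcauchy; assumption. }
  assert (Hder : is_derive g x G).
  { apply is_derive_Reals. intros eps Heps.
    assert (Z : is_lim_seq (fun m => 2 * C1 * ((1/2)^m)^(p-1)) 0).
    { apply (is_lim_seq_rate _ 0 (2 * C1) (p-1)); [lia|]. intros m. rewrite Rminus_0_r, Rabs_pos_eq; [lra|].
      apply Rmult_le_pos; [lra|apply pow_le, Rlt_le, Hs]. }
    apply is_lim_seq_spec in Z. assert (He4 : 0 < eps / 4) by lra.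
    destruct (Z (mkposreal _ He4)) as [m Hm]. specialize (Hm m (le_n m)).
    rewrite Rminus_0_r in Hm. apply Rabs_lt_between in Hm. simpl in Hm.
    set (e := 2 * C1 * ((1/2)^m)^(p-1)) in *.
    pose proof (smooth_derive (gm m) x (Hgm m)) as Dm. apply is_derive_Reals in Dm.
    destruct (Dm (eps/4) He4) as [d Hd].
    assert (Hr : 0 < Rmin d (Rmin (x - a) (b - x))).
    { apply Rmin_glb_lt; [apply cond_pos|]. apply Rmin_glb_lt; lra. }
    exists (mkposreal _ Hr). intros h Hh Hhd. simpl in Hhd.
    pose proof (Rmin_l d (Rmin (x - a) (b - x))). pose proof (Rmin_r d (Rmin (x - a) (b - x))).
    pose proof (Rmin_l (x - a) (b - x)). pose proof (Rmin_r (x - a) (b - x)).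
    specialize (Hd h Hh ltac:(lra)).
    assert (Hy : a < x + h < b) by (assert (Hz : Rabs h < Rmin (x - a) (b - x)) by lra; apply Rabs_lt_between in Hz; lra).
    (* Obtained as the limit in [n] of the mean value estimate for [gm n - gm m], since nothing is
       known yet about a derivative of [g]. *)
    assert (Hdiff : Rabs ((g (x + h) - g x) - (gm m (x + h) - gm m x)) <= e * Rabs h).
    { apply (is_lim_seq_abs_le (fun n => gm n (x + h) - gm n x) _ _ _ m).
      - apply (is_lim_seq_minus' (fun n => gm n (x + h)) (fun n => gm n x));
          apply (is_lim_seq_rate _ _ C p); try lia; intros n; apply Happ; assumption.
      - intros n Hn.
        replace (gm n (x + h) - gm n x - (gm m (x + h) - gm m x)) with
          ((gm n (x + h) - gm m (x + h)) - (gm n x - gm m x)) by ring.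
        replace (Rabs h) with (Rabs (x + h - x)) by (f_equal; ring).
        apply (smooth_MVT (fun z => gm n z - gm m z)); [apply smooth_minus; apply Hgm|].
        intros z Hz. rewrite Derive_minus by (eexists; apply smooth_derive, Hgm).
        apply Hcauchy; [|exact Hn]. revert Hz. unfold Rmin, Rmax. repeat destruct Rle_dec; lra. }
    specialize (HGm m). fold e in HGm.
    replace ((g (x + h) - g x) / h - G) with
      (((g (x + h) - g x) - (gm m (x + h) - gm m x)) / h + ((gm m (x + h) - gm m x) / h - Derive (gm m) x)
        - (G - Derive (gm m) x)) by (field; exact Hh).
    assert (T : Rabs (((g (x + h) - g x) - (gm m (x + h) - gm m x)) / h) <= e).
    { unfold Rdiv. rewrite Rabs_mult, Rabs_inv. apply Rmult_le_reg_r with (Rabs h); [apply Rabs_pos_lt, Hh|].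
      rewrite Rmult_assoc, Rinv_l, Rmult_1_r by (apply Rabs_no_R0, Hh). exact Hdiff. }
    eapply Rle_lt_trans; [apply Rabs_triang|]. rewrite Rabs_Ropp.
    eapply Rle_lt_trans; [apply Rplus_le_compat_r, Rabs_triang|]. lra. }
  split; [eexists; exact Hder|]. intros m. rewrite (is_derive_unique _ _ _ Hder).
  rewrite Rabs_minus_sym. apply HGm.
Qed.

(** Iterates [approx_derive], whose [2 * L] derivatives are taken on top of the [k] already used;
    hence the range up to [3 * L]. The constant is fixed before the functions, which later makes the
    bounds uniform in [t]. *)
Lemma approx_Derive_n L C (A : nat -> R) l k : 0 < l -> (k + 1 <= L)%nat -> exists C', forall a b g (gm : nat -> R -> R),
  l <= b - a -> (forall m, smoothRR (gm m)) ->
  (forall m x, a < x < b -> Rabs (gm m x - g x) <= C * ((1/2)^m)^L) ->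
  (forall m K x, (K <= 3 * L)%nat -> a < x < b -> Rabs (Derive_n (gm m) K x) <= A K * (2^m)^L) ->
  forall x, a < x < b -> (forall m, Rabs (Derive_n (gm m) k x - Derive_n g k x) <= C' * ((1/2)^m)^(L - k)) /\
     (forall i, (i < k)%nat -> ex_derive (Derive_n g i) x).
Proof.
  intros Hl. induction k as [|k IH]; intros Hk.
  - exists C. intros a b g gm Hab Hgm Happ HA x Hx. split; [|intros; lia].
    intros m. rewrite Nat.sub_0_r. apply Happ, Hx.
  - destruct IH as [C1 H1]; [lia|].
    destruct (approx_derive L (L - k) C1 (A (2 * L + k)%nat) l) as [C2 H2]; [lia|exact Hl|].
    exists C2. intros a b g gm Hab Hgm Happ HA.
    specialize (H1 a b g gm Hab Hgm Happ HA).
    specialize (H2 a b (Derive_n g k) (fun m => Derive_n (gm m) k) Hab (fun m => smooth_Derive_n _ k (Hgm m))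
      (fun m x Hx => proj1 (H1 x Hx) m)).
    intros x Hx. destruct (H2 ltac:(intros m z Hz; cbv beta; rewrite Derive_n_comp; apply HA; [lia|exact Hz]) x Hx) as [Hex Hap].
    split.
    + intros m. replace (L - S k)%nat with (L - k - 1)%nat by lia. apply Hap.
    + intros i Hi. destruct (Nat.eq_dec i k) as [->|]; [exact Hex|]. apply (H1 x Hx). lia.
Qed.

(** * Families with locally bounded pure derivatives *)

Lemma smooth_of_ex_derive_n f : (forall k x, ex_derive (Derive_n f k) x) -> smoothRR f.
Proof.
  intros H. exists (Derive_n f). split; [reflexivity|].
  intros n x. apply is_derive_Reals, Derive_correct, H.
Qed.

(** A condition on each variable separately, with bounds on boxes. It is inherited by both partial
    derivatives, which is what the smoothness of the diagonal rests on. *)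
Definition pure_bounded (u : R -> R -> R) : Prop :=
  (forall x, smoothRR (fun t => u t x)) /\ (forall t, smoothRR (u t)) /\
  (forall j t0 x0, exists d B, 0 < d /\ forall t x, Rabs (t - t0) < d -> Rabs (x - x0) < d ->
     Rabs (Derive_n (fun s => u s x) j t) <= B) /\
  (forall k t0 x0, exists d B, 0 < d /\ forall t x, Rabs (t - t0) < d -> Rabs (x - x0) < d ->
     Rabs (Derive_n (u t) k x) <= B).

Lemma pure_bounded_swap u : pure_bounded u -> pure_bounded (fun x t => u t x).
Proof.
  intros [H1 [H2 [H3 H4]]]. repeat split; auto.
  - intros j t0 x0. destruct (H4 j x0 t0) as [d [B [Hd H]]]. exists d, B. split; auto.
  - intros j t0 x0. destruct (H3 j x0 t0) as [d [B [Hd H]]]. exists d, B. split; auto.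
Qed.

Lemma common_box (Q : nat -> R -> R -> R -> Prop) (t0 x0 : R) :
  (forall k, exists d B, 0 < d /\ forall t x, Rabs (t - t0) < d -> Rabs (x - x0) < d -> Q k B t x) ->
  forall N, exists d (A : nat -> R), 0 < d /\ forall k, (k <= N)%nat ->
    forall t x, Rabs (t - t0) < d -> Rabs (x - x0) < d -> Q k (A k) t x.
Proof.
  intros H N. destruct (choice _ H) as [dd Hdd]. destruct (choice _ Hdd) as [A HA].
  assert (Hd : exists d, 0 < d /\ forall k, (k <= N)%nat -> d <= dd k).
  { induction N as [|N [d [Hd IH]]].
    - exists (dd O). split; [apply HA|]. intros k Hk. replace k with O by lia. lra.
    - exists (Rmin d (dd (S N))). split; [apply Rmin_glb_lt; [exact Hd|apply HA]|].
      intros k Hk. pose proof (Rmin_l d (dd (S N))). pose proof (Rmin_r d (dd (S N))).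
      destruct (Nat.eq_dec k (S N)) as [->|]; [lra|]. specialize (IH k ltac:(lia)). lra. }
  destruct Hd as [d [Hd Hle]]. exists d, A. split; [exact Hd|].
  intros k Hk t x Ht Hx. specialize (Hle k Hk). apply (HA k); lra.
Qed.

(* [d_t u] is the limit of the difference quotients of step [c (1/2)^(m L)]; these are close to it
   to order [step], while their [x]-derivatives only grow like [1/step]. *)
Lemma pure_bounded_mixed u k t0 x0 : pure_bounded u ->
  exists d B, 0 < d /\ forall t x, Rabs (t - t0) < d -> Rabs (x - x0) < d ->
    ex_derive (Derive_n (fun x => Derive (fun s => u s x) t) k) x /\
    Rabs (Derive_n (fun x => Derive (fun s => u s x) t) k x) <= B.
Proof.
  intros [Ht [Hx [Hbt Hbx]]].
  (* The approximation is used up to order [S k], so that the [k]-th derivative in [x] is itself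
     differentiable; this requires [S k + 1 <= L]. *)
  set (L := (k + 2)%nat).
  destruct (common_box (fun k B t x => Rabs (Derive_n (u t) k x) <= B) t0 x0 (fun k => Hbx k t0 x0) (3 * L)) as [d1 [A [Hd1 HA]]].
  destruct (Hbt 2%nat t0 x0) as [d2 [B2 [Hd2 HB2]]].
  pose proof (Rmin_l d1 d2). pose proof (Rmin_r d1 d2).
  assert (Hd0 : 0 < Rmin d1 d2) by (apply Rmin_glb_lt; assumption).
  set (d := Rmin d1 d2 / 2) in *. assert (Hd : 0 < d) by (unfold d; lra).
  set (st := fun m => d * ((1/2)^m)^L).
  assert (Hst : forall m, 0 < st m <= d).
  { intros m. pose proof (pow_half_pos m). pose proof (pow_half_le1 m). split.
    - apply Rmult_lt_0_compat; [exact Hd|]. apply pow_lt; assumption.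
    - unfold st. rewrite <- (Rmult_1_r d) at 2. apply Rmult_le_compat_l; [lra|]. apply pow_le1. lra. }
  destruct (approx_Derive_n L (B2 * d) (fun K => 2 * A K / d) (2 * d) (S k)) as [C1 H1]; [lra|unfold L; lia|].
  destruct (approx_Derive_n L (B2 * d) (fun K => 2 * A K / d) (2 * d) k) as [C0 HC0]; [lra|unfold L; lia|].
  exists d, (2 * A k / d + C0). split; [exact Hd|].
  intros t x Htt Hxx.
  set (gm := fun m x => / st m * (u (t + st m) x - u t x)).
  assert (Hgm : forall m, smoothRR (gm m)).
  { intros m. apply smooth_scal, smooth_minus; apply Hx. }
  assert (Hgd : forall m K z, Derive_n (gm m) K z = / st m * (Derive_n (u (t + st m)) K z - Derive_n (u t) K z)).
  { intros m K; induction K as [|K IH]; intros z; [reflexivity|].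
    simpl. rewrite (Derive_ext _ _ _ IH). rewrite Derive_scal. f_equal.
    apply Derive_minus; eexists; apply smooth_is_derive_n, Hx. }
  assert (Htm : forall m s, 0 <= s <= st m -> Rabs (t + s - t0) < Rmin d1 d2).
  { intros m s Hs. specialize (Hst m). apply Rabs_lt_between in Htt. apply Rabs_lt_between. unfold d in *. lra. }
  assert (Happ : forall m z, x0 - d < z < x0 + d ->
     Rabs (gm m z - Derive (fun s => u s z) t) <= B2 * d * ((1/2)^m)^L).
  { intros m z Hz. specialize (Hst m). pose proof (Htm m) as Hm.
    destruct (smooth_MVT_eq (fun s => u s z) t (t + st m)) as [c [Hc Ec]]; [apply Ht|lra|].
    unfold gm. rewrite Ec. replace (/ st m * (Derive (fun s => u s z) c * (t + st m - t)))
      with (Derive (fun s => u s z) c) by (field; lra).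
    assert (Hzd : Rabs (z - x0) < d2) by (apply Rabs_lt_between; unfold d in *; lra).
    assert (HB2' : forall s, 0 <= s <= st m -> Rabs (Derive_n (fun s => u s z) 2 (t + s)) <= B2).
    { intros s Hs. apply HB2; [|exact Hzd]. specialize (Hm s Hs). lra. }
    assert (HB0 : 0 <= B2) by (eapply Rle_trans; [apply Rabs_pos|apply (HB2' 0); lra]).
    apply Rle_trans with (B2 * Rabs (c - t)).
    - apply smooth_MVT; [apply smooth_Derive, Ht|]. intros y Hy.
      replace y with (t + (y - t)) by ring. apply HB2'.
      revert Hy. unfold Rmin, Rmax. repeat destruct Rle_dec; lra.
    - rewrite Rmult_assoc. apply Rmult_le_compat_l; [exact HB0|]. fold (st m). rewrite Rabs_pos_eq; lra. }
  assert (HA' : forall m K z, (K <= 3 * L)%nat -> x0 - d < z < x0 + d -> Rabs (Derive_n (gm m) K z) <= 2 * A K / d * (2^m)^L).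
  { intros m K z HK Hz. specialize (Hst m). pose proof (Htm m) as Hm. rewrite Hgd.
    assert (Hzd : Rabs (z - x0) < d1) by (apply Rabs_lt_between; unfold d in *; lra).
    assert (Q1 := HA K HK (t + st m) z ltac:(specialize (Hm (st m) ltac:(lra)); lra) Hzd).
    assert (Q2 := HA K HK t z ltac:(specialize (Hm 0 ltac:(lra)); rewrite Rplus_0_r in Hm; lra) Hzd).
    assert (E : 2 * A K / d * (2^m)^L = / st m * (2 * A K)).
    { assert (E1 : ((1/2)^m)^L * (2^m)^L = 1).
      { rewrite <- !Rpow_mult_distr. replace (1/2*2) with 1 by field. now rewrite !pow1. }
      unfold st. assert (P1 : 0 < ((1/2)^m)^L) by (apply pow_lt, pow_half_pos).
      apply Rmult_eq_reg_r with (((1/2)^m)^L); [|lra].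
      replace (2 * A K / d * (2^m)^L * ((1/2)^m)^L) with (2 * A K / d * (((1/2)^m)^L * (2^m)^L)) by ring.
      rewrite E1. field. split; lra. }
    rewrite E, Rabs_mult, Rabs_pos_eq by (apply Rlt_le, Rinv_0_lt_compat; lra).
    apply Rmult_le_compat_l; [apply Rlt_le, Rinv_0_lt_compat; lra|].
    eapply Rle_trans; [apply Rabs_triang|]. rewrite Rabs_Ropp. lra. }
  assert (Hxb : x0 - d < x < x0 + d) by (apply Rabs_lt_between in Hxx; lra).
  destruct (H1 (x0 - d) (x0 + d) _ gm ltac:(lra) Hgm Happ HA' x Hxb) as [_ Hex].
  destruct (HC0 (x0 - d) (x0 + d) _ gm ltac:(lra) Hgm Happ HA' x Hxb) as [Hap _].
  split; [apply Hex; lia|].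
  (* Already at [m = 0], where the step is [d], the difference quotient is within a constant of the
     limit; its own bound [2 * A k / d] gives the rest. *)
  specialize (Hap O). specialize (HA' O k x ltac:(unfold L; lia) Hxb).
  rewrite !pow_O, !pow1, Rmult_1_r in Hap, HA'.
  set (G := Derive_n (fun x => Derive (fun s => u s x) t) k x) in *.
  replace G with (Derive_n (gm O) k x - (Derive_n (gm O) k x - G)) by ring.
  eapply Rle_trans; [apply Rabs_triang|]. rewrite Rabs_Ropp. lra.
Qed.

Lemma pure_bounded_Derive u : pure_bounded u -> pure_bounded (fun t x => Derive (fun s => u s x) t).
Proof.
  intros Hu. pose proof (fun k t0 x0 => pure_bounded_mixed u k t0 x0 Hu) as Hm.
  destruct Hu as [Ht [Hx [Hbt Hbx]]]. repeat split.
  - intros x. apply (smooth_Derive (fun t => u t x)), Ht.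
  - intros t. apply smooth_of_ex_derive_n. intros k x.
    destruct (Hm k t x) as [d [B [Hd H]]]. apply (H t x); rewrite Rminus_diag, Rabs_R0; exact Hd.
  - intros j t0 x0. destruct (Hbt (S j) t0 x0) as [d [B [Hd H]]]. exists d, B. split; [exact Hd|].
    intros t x Htt Hxx. change (Rabs (Derive_n (Derive (fun s => u s x)) j t) <= B).
    rewrite Derive_n_Derive. apply H; assumption.
  - intros k t0 x0. destruct (Hm k t0 x0) as [d [B [Hd H]]]. exists d, B. split; [exact Hd|].
    intros t x Htt Hxx. apply H; assumption.
Qed.

(** The increment is split at [u r0 (r0 + h)]. The step in [t] gives a [t]-derivative at
    [(c, r0 + h)], moved to [(r0, r0 + h)] by the bound on the second [t]-derivative and then to
    [(r0, r0)] by continuity in [x], which comes from [pure_bounded_Derive]. *)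
Lemma is_derive_diag u r0 : pure_bounded u ->
  is_derive (fun r => u r r) r0 (Derive (fun s => u s r0) r0 + Derive (u r0) r0).
Proof.
  intros Hu. destruct (pure_bounded_Derive u Hu) as [_ [Hx' _]]. destruct Hu as [Ht [Hx [Hbt _]]].
  apply is_derive_Reals. intros eps Heps.
  destruct (Hbt 2%nat r0 r0) as [d1 [B [Hd1 HB]]].
  destruct (smooth_near _ r0 (eps/3) (Hx' r0)) as [d2 [Hd2 H2]]; [lra|].
  pose proof (smooth_derive (u r0) r0 (Hx r0)) as D. apply is_derive_Reals in D.
  destruct (D (eps/3)) as [d3 H3]; [lra|].
  set (d4 := eps / (3 * (Rabs B + 1))).
  assert (HBp := Rabs_pos B). assert (HBl := Rle_abs B).
  assert (Hd4 : 0 < d4) by (apply Rdiv_lt_0_compat; lra).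
  assert (Hd : 0 < Rmin (Rmin d1 d2) (Rmin d3 d4)).
  { apply Rmin_glb_lt; apply Rmin_glb_lt; auto using cond_pos. }
  exists (mkposreal _ Hd). intros h Hh Hhd. simpl in Hhd.
  pose proof (Rmin_l (Rmin d1 d2) (Rmin d3 d4)). pose proof (Rmin_r (Rmin d1 d2) (Rmin d3 d4)).
  pose proof (Rmin_l d1 d2). pose proof (Rmin_r d1 d2). pose proof (Rmin_l d3 d4). pose proof (Rmin_r d3 d4).
  specialize (H3 h Hh ltac:(lra)).
  specialize (H2 (r0 + h)). replace (r0 + h - r0) with h in H2 by ring. specialize (H2 ltac:(lra)).
  set (Dt := fun t x => Derive (fun s => u s x) t) in *.
  change (Derive (fun s => u s r0) r0) with (Dt r0 r0).
  change (Rabs (Dt r0 (r0 + h) - Dt r0 r0) < eps / 3) in H2.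
  assert (Hq : Rabs ((u (r0 + h) (r0 + h) - u r0 (r0 + h)) / h - Dt r0 (r0 + h)) <= eps / 3).
  { assert (Hmv : exists c, Rabs (c - r0) <= Rabs h /\ u (r0 + h) (r0 + h) - u r0 (r0 + h) = Dt c (r0 + h) * h).
    { destruct (MVT_gen (fun s => u s (r0 + h)) r0 (r0 + h) (Derive (fun s => u s (r0 + h)))) as [c [Hc E]].
      - intros z _. apply (smooth_derive (fun s => u s (r0 + h))), Ht.
      - intros z _. apply continuity_pt_filterlim, (smooth_continuous (fun s => u s (r0 + h))), Ht.
      - exists c. split; [revert Hc; unfold Rmin, Rmax, Rabs; repeat destruct Rle_dec; repeat destruct Rcase_abs; lra|].
        rewrite E. unfold Dt. ring. }
    destruct Hmv as [c [Hc ->]]. replace (Dt c (r0 + h) * h / h) with (Dt c (r0 + h)) by (field; exact Hh).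
    apply Rle_trans with (Rabs B * Rabs (c - r0)).
    - apply (smooth_MVT (fun t => Dt t (r0 + h))); [apply (smooth_Derive (fun t => u t (r0 + h))), Ht|].
      intros z Hz. apply Rle_trans with B; [|exact HBl].
      apply (HB z (r0 + h)).
      + apply Rle_lt_trans with (Rabs h); [|lra]. eapply Rle_trans; [|exact Hc].
        revert Hz. unfold Rmin, Rmax, Rabs. repeat destruct Rle_dec; repeat destruct Rcase_abs; lra.
      + replace (r0 + h - r0) with h by ring. lra.
    - apply Rle_trans with ((Rabs B + 1) * d4).
      + apply Rmult_le_compat; try lra. apply Rabs_pos.
      + right. unfold d4. field. lra. }
  replace ((u (r0 + h) (r0 + h) - u r0 r0) / h - (Dt r0 r0 + Derive (u r0) r0)) with
    (((u (r0 + h) (r0 + h) - u r0 (r0 + h)) / h - Dt r0 (r0 + h)) + (Dt r0 (r0 + h) - Dt r0 r0)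
      + ((u r0 (r0 + h) - u r0 r0) / h - Derive (u r0) r0)) by (field; exact Hh).
  eapply Rle_lt_trans; [apply Rabs_triang|].
  eapply Rle_lt_trans; [apply Rplus_le_compat_r, Rabs_triang|]. lra.
Qed.

Inductive diag_sum : (R -> R) -> Prop :=
| ds_base u : pure_bounded u -> diag_sum (fun r => u r r)
| ds_plus f g : diag_sum f -> diag_sum g -> diag_sum (fun r => f r + g r).

(** The derivative of a diagonal is a sum of two diagonals, of the two partial derivatives, and both
    are again [pure_bounded]; so finite sums of diagonals are stable under differentiation. *)
Lemma pure_bounded_diag u : pure_bounded u -> smoothRR (fun r => u r r).
Proof.
  intros Hu. apply (smooth_coind diag_sum); [|apply ds_base, Hu].
  clear u Hu. intros f Hf. induction Hf as [u Hu|f g _ [f' [Hf Pf]] _ [g' [Hg Pg]]].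
  - exists (fun r => Derive (fun s => u s r) r + Derive (u r) r). split.
    + intros r. apply is_derive_diag, Hu.
    + apply ds_plus.
      * apply (ds_base (fun t x => Derive (fun s => u s x) t)), pure_bounded_Derive, Hu.
      * apply (ds_base (fun t x => Derive (u t) x)).
        apply (pure_bounded_swap (fun x t => Derive (u t) x)).
        apply (pure_bounded_Derive (fun x t => u t x)), pure_bounded_swap, Hu.
  - exists (fun r => f' r + g' r). split; [|apply ds_plus; assumption].
    intros r. apply (is_derive_plus f g); auto.
Qed.

Theorem weakly_smooth_diag eps al u : braking eps al -> weakly_smooth u -> smoothRR (fun r => u r r).
Proof.
  intros Hal Hu. apply pure_bounded_diag. split; [|split; [|split]].
  - intros x. apply (weakly_smooth_sums eps al u 0 Hal Hu).
  - apply Hu.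
  - apply (weakly_smooth_bounded_l eps al u Hal Hu).
  - apply (weakly_smooth_bounded_r eps al u Hal Hu).
Qed.

(** * Cones and suspensions as final structures *)

Lemma curv_fns (X : Frol) c f : curv X c -> fns X f -> smoothRR (fun t => f (c t)).
Proof. intros Hc Hf. apply (proj1 (curv_ax X c)); assumption. Qed.

Lemma smooth_map_curv (X Y : Frol) (phi : X -> Y) :
  smooth_map X Y phi <-> forall c, curv X c -> curv Y (fun t => phi (c t)).
Proof.
  split.
  - intros H c Hc. apply curv_ax. intros f Hf. apply (curv_fns X c (fun x => f (phi x)) Hc), H, Hf.
  - intros H g Hg. apply fns_ax. intros c Hc. apply (curv_fns Y (fun t => phi (c t))); auto.
Qed.

Lemma curv_const (X : Frol) (x : X) : curv X (fun _ => x).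
Proof. apply curv_ax. intros f _. apply smooth_const. Qed.

Lemma curv_comp (X : Frol) c a : curv X c -> smoothRR a -> curv X (fun t => c (a t)).
Proof.
  intros Hc Ha. apply curv_ax. intros f Hf.
  apply (smooth_comp (fun t => f (c t))); [apply (curv_fns X); assumption|exact Ha].
Qed.

Lemma curv_local (X : Frol) (c : R -> X) :
  (forall t0, exists d c', 0 < d /\ curv X c' /\ forall t, Rabs (t - t0) < d -> c t = c' t) -> curv X c.
Proof.
  intros H. apply curv_ax. intros f Hf. apply smooth_local. intros t0.
  destruct (H t0) as [d [c' [Hd [Hc E]]]]. exists d, (fun t => f (c' t)).
  split; [exact Hd|]. split; [apply (curv_fns X); assumption|]. intros t Ht. f_equal. auto.
Qed.

Lemma curv_ext (X : Frol) (c c' : R -> X) : (forall t, c t = c' t) -> curv X c -> curv X c'.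
Proof. intros E. apply functional_extensionality in E. subst; auto. Qed.

Lemma prodF_curv (X Y : Frol) (c : R -> X * Y) :
  curv (prodF X Y) c <-> curv X (fun t => fst (c t)) /\ curv Y (fun t => snd (c t)).
Proof.
  split.
  - intros Hc; split; apply curv_ax; intros f Hf.
    + apply (Hc (fun p => f (fst p))). left. eauto.
    + apply (Hc (fun p => f (snd p))). right. eauto.
  - intros [H1 H2] g [[f [Hf E]]|[f [Hf E]]].
    + apply (smooth_ext (fun t => f (fst (c t)))); [auto|]. apply (curv_fns X _ f H1 Hf).
    + apply (smooth_ext (fun t => f (snd (c t)))); [auto|]. apply (curv_fns Y _ f H2 Hf).
Qed.

Lemma prodF_map_curv (X Y W : Frol) (H : X * Y -> W) x y :
  smooth_map (prodF X Y) W H -> curv X x -> curv Y y -> curv W (fun t => H (x t, y t)).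
Proof.
  intros HH Hx Hy. apply (proj1 (smooth_map_curv _ _ _) HH (fun t => (x t, y t))). apply prodF_curv. auto.
Qed.

(* Cartesian closedness in the form used below: a product with [genC] is again final. *)
Lemma smooth_map_prod_genC eps al (B W : Frol) (T : Type) (C0 : (R -> T) -> Prop) (H : B * T -> W) :
  braking eps al ->
  (forall c a, C0 c -> smoothRR a -> C0 (fun t => c (a t))) -> (forall q, C0 (fun _ => q)) ->
  (forall b c, curv B b -> C0 c -> curv W (fun r => H (b r, c r))) ->
  smooth_map (prodF B (genC T C0)) W H.
Proof.
  intros Hal Hrep Hcst HH. apply smooth_map_curv. intros c Hc. apply prodF_curv in Hc. destruct Hc as [Hb Hq].
  apply curv_ax. intros g Hg.
  apply (smooth_ext (fun r => g (H (fst (c r), snd (c r))))); [intros r; now rewrite <- surjective_pairing|].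
  (* Independent times for the two components: [x] for the point of [B], [t] for the point of the
     final structure. *)
  apply (weakly_smooth_diag eps al (fun t x => g (H (fst (c x), snd (c t))))); [exact Hal|]. split.
  - intros t. apply (curv_fns W (fun x => H (fst (c x), snd (c t)))); [|exact Hg].
    apply (HH _ (fun _ => snd (c t))); [exact Hb|apply Hcst].
  (* The functional produces a function on the final structure; it is a structure function as soon
     as it is smooth along the generating curves, where the hypothesis on [H] applies. *)
  - intros Phi HPhi. apply (Hq (fun p => Phi (fun x => g (H (fst (c x), p))))).
    intros c0 Hc0. apply (HPhi (fun t x => g (H (fst (c x), c0 t)))). intros a1 a2 Ha1 Ha2.
    apply (curv_fns W (fun r => H (fst (c (a2 r)), c0 (a1 r)))); [|exact Hg].
    apply HH; [apply (curv_comp B (fun x => fst (c x))); assumption|apply Hrep; assumption].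
Qed.

Lemma qproj_eq {X : Type} (Rl : X -> X -> Prop) x y :
  clos_refl_sym_trans X Rl x y -> qproj Rl x = qproj Rl y.
Proof.
  intros Hxy. apply subset_eq_compat. apply functional_extensionality. intros z.
  apply propositional_extensionality. unfold qcls. split; intros Hz.
  - eapply rst_trans; [apply rst_sym, Hxy|exact Hz].
  - eapply rst_trans; [exact Hxy|exact Hz].
Qed.

Lemma qproj_surj {X : Type} (Rl : X -> X -> Prop) q : exists x, q = qproj Rl x.
Proof. destruct q as [P [x Hx]]. exists x. apply subset_eq_compat, Hx. Qed.

Lemma qrep_proj {X : Type} (Rl : X -> X -> Prop) x : clos_refl_sym_trans X Rl x (qrep Rl (qproj Rl x)).
Proof.
  unfold qrep. destruct (constructive_indefinite_description _ _) as [y Hy]. simpl in *.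
  change (qcls Rl x y). rewrite Hy. apply rst_refl.
Qed.

Lemma qrep_compat {X Y : Type} (Rl : X -> X -> Prop) (f : X -> Y) x :
  (forall u v, Rl u v -> f u = f v) -> f (qrep Rl (qproj Rl x)) = f x.
Proof.
  intros Hf. assert (H : forall u v, clos_refl_sym_trans X Rl u v -> f u = f v).
  { induction 1; congruence || auto. }
  symmetry. apply H, qrep_proj.
Qed.

Lemma smooth_map_prod_quotF eps al (B X W : Frol) (Rl : X -> X -> Prop) (H : B * quotF X Rl -> W) :
  braking eps al ->
  (forall b c, curv B b -> curv X c -> curv W (fun r => H (b r, qproj Rl (c r)))) ->
  smooth_map (prodF B (quotF X Rl)) W H.
Proof.
  intros Hal HH. apply (smooth_map_prod_genC eps al); [exact Hal| | |].
  - intros c a [c' [Hc' E]] Ha. exists (fun t => c' (a t)). split; [apply curv_comp; assumption|auto].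
  - intros q. destruct (qproj_surj Rl q) as [x ->]. exists (fun _ => x). split; [apply curv_const|auto].
  - intros b c Hb [c' [Hc' E]]. apply (curv_ext W (fun r => H (b r, qproj Rl (c' r)))); [intro; now rewrite E|].
    apply HH; assumption.
Qed.

Lemma smooth_map_prod_sumF eps al (B X Y W : Frol) (H : B * sumF X Y -> W) :
  braking eps al ->
  (forall b x, curv B b -> curv X x -> curv W (fun r => H (b r, inl (x r)))) ->
  (forall b y, curv B b -> curv Y y -> curv W (fun r => H (b r, inr (y r)))) ->
  smooth_map (prodF B (sumF X Y)) W H.
Proof.
  intros Hal HX HY. apply (smooth_map_prod_genC eps al); [exact Hal| | |].
  - intros c a [[c' [Hc' E]]|[c' [Hc' E]]] Ha; [left|right];
      (exists (fun t => c' (a t)); split; [apply curv_comp; assumption|auto]).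
  - intros [x|y]; [left; exists (fun _ => x)|right; exists (fun _ => y)]; (split; [apply curv_const|auto]).
  - intros b c Hb [[c' [Hc' E]]|[c' [Hc' E]]].
    + apply (curv_ext W (fun r => H (b r, inl (c' r)))); [intro; now rewrite E|]. apply HX; assumption.
    + apply (curv_ext W (fun r => H (b r, inr (c' r)))); [intro; now rewrite E|]. apply HY; assumption.
Qed.

(** * Points, curves and maps of the cone and of the suspension *)

Definition cone_pt {X Y : PFrol} (f : X -> Y) (t : Iset) (x : X) : coneF f :=
  qproj (collapse (coneSet f)) (cylproj f (inl (t, x))).

Definition sig_pt {A : PFrol} (t : Iset) (a : A) : SigP A :=
  qproj (collapse (wedgeSet circP A)) (qproj (collapse endpts) t, a).

Lemma quotF_proj_curv (X : Frol) (Rl : X -> X -> Prop) c :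
  curv X c -> curv (quotF X Rl) (fun t => qproj Rl (c t)).
Proof. intros Hc f Hf. apply Hf. exists c. auto. Qed.

Lemma cone_pt_curv (X Y : PFrol) (f : X -> Y) t x :
  curv boldI t -> curv X x -> curv (coneF f) (fun r => cone_pt f (t r) (x r)).
Proof.
  intros Ht Hx. apply quotF_proj_curv, quotF_proj_curv.
  intros g Hg. apply Hg. left. exists (fun r => (t r, x r)). split; [apply prodF_curv|]; auto.
Qed.

Lemma coneJ_curv (X Y : PFrol) (f : X -> Y) y :
  curv Y y -> curv (coneF f) (fun r => coneJ f (y r)).
Proof.
  intros Hy. apply quotF_proj_curv, quotF_proj_curv.
  intros g Hg. apply Hg. right. exists y. auto.
Qed.

Lemma sig_pt_curv (A : PFrol) t a : curv boldI t -> curv A a -> curv (SigP A) (fun r => sig_pt (t r) (a r)).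
Proof.
  intros Ht Ha. apply (quotF_proj_curv (prodF circP A)). apply prodF_curv. simpl.
  split; [apply (quotF_proj_curv boldI); exact Ht|exact Ha].
Qed.

Lemma smooth_map_prod_cone eps al (B W : Frol) (X Y : PFrol) (f : X -> Y) (H : B * coneF f -> W) :
  braking eps al ->
  (forall b t x, curv B b -> curv boldI t -> curv X x -> curv W (fun r => H (b r, cone_pt f (t r) (x r)))) ->
  (forall b y, curv B b -> curv Y y -> curv W (fun r => H (b r, coneJ f (y r)))) ->
  smooth_map (prodF B (coneF f)) W H.
Proof.
  intros Hal HX HY. apply (smooth_map_prod_quotF eps al B (cylF f)); [exact Hal|]. intros b c Hb Hc.
  apply (prodF_map_curv B (cylF f) W (fun p => H (fst p, qproj (collapse (coneSet f)) (snd p)))); [|exact Hb|exact Hc].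
  clear b c Hb Hc. apply (smooth_map_prod_quotF eps al); [exact Hal|]. intros b c Hb Hc.
  apply (prodF_map_curv B _ W (fun p => H (fst p, qproj (collapse (coneSet f)) (cylproj f (snd p))))
     b c); [|exact Hb|exact Hc].
  apply (smooth_map_prod_sumF eps al); [exact Hal| |].
  - clear b c Hb Hc. intros b p Hb Hp. apply prodF_curv in Hp. destruct Hp as [Ht Hx].
    apply (curv_ext W (fun r => H (b r, cone_pt f (fst (p r)) (snd (p r))))); [|apply HX; assumption].
    intros r. unfold cone_pt. now rewrite <- surjective_pairing.
  - intros b' y Hb' Hy. apply HY; assumption.
Qed.

Lemma smooth_map_prod_sig eps al (B W : Frol) (A : PFrol) (H : B * SigP A -> W) :
  braking eps al ->
  (forall b t a, curv B b -> curv boldI t -> curv A a -> curv W (fun r => H (b r, sig_pt (t r) (a r)))) ->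
  smooth_map (prodF B (SigP A)) W H.
Proof.
  intros Hal HH. apply (smooth_map_prod_quotF eps al B (prodF circP A)); [exact Hal|]. intros b c Hb Hc.
  apply prodF_curv in Hc. destruct Hc as [Hp Ha].
  apply (curv_ext W (fun r => H (b r, qproj (collapse (wedgeSet circP A)) (fst (c r), snd (c r)))));
    [intros r; now rewrite <- surjective_pairing|].
  (* The circle inside the smash product is a quotient as well: the factors are regrouped so that
     [prodF B A] is the parameter space, and the quotient lemma applies once more. *)
  apply (prodF_map_curv (prodF B A) circP W
    (fun q => H (fst (fst q), qproj (collapse (wedgeSet circP A)) (snd q, snd (fst q)))) (fun r => (b r, snd (c r))));
    [|apply prodF_curv; auto|exact Hp].
  apply (smooth_map_prod_quotF eps al); [exact Hal|]. intros ba t Hba Ht. apply prodF_curv in Hba.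
  apply (HH (fun r => fst (ba r)) t (fun r => snd (ba r))); tauto.
Qed.

Lemma smooth_map_of_prod (B X W : Frol) (phi : X -> W) (b : B) :
  smooth_map (prodF B X) W (fun p => phi (snd p)) -> smooth_map X W phi.
Proof.
  intros H. apply smooth_map_curv. intros c Hc.
  apply (prodF_map_curv B X W _ (fun _ => b) c H); [apply curv_const|exact Hc].
Qed.

Lemma smooth_map_cone eps al (W : Frol) (X Y : PFrol) (f : X -> Y) (phi : coneF f -> W) :
  braking eps al ->
  (forall t x, curv boldI t -> curv X x -> curv W (fun r => phi (cone_pt f (t r) (x r)))) ->
  (forall y, curv Y y -> curv W (fun r => phi (coneJ f (y r)))) ->
  smooth_map (coneF f) W phi.
Proof.
  intros Hal HX HY. apply (smooth_map_of_prod Ifr _ _ _ I0).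
  apply (smooth_map_prod_cone eps al); [exact Hal| |]; intros; simpl; auto.
Qed.

Lemma smooth_map_sig eps al (W : Frol) (A : PFrol) (phi : SigP A -> W) :
  braking eps al ->
  (forall t a, curv boldI t -> curv A a -> curv W (fun r => phi (sig_pt (t r) (a r)))) ->
  smooth_map (SigP A) W phi.
Proof.
  intros Hal HA. apply (smooth_map_of_prod Ifr _ _ _ I0).
  apply (smooth_map_prod_sig eps al); [exact Hal|]. intros; simpl; auto.
Qed.

Lemma cone_pt_base (X Y : PFrol) (f : X -> Y) t x :
  proj1_sig t = 0 \/ x = ppt X -> cone_pt f t x = ppt (coneF f).
Proof.
  intros H. apply qproj_eq, rst_step. split.
  - exists t, x. auto.
  - exists I0, (ppt X). auto.
Qed.

Lemma cone_pt_end (X Y : PFrol) (f : X -> Y) t x : proj1_sig t = 1 -> cone_pt f t x = coneJ f (f x).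
Proof.
  intros H. unfold cone_pt, coneJ. f_equal. apply qproj_eq, rst_step. exists t, x. auto.
Qed.

Lemma sig_pt_base (A : PFrol) t (a : A) :
  endpts t \/ a = ppt A -> sig_pt t a = ppt (SigP A).
Proof.
  intros H. apply qproj_eq, rst_step. split; [|left; reflexivity].
  destruct H as [H|H]; [left|right; exact H]. apply qproj_eq, rst_step. split; [exact H|left; reflexivity].
Qed.

(** Follows the choice of representatives in [coneK], so that [coneK] is an instance and is computed
    by the same lemmas. *)
Definition cone_lift {X Y : PFrol} {W : Type} (f : X -> Y) (h1 : Iset * X -> W) (h2 : Y -> W) (q : coneF f) : W :=
  match qrep (cylRel f) (qrep (collapse (coneSet f)) q) with inl p => h1 p | inr y => h2 y end.

Definition sig_lift {A : PFrol} {W : Type} (h : Iset -> A -> W) (q : SigP A) : W :=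
  let r := qrep (collapse (wedgeSet circP A)) q in h (qrep (collapse endpts) (fst r)) (snd r).

Section ConeLift.
Context {X Y : PFrol} {W : Type} (f : X -> Y) (h1 : Iset * X -> W) (h2 : Y -> W) (w0 : W).
Context (H1 : forall t x, proj1_sig t = 1 -> h1 (t, x) = h2 (f x)).
Context (H0 : forall t x, proj1_sig t = 0 \/ x = ppt X -> h1 (t, x) = w0).

Lemma cyl_lift_proj u :
  match qrep (cylRel f) (cylproj f u) with inl p => h1 p | inr y => h2 y end =
  match u with inl p => h1 p | inr y => h2 y end.
Proof using H1.
  apply (qrep_compat (cylRel f) (fun u : car (sumF (prodF boldI X) Y) => match u with inl p => h1 p | inr y => h2 y end)).
  intros u' v [t [x [Ht [-> ->]]]]. apply H1, Ht.
Qed.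

Lemma cone_lift_proj u :
  cone_lift f h1 h2 (qproj (collapse (coneSet f)) (cylproj f u)) = match u with inl p => h1 p | inr y => h2 y end.
Proof using H0 H1.
  unfold cone_lift.
  rewrite (qrep_compat (collapse (coneSet f)) (fun z => match qrep (cylRel f) z with inl p => h1 p | inr y => h2 y end)).
  - apply cyl_lift_proj.
  - intros z z' [[t [x [Hx ->]]] [t' [x' [Hx' ->]]]]. rewrite !cyl_lift_proj. now rewrite !H0.
Qed.

Lemma cone_lift_pt t x : cone_lift f h1 h2 (cone_pt f t x) = h1 (t, x).
Proof using H0 H1. apply cone_lift_proj. Qed.

Lemma cone_lift_J y : cone_lift f h1 h2 (coneJ f y) = h2 y.
Proof using H0 H1. apply cone_lift_proj. Qed.
End ConeLift.

Lemma sig_lift_pt {A : PFrol} {W : Type} (h : Iset -> A -> W) (w0 : W) t a :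
  (forall t a, endpts t \/ a = ppt A -> h t a = w0) -> sig_lift h (sig_pt t a) = h t a.
Proof.
  intros H.
  assert (HC : forall t a, h (qrep (collapse endpts) (qproj (collapse endpts) t)) a = h t a).
  { intros t' a'. apply (qrep_compat (collapse endpts) (fun t => h t a')).
    intros u v [Hu Hv]. rewrite !H; auto. }
  unfold sig_lift, sig_pt.
  rewrite (qrep_compat (collapse (wedgeSet circP A)) (fun r => h (qrep (collapse endpts) (fst r)) (snd r)));
    [apply HC|].
  assert (HW : forall r, wedgeSet circP A r -> h (qrep (collapse endpts) (fst r)) (snd r) = w0).
  { intros r [E|E]; [|apply H; auto]. rewrite E. simpl ppt. rewrite HC. apply H. left. left. reflexivity. }
  intros u v [Hu Hv]. now rewrite !HW.
Qed.

Lemma cone_cases (X Y : PFrol) (f : X -> Y) (q : coneF f) :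
  (exists t x, q = cone_pt f t x) \/ (exists y, q = coneJ f y).
Proof.
  destruct (qproj_surj _ q) as [z ->]. destruct (qproj_surj _ z) as [[[t x]|y] ->]; [left|right]; unfold cone_pt, coneJ, cylproj; eauto.
Qed.

Lemma sig_cases (A : PFrol) (q : SigP A) : exists t a, q = sig_pt t a.
Proof.
  destruct (qproj_surj _ q) as [[p a] ->]. destruct (qproj_surj _ p) as [t ->]. exists t, a. reflexivity.
Qed.

Lemma coneK_pt (X Y : PFrol) (f : X -> Y) t x : coneK f (cone_pt f t x) = sig_pt t x.
Proof.
  apply (cone_lift_pt f (fun p => sig_pt (fst p) (snd p)) (fun _ => ppt (SigP X)) (ppt (SigP X))).
  - intros t' x' H. apply sig_pt_base. left. right. exact H.
  - intros t' x' H. apply sig_pt_base. destruct H; [left; left|right]; assumption.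
Qed.

Lemma coneK_J (X Y : PFrol) (f : X -> Y) y : coneK f (coneJ f y) = ppt (SigP X).
Proof.
  apply (cone_lift_J f (fun p => sig_pt (fst p) (snd p)) (fun _ => ppt (SigP X)) (ppt (SigP X))).
  - intros t' x' H. apply sig_pt_base. left. right. exact H.
  - intros t' x' H. apply sig_pt_base. destruct H; [left; left|right]; assumption.
Qed.

Lemma Sigm_pt (A B : PFrol) (g : A -> B) t a : g (ppt A) = ppt B -> Sigm g (sig_pt t a) = sig_pt t (g a).
Proof.
  intros Hg. unfold Sigm, sig_pt.
  rewrite (qrep_compat (collapse (wedgeSet circP A)) (fun r => qproj (collapse (wedgeSet circP B)) (fst r, g (snd r)))); [reflexivity|].
  intros u v [Hu Hv]. apply qproj_eq, rst_step. split.
  - destruct Hu as [E|E]; [left; exact E|right; exact (eq_trans (f_equal g E) Hg)].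
  - destruct Hv as [E|E]; [left; exact E|right; exact (eq_trans (f_equal g E) Hg)].
Qed.

(** * The flattened interval and homotopies *)

Lemma Iset_eq (s t : Iset) : proj1_sig s = proj1_sig t -> s = t.
Proof. destruct s, t; simpl. intros ->. f_equal. apply proof_irrelevance. Qed.

Lemma clamp_range r : 0 <= Rmax 0 (Rmin 1 r) <= 1.
Proof. unfold Rmax, Rmin. repeat destruct Rle_dec; lra. Qed.

Definition toI (r : R) : Iset := exist _ (Rmax 0 (Rmin 1 r)) (clamp_range r).

Lemma toI_val r : 0 <= r <= 1 -> proj1_sig (toI r) = r.
Proof. intros Hr. simpl. rewrite Rmin_right, Rmax_right; lra. Qed.

Lemma toI_id (t : Iset) : toI (proj1_sig t) = t.
Proof. apply Iset_eq, toI_val, (proj2_sig t). Qed.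

Lemma toI_0 r : r = 0 -> toI r = I0.
Proof. intros ->. apply Iset_eq. exact (toI_val 0 ltac:(lra)). Qed.

Lemma toI_1 r : r = 1 -> toI r = I1.
Proof. intros ->. apply Iset_eq. exact (toI_val 1 ltac:(lra)). Qed.

Lemma Ifr_curv (c : R -> Iset) : curv Ifr c <-> smoothRR (fun r => proj1_sig (c r)).
Proof.
  split.
  - intros Hc. apply (Hc (fun t => proj1_sig t)). exists (fun x => x). split; [|reflexivity].
    intros c' Hc'. apply (Hc' (fun x => x)), smooth_id.
  - intros Hc g [f [Hf E]]. apply (smooth_ext (fun r => f (proj1_sig (c r)))); [auto|].
    apply Hf. intros h Hh. apply (smooth_comp h); assumption.
Qed.

Lemma toI_curv (h : R -> R) : smoothRR h -> (forall r, 0 <= h r <= 1) -> curv Ifr (fun r => toI (h r)).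
Proof.
  intros Hs Hr. apply (proj2 (Ifr_curv _)). apply (smooth_ext h); [|exact Hs]. intros r. symmetry. apply toI_val, Hr.
Qed.

Lemma Ifr_curv_boldI (c : R -> Iset) : curv Ifr c -> curv boldI c.
Proof. intros Hc f [Hf _]. apply (curv_fns Ifr); assumption. Qed.

Lemma boldI_curv_flat (t : R -> Iset) (b : R -> R) e : curv boldI t -> smoothRR b -> 0 < e ->
  (forall x, 0 <= x <= e -> b x = b 0) -> (forall x, 1 - e <= x <= 1 -> b x = b 1) ->
  smoothRR (fun r => b (proj1_sig (t r))).
Proof.
  intros Ht Hb He H0 H1. apply (Ht (fun s => b (proj1_sig s))). split.
  - apply fns_ax. intros c Hc. apply (smooth_comp b); [exact Hb|]. exact (proj1 (Ifr_curv c) Hc).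
  (* The definition of [boldI] asks for a radius below 1/4. *)
  - pose proof (Rmin_l e (1/8)). pose proof (Rmin_r e (1/8)).
    exists (Rmin e (1/8)). split; [split; [apply Rmin_glb_lt|]; lra|]. split.
    + intros s u Hs Hu. pose proof (proj2_sig s). pose proof (proj2_sig u). simpl in *. rewrite (H0 (proj1_sig s)), (H0 (proj1_sig u)); lra.
    + intros s u Hs Hu. pose proof (proj2_sig s). pose proof (proj2_sig u). simpl in *. rewrite (H1 (proj1_sig s)), (H1 (proj1_sig u)); lra.
Qed.

(** What remains of a braking function after squeezing it into one half of the interval, where it is
    no longer strictly increasing on a symmetric middle part. *)
Definition flat_step (b : R -> R) : Prop :=
  smoothRR b /\ (forall x, 0 <= b x <= 1) /\
  exists e, 0 < e /\ (forall x, x <= e -> b x = 0) /\ (forall x, 1 - e <= x -> b x = 1).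

Lemma braking_flat_step eps al : braking eps al -> flat_step al.
Proof.
  intros Hal. pose proof (fun x => braking_range eps al x Hal).
  destruct Hal as [He [Hs [H0 [_ [_ H1]]]]]. split; [exact Hs|]. split; [assumption|].
  exists eps. split; [lra|]. auto.
Qed.

Lemma flat_step_0 b : flat_step b -> b 0 = 0.
Proof. intros [_ [_ [e [He [H _]]]]]. apply H. lra. Qed.

Lemma flat_step_1 b : flat_step b -> b 1 = 1.
Proof. intros [_ [_ [e [He [_ H]]]]]. apply H. lra. Qed.

Lemma flat_step_curv b t : flat_step b -> curv boldI t -> smoothRR (fun r => b (proj1_sig (t r))).
Proof.
  intros Hb Ht. pose proof (flat_step_0 b Hb) as E0. pose proof (flat_step_1 b Hb) as E1.
  destruct Hb as [Hs [_ [e [He [H0 H1]]]]]. apply (boldI_curv_flat t b e); auto.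
  - intros x Hx. rewrite (H0 x); lra.
  - intros x Hx. rewrite (H1 x); lra.
Qed.

(* Near the ends of the interval a structure function of [boldI] cannot tell [t] from the
   cut-off [kappa t], which is flat at the ends and hence smooth along curves of [boldI]. *)
Lemma interpolation_curv eps al b s t : braking eps al -> flat_step b ->
  curv Ifr s -> curv boldI t ->
  curv boldI (fun r => toI ((1 - proj1_sig (s r)) * proj1_sig (t r) + proj1_sig (s r) * b (proj1_sig (t r)))).
Proof.
  intros Hal [Hb [Hbr [eb [Heb [Hb0 Hb1]]]]] Hs Ht f [Hf [ef [Hef [Hf0 Hf1]]]].
  pose proof (fun x => braking_range eps al x Hal) as Halr.
  destruct Hal as [He [Hals [Hal0 [_ [_ Hal1]]]]].
  (* Below this radius both the test function [f] and the step [b] are constant, and the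
     interpolated point stays within the radius at either end. *)
  set (e1 := Rmin (ef / 2) (eb / 2)).
  assert (He1 : 0 < e1) by (apply Rmin_glb_lt; lra).
  assert (He1f : e1 <= ef / 2) by apply Rmin_l. assert (He1b : e1 <= eb / 2) by apply Rmin_r.
  set (kap := fun x => x * al (x / e1) * al ((1 - x) / e1) + (1 - al ((1 - x) / e1))).
  assert (Hlarge : forall x, e1 <= x -> al (x / e1) = 1).
  { intros x Hx. apply Hal1. apply Rle_trans with 1; [lra|]. apply Rle_div_r; lra. }
  assert (Hsmall : forall x, x <= e1 * eps -> al (x / e1) = 0).
  { intros x Hx. apply Hal0. apply Rle_div_l; lra. }
  assert (Hk0 : forall x, x <= e1 -> kap x = x * al (x / e1)).
  { intros x Hx. unfold kap. rewrite (Hlarge (1 - x)) by lra. ring. }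
  assert (Hk1 : forall x, 1 - e1 <= x -> kap x = 1 - (1 - x) * al ((1 - x) / e1)).
  { intros x Hx. unfold kap. rewrite (Hlarge x) by lra. ring. }
  assert (Hkm : forall x, e1 <= x <= 1 - e1 -> kap x = x).
  { intros x Hx. unfold kap. rewrite (Hlarge x), (Hlarge (1 - x)) by lra. ring. }
  assert (Hee : 0 < e1 * eps < e1) by nra.
  assert (Hks : smoothRR (fun r => kap (proj1_sig (t r)))).
  { apply (boldI_curv_flat t kap (e1 * eps)); auto; try lra.
    - unfold kap. assert (S1 : smoothRR (fun x => al (x / e1))) by (apply (smooth_comp al); [exact Hals|]; unfold Rdiv; smooth_tac).
      assert (S2 : smoothRR (fun x => al ((1 - x) / e1))) by (apply (smooth_comp al); [exact Hals|]; unfold Rdiv; smooth_tac).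
      smooth_tac.
    - intros x Hx. rewrite !Hk0 by lra. rewrite (Hsmall x) by lra. ring.
    - intros x Hx. rewrite !Hk1 by lra. rewrite (Hsmall (1 - x)) by lra. ring. }
  set (ga := fun s x => (1 - s) * x + s * b x).
  assert (Hga : forall s x, 0 <= s <= 1 -> 0 <= x <= 1 -> 0 <= ga s x <= 1).
  { intros s' x Hs' Hx. unfold ga. specialize (Hbr x). nra. }
  assert (Hga0 : forall s x, 0 <= s <= 1 -> 0 <= x <= e1 -> 0 <= ga s x <= e1).
  { intros s' x Hs' Hx. unfold ga. rewrite Hb0 by lra. nra. }
  assert (Hga1 : forall s x, 0 <= s <= 1 -> 1 - e1 <= x <= 1 -> 1 - e1 <= ga s x <= 1).
  { intros s' x Hs' Hx. unfold ga. rewrite Hb1 by lra. nra. }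
  assert (Hkr0 : forall x, 0 <= x <= e1 -> 0 <= kap x <= e1).
  { intros x Hx. rewrite Hk0 by lra. specialize (Halr (x / e1)). nra. }
  assert (Hkr1 : forall x, 1 - e1 <= x <= 1 -> 1 - e1 <= kap x <= 1).
  { intros x Hx. rewrite Hk1 by lra. specialize (Halr ((1 - x) / e1)). nra. }
  assert (Hkr : forall x, 0 <= x <= 1 -> 0 <= kap x <= 1).
  { intros x Hx. destruct (Rle_dec x e1); [specialize (Hkr0 x); lra|].
    destruct (Rle_dec (1 - e1) x); [specialize (Hkr1 x); lra|]. rewrite Hkm; lra. }
  apply (smooth_ext (fun r => f (toI (ga (proj1_sig (s r)) (kap (proj1_sig (t r))))))).
  - intros r. pose proof (proj2_sig (s r)) as Hsr. pose proof (proj2_sig (t r)) as Htr. simpl in Hsr, Htr.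
    set (x := proj1_sig (t r)) in *. set (p := proj1_sig (s r)) in *.
    change (f (toI (ga p (kap x))) = f (toI (ga p x))).
    destruct (Rle_dec x e1); [|destruct (Rle_dec (1 - e1) x)].
    + pose proof (Hga0 p x Hsr ltac:(lra)). pose proof (Hga0 p (kap x) Hsr (Hkr0 x ltac:(lra))).
      apply Hf0; rewrite toI_val; lra.
    + pose proof (Hga1 p x Hsr ltac:(lra)). pose proof (Hga1 p (kap x) Hsr (Hkr1 x ltac:(lra))).
      apply Hf1; rewrite toI_val; lra.
    + rewrite Hkm by lra. reflexivity.
  - apply (curv_fns Ifr _ f); [|exact Hf]. apply toI_curv.
    + apply (proj1 (Ifr_curv s)) in Hs. unfold ga.
      assert (smoothRR (fun r => b (kap (proj1_sig (t r))))) by (apply (smooth_comp b (fun r => kap (proj1_sig (t r)))); assumption).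
      smooth_tac.
    + intros r. apply Hga; [apply (proj2_sig (s r))|]. apply Hkr, (proj2_sig (t r)).
Qed.

Lemma braking_mono eps al s t : braking eps al -> s <= t -> al s <= al t.
Proof.
  intros Hal Hst. pose proof (braking_range eps al s Hal) as Rs. pose proof (braking_range eps al t Hal) as Rt.
  destruct Hal as [He [_ [H0 [_ [Hm H1]]]]].
  destruct (Rle_dec s eps); [rewrite (H0 s); lra|].
  destruct (Rle_dec (1 - eps) t); [rewrite (H1 t); lra|].
  destruct (Req_dec s t) as [->|]; [lra|]. left. apply Hm; lra.
Qed.

(* [al] serves as a smooth coordinate detecting on which side of [1/2] the curve [t] runs. *)
Lemma curv_glue eps al (W : Frol) (t : R -> Iset) (c1 c2 : R -> W) d :
  braking eps al -> curv boldI t -> curv W c1 -> curv W c2 -> 0 < d ->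
  (forall r, Rabs (proj1_sig (t r) - 1/2) < d -> c1 r = c2 r) ->
  curv W (fun r => if Rle_dec (proj1_sig (t r)) (1/2) then c1 r else c2 r).
Proof.
  intros Hal Ht H1 H2 Hd E.
  assert (Hrho := flat_step_curv al t (braking_flat_step eps al Hal) Ht).
  pose proof (fun s u => braking_mono eps al s u Hal) as Hmono.
  destruct Hal as [He [_ [_ [_ [Hm _]]]]].
  set (d' := Rmin d ((1/2 - eps) / 2)).
  assert (Hd' : 0 < d') by (apply Rmin_glb_lt; lra).
  assert (Hd1 : d' <= d) by apply Rmin_l. assert (Hd2 : d' <= (1/2 - eps) / 2) by apply Rmin_r.
  assert (M1 : al (1/2) < al (1/2 + d')) by (apply Hm; lra).
  assert (M2 : al (1/2 - d') < al (1/2)) by (apply Hm; lra).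
  apply curv_local. intros r0. destruct (Rle_dec (proj1_sig (t r0)) (1/2)) as [Hle|Hgt].
  - pose proof (Hmono _ _ Hle) as M3.
    destruct (smooth_near _ r0 (al (1/2 + d') - al (proj1_sig (t r0))) Hrho) as [dl [Hdl Hn]]; [lra|].
    exists dl, c1. split; [exact Hdl|]. split; [exact H1|]. intros r Hr.
    destruct (Rle_dec (proj1_sig (t r)) (1/2)); [reflexivity|]. symmetry. apply E.
    specialize (Hn r Hr). apply Rabs_lt_between in Hn.
    destruct (Rle_dec (1/2 + d') (proj1_sig (t r))) as [Hbad|]; [pose proof (Hmono _ _ Hbad); lra|].
    apply Rabs_lt_between. lra.
  - assert (M3 : al (1/2) <= al (proj1_sig (t r0))) by (apply Hmono; lra).
    destruct (smooth_near _ r0 (al (proj1_sig (t r0)) - al (1/2 - d')) Hrho) as [dl [Hdl Hn]]; [lra|].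
    exists dl, c2. split; [exact Hdl|]. split; [exact H2|]. intros r Hr.
    destruct (Rle_dec (proj1_sig (t r)) (1/2)); [|reflexivity]. apply E.
    specialize (Hn r Hr). apply Rabs_lt_between in Hn.
    destruct (Rle_dec (proj1_sig (t r)) (1/2 - d')) as [Hbad|]; [pose proof (Hmono _ _ Hbad); lra|].
    apply Rabs_lt_between. lra.
Qed.

(** * Pointed homotopies and their concatenation *)

Lemma phtpy_refl (X W : PFrol) (f : X -> W) : psmooth X W f -> phtpy X W f f.
Proof.
  intros [Hf Hb]. exists (fun p => f (snd p)). simpl. repeat split; auto.
  apply smooth_map_curv. intros c Hc. apply prodF_curv in Hc.
  apply (proj1 (smooth_map_curv _ _ _) Hf (fun t => snd (c t))), Hc.
Qed.

Lemma phtpy_ext (X W : PFrol) (f f' g g' : X -> W) :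
  (forall x, f x = f' x) -> (forall x, g x = g' x) -> phtpy X W f g -> phtpy X W f' g'.
Proof. intros Ef Eg. apply functional_extensionality in Ef, Eg. subst; auto. Qed.

Lemma phtpy_precomp (X Y W : PFrol) (g : X -> Y) (f f' : Y -> W) :
  psmooth X Y g -> phtpy Y W f f' -> phtpy X W (fun x => f (g x)) (fun x => f' (g x)).
Proof.
  intros [Hg Hgb] [H [HH [H0 [H1 Hb]]]]. exists (fun p => H (fst p, g (snd p))). simpl.
  repeat split; auto; [|intros; now rewrite Hgb].
  apply smooth_map_curv. intros c Hc. apply prodF_curv in Hc. destruct Hc as [Hs Hx].
  apply (prodF_map_curv Ifr Y W H (fun t => fst (c t)) (fun t => g (snd (c t))) HH Hs).
  apply (proj1 (smooth_map_curv _ _ _) Hg (fun t => snd (c t)) Hx).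
Qed.

Lemma flat_step_first eps al : braking eps al -> flat_step (fun x => al (2 * x)).
Proof.
  intros Hal. pose proof (fun x => braking_range eps al x Hal).
  destruct Hal as [He [Hs [H0 [_ [_ H1]]]]]. split; [|split].
  - apply (smooth_comp al); [exact Hs|]. smooth_tac.
  - auto.
  - exists (eps / 2). repeat split; [lra| |]; intros; [apply H0|apply H1]; lra.
Qed.

Lemma flat_step_second eps al : braking eps al -> flat_step (fun x => al (2 * x - 1)).
Proof.
  intros Hal. pose proof (fun x => braking_range eps al x Hal).
  destruct Hal as [He [Hs [H0 [_ [_ H1]]]]]. split; [|split].
  - apply (smooth_comp al); [exact Hs|]. smooth_tac.
  - auto.
  - exists (eps / 2). repeat split; [lra| |]; intros; [apply H0|apply H1]; lra.
Qed.

Lemma braking_middle eps al x : braking eps al -> Rabs (x - 1/2) < eps / 2 ->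
  al (2 * x) = 1 /\ al (2 * x - 1) = 0.
Proof.
  intros [He [_ [H0 [_ [_ H1]]]]] Hx. apply Rabs_lt_between in Hx. split; [apply H1|apply H0]; lra.
Qed.

Lemma flat_step_toI b t : flat_step b -> curv boldI t -> curv Ifr (fun r => toI (b (proj1_sig (t r)))).
Proof.
  intros Hb Ht. apply toI_curv; [apply flat_step_curv; assumption|]. intros r. apply Hb.
Qed.

(** Each half runs through [al], so within [eps / 2] of time 1/2 both branches rest at [g] and
    [curv_glue] applies. *)
Lemma phtpy_trans eps al (X W : PFrol) (f g h : X -> W) :
  braking eps al -> phtpy X W f g -> phtpy X W g h -> phtpy X W f h.
Proof.
  intros Hal [H1 [HH1 [H10 [H11 H1b]]]] [H2 [HH2 [H20 [H21 H2b]]]].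
  pose proof (flat_step_first eps al Hal) as F1. pose proof (flat_step_second eps al Hal) as F2.
  exists (fun p => if Rle_dec (proj1_sig (fst p)) (1/2) then H1 (toI (al (2 * proj1_sig (fst p))), snd p)
                   else H2 (toI (al (2 * proj1_sig (fst p) - 1)), snd p)).
  simpl fst; simpl snd. split; [|split; [|split]].
  - apply smooth_map_curv. intros c Hc. apply prodF_curv in Hc. destruct Hc as [Hs Hx].
    apply Ifr_curv_boldI in Hs.
    apply (curv_glue eps al W (fun r => fst (c r))
      (fun r => H1 (toI (al (2 * proj1_sig (fst (c r)))), snd (c r)))
      (fun r => H2 (toI (al (2 * proj1_sig (fst (c r)) - 1)), snd (c r))) (eps / 2)); auto.
    + apply (prodF_map_curv Ifr X W H1 (fun r => toI (al (2 * proj1_sig (fst (c r))))) (fun r => snd (c r)) HH1); [|exact Hx].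
      apply (flat_step_toI _ _ F1 Hs).
    + apply (prodF_map_curv Ifr X W H2 (fun r => toI (al (2 * proj1_sig (fst (c r)) - 1))) (fun r => snd (c r)) HH2); [|exact Hx].
      apply (flat_step_toI _ _ F2 Hs).
    + destruct Hal; lra.
    + intros r Hr. destruct (braking_middle eps al _ Hal Hr) as [E1 E2].
      transitivity (g (snd (c r))).
      * exact (eq_trans (f_equal (fun s => H1 (s, snd (c r))) (toI_1 _ E1)) (H11 _)).
      * exact (eq_trans (eq_sym (H20 _)) (f_equal (fun s => H2 (s, snd (c r))) (eq_sym (toI_0 _ E2)))).
  - intros x. simpl. destruct (Rle_dec 0 (1/2)); [|lra]. rewrite toI_0; [apply H10|].
    apply (flat_step_0 _ F1).
  - intros x. simpl. destruct (Rle_dec 1 (1/2)); [lra|]. rewrite toI_1; [apply H21|].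
    apply (flat_step_1 _ F2).
  - intros t. destruct Rle_dec; [apply H1b|apply H2b].
Qed.

(** * Exactness before suspension *)

(** Together with [phtpy_sig], the gate through which homotopies are given by formulas on
    representatives: compatibility is an equation and smoothness is asked along curves of the pieces
    only. *)
Lemma phtpy_cone eps al (X Y W : PFrol) (f : X -> Y) (h1 : Iset -> Iset -> X -> W) (h2 : Iset -> Y -> W)
  (g0 g1 : coneF f -> W) :
  braking eps al ->
  (forall s t x, proj1_sig t = 1 -> h1 s t x = h2 s (f x)) ->
  (forall s t x, proj1_sig t = 0 \/ x = ppt X -> h1 s t x = ppt W) ->
  (forall s t x, curv Ifr s -> curv boldI t -> curv X x -> curv W (fun r => h1 (s r) (t r) (x r))) ->
  (forall s y, curv Ifr s -> curv Y y -> curv W (fun r => h2 (s r) (y r))) ->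
  (forall t x, g0 (cone_pt f t x) = h1 I0 t x) -> (forall y, g0 (coneJ f y) = h2 I0 y) ->
  (forall t x, g1 (cone_pt f t x) = h1 I1 t x) -> (forall y, g1 (coneJ f y) = h2 I1 y) ->
  phtpy (coneF f) W g0 g1.
Proof.
  intros Hal C1 C0 S1 S2 E01 E02 E11 E12.
  set (H := fun p : Iset * coneF f => cone_lift f (fun q => h1 (fst p) (fst q) (snd q)) (h2 (fst p)) (snd p)).
  assert (HP : forall s t x, H (s, cone_pt f t x) = h1 s t x).
  { intros s t x. apply (cone_lift_pt f (fun q => h1 s (fst q) (snd q)) (h2 s) (ppt W)); simpl; auto. }
  assert (HJ : forall s y, H (s, coneJ f y) = h2 s y).
  { intros s y. apply (cone_lift_J f (fun q => h1 s (fst q) (snd q)) (h2 s) (ppt W)); simpl; auto. }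
  exists H. split; [|split; [|split]].
  - apply (smooth_map_prod_cone eps al); [exact Hal| |].
    + intros b t x Hb Ht Hx. apply (curv_ext W (fun r => h1 (b r) (t r) (x r))); [intro; now rewrite HP|].
      apply S1; assumption.
    + intros b y Hb Hy. apply (curv_ext W (fun r => h2 (b r) (y r))); [intro; now rewrite HJ|].
      apply S2; assumption.
  - intros q. destruct (cone_cases X Y f q) as [[t [x ->]]|[y ->]]; [now rewrite HP, E01|now rewrite HJ, E02].
  - intros q. destruct (cone_cases X Y f q) as [[t [x ->]]|[y ->]]; [now rewrite HP, E11|now rewrite HJ, E12].
  - intros s. change (ppt (coneF f)) with (cone_pt f I0 (ppt X)). rewrite HP. apply C0. auto.
Qed.

Lemma phtpy_sig eps al (A W : PFrol) (h : Iset -> Iset -> A -> W) (g0 g1 : SigP A -> W) :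
  braking eps al ->
  (forall s t a, endpts t \/ a = ppt A -> h s t a = ppt W) ->
  (forall s t a, curv Ifr s -> curv boldI t -> curv A a -> curv W (fun r => h (s r) (t r) (a r))) ->
  (forall t a, g0 (sig_pt t a) = h I0 t a) -> (forall t a, g1 (sig_pt t a) = h I1 t a) ->
  phtpy (SigP A) W g0 g1.
Proof.
  intros Hal C S1 E0 E1.
  set (H := fun p : Iset * SigP A => sig_lift (h (fst p)) (snd p)).
  assert (HP : forall s t a, H (s, sig_pt t a) = h s t a).
  { intros s t a. apply (sig_lift_pt (h s) (ppt W)). intros; apply C; assumption. }
  exists H. split; [|split; [|split]].
  - apply (smooth_map_prod_sig eps al); [exact Hal|]. intros b t a Hb Ht Ha.
    apply (curv_ext W (fun r => h (b r) (t r) (a r))); [intro; now rewrite HP|]. apply S1; assumption.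
  - intros q. destruct (sig_cases A q) as [t [a ->]]. now rewrite HP, E0.
  - intros q. destruct (sig_cases A q) as [t [a ->]]. now rewrite HP, E1.
  - intros s. change (ppt (SigP A)) with (sig_pt I0 (ppt A)). rewrite HP. apply C. auto.
Qed.

Lemma cone_map_exists eps al (X Y W : PFrol) (f : X -> Y) (h1 : Iset -> X -> W) (h2 : Y -> W) :
  braking eps al ->
  (forall t x, proj1_sig t = 1 -> h1 t x = h2 (f x)) ->
  (forall t x, proj1_sig t = 0 \/ x = ppt X -> h1 t x = ppt W) ->
  (forall t x, curv boldI t -> curv X x -> curv W (fun r => h1 (t r) (x r))) ->
  (forall y, curv Y y -> curv W (fun r => h2 (y r))) ->
  exists phi, psmooth (coneF f) W phi /\ (forall t x, phi (cone_pt f t x) = h1 t x) /\ (forall y, phi (coneJ f y) = h2 y).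
Proof.
  intros Hal C1 C0 S1 S2.
  set (phi := cone_lift f (fun q => h1 (fst q) (snd q)) h2).
  assert (HP : forall t x, phi (cone_pt f t x) = h1 t x).
  { intros t x. apply (cone_lift_pt f (fun q => h1 (fst q) (snd q)) h2 (ppt W)); simpl; auto. }
  assert (HJ : forall y, phi (coneJ f y) = h2 y).
  { intros y. apply (cone_lift_J f (fun q => h1 (fst q) (snd q)) h2 (ppt W)); simpl; auto. }
  exists phi. split; [|auto]. split.
  - apply (smooth_map_cone eps al); [exact Hal| |].
    + intros t x Ht Hx. apply (curv_ext W (fun r => h1 (t r) (x r))); [intro; now rewrite HP|auto].
    + intros y Hy. apply (curv_ext W (fun r => h2 (y r))); [intro; now rewrite HJ|auto].
  - change (ppt (coneF f)) with (cone_pt f I0 (ppt X)). rewrite HP. apply C0. auto.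
Qed.

Lemma sig_map_exists eps al (A W : PFrol) (h : Iset -> A -> W) :
  braking eps al ->
  (forall t a, endpts t \/ a = ppt A -> h t a = ppt W) ->
  (forall t a, curv boldI t -> curv A a -> curv W (fun r => h (t r) (a r))) ->
  exists phi, psmooth (SigP A) W phi /\ (forall t a, phi (sig_pt t a) = h t a).
Proof.
  intros Hal C S1. set (phi := sig_lift h).
  assert (HP : forall t a, phi (sig_pt t a) = h t a) by (intros; apply (sig_lift_pt h (ppt W)); assumption).
  exists phi. split; [|exact HP]. split.
  - apply (smooth_map_sig eps al); [exact Hal|]. intros t a Ht Ha.
    apply (curv_ext W (fun r => h (t r) (a r))); [intro; now rewrite HP|auto].
  - change (ppt (SigP A)) with (sig_pt I0 (ppt A)). rewrite HP. apply C. auto.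
Qed.

Lemma coneJ_psmooth (X Y : PFrol) (f : X -> Y) : f (ppt X) = ppt Y -> psmooth Y (coneF f) (coneJ f).
Proof.
  intros Hf. split.
  - apply smooth_map_curv. apply coneJ_curv.
  - rewrite <- Hf, <- (cone_pt_end X Y f I1) by reflexivity. apply cone_pt_base. auto.
Qed.

Lemma coneK_psmooth eps al (X Y : PFrol) (f : X -> Y) : braking eps al -> psmooth (coneF f) (SigP X) (coneK f).
Proof.
  intros Hal. split.
  - apply (smooth_map_cone eps al); [exact Hal| |].
    + intros t x Ht Hx. apply (curv_ext (SigP X) (fun r => sig_pt (t r) (x r))); [intro; now rewrite coneK_pt|].
      apply sig_pt_curv; assumption.
    + intros y Hy. apply (curv_ext (SigP X) (fun _ => ppt (SigP X))); [intro; now rewrite coneK_J|apply curv_const].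
  - change (ppt (coneF f)) with (cone_pt f I0 (ppt X)). rewrite coneK_pt. reflexivity.
Qed.

Lemma Ifr_curv_val s : curv Ifr s -> smoothRR (fun r => proj1_sig (s r)).
Proof. apply Ifr_curv. Qed.

Lemma toI_interp_0 b (t : Iset) : toI ((1 - proj1_sig I0) * proj1_sig t + proj1_sig I0 * b) = t.
Proof. simpl proj1_sig. replace ((1 - 0) * proj1_sig t + 0 * b) with (proj1_sig t) by ring. apply toI_id. Qed.

Lemma toI_interp_1 b (t : Iset) : toI ((1 - proj1_sig I1) * proj1_sig t + proj1_sig I1 * b) = toI b.
Proof. f_equal. simpl proj1_sig. ring. Qed.

Lemma unit_opp x : 0 <= x <= 1 -> 0 <= 1 - x <= 1.
Proof. lra. Qed.

Lemma unit_mult x y : 0 <= x <= 1 -> 0 <= y <= 1 -> 0 <= x * y <= 1.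
Proof. nra. Qed.

Lemma unit_interp x y : 0 <= x <= 1 -> 0 <= y <= 1 -> 0 <= x + (1 - x) * y <= 1.
Proof. nra. Qed.

Lemma endpts_cases (t : Iset) : endpts t -> t = I0 \/ t = I1.
Proof. intros [H|H]; [left|right]; apply Iset_eq; exact H. Qed.

(** A null-homotopy run backwards, from the constant at the vertex to [phi] composed with [f] at the
    base, is exactly an extension of [phi] over the cone. Conversely the image of [X] in the cone
    contracts along the cone lines. *)
Lemma exact_at_cone eps al (X Y W : PFrol) (f : X -> Y) :
  braking eps al -> psmooth X Y f -> exact_at W f (coneJ f).
Proof.
  intros Hal Hf phi Hphi. pose proof (braking_flat_step eps al Hal) as Hst.
  pose proof (flat_step_0 al Hst) as a0. pose proof (flat_step_1 al Hst) as a1.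
  split.
  - intros [H [HH [H0 [H1 Hb]]]].
    destruct (cone_map_exists eps al X Y W f (fun t x => H (toI (1 - al (proj1_sig t)), x)) phi Hal)
      as [psi [Hpsi [HP HJ]]].
    + intros t x Ht. rewrite Ht, a1, toI_0 by ring. apply H0.
    + intros t x [Ht| ->]; [|apply Hb]. rewrite Ht, a0, toI_1 by ring. apply H1.
    + intros t x Ht Hx. apply (prodF_map_curv Ifr X W H (fun r => toI (1 - al (proj1_sig (t r)))) x HH); [|exact Hx].
      apply toI_curv.
      * apply smooth_minus; [apply smooth_const|]. apply flat_step_curv; assumption.
      * intros r. pose proof (braking_range eps al (proj1_sig (t r)) Hal). lra.
    + intros y Hy. apply (proj1 (smooth_map_curv _ _ _) (proj1 Hphi) y Hy).
    + exists psi. split; [exact Hpsi|].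
      apply (phtpy_ext Y W phi phi phi); [reflexivity|intros; now rewrite HJ|apply phtpy_refl, Hphi].
  - intros [psi [Hpsi Hh]].
    apply (phtpy_trans eps al X W _ (fun x => psi (coneJ f (f x)))); [exact Hal| |].
    + apply (phtpy_precomp X Y W f phi (fun y => psi (coneJ f y))); assumption.
    + exists (fun p => psi (cone_pt f (toI (1 - proj1_sig (fst p))) (snd p))). simpl fst; simpl snd.
      split; [|split; [|split]].
      * apply smooth_map_curv. intros c Hc. apply prodF_curv in Hc. destruct Hc as [Hs Hx].
        apply (proj1 (smooth_map_curv _ _ _) (proj1 Hpsi)
          (fun r => cone_pt f (toI (1 - proj1_sig (fst (c r)))) (snd (c r)))).
        apply cone_pt_curv; [|exact Hx]. apply Ifr_curv_boldI, toI_curv.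
        -- apply smooth_minus; [apply smooth_const|apply Ifr_curv_val, Hs].
        -- intros r. exact (unit_opp _ (proj2_sig (fst (c r)))).
      * intros x. rewrite toI_1 by (simpl; ring). now rewrite cone_pt_end.
      * intros x. rewrite toI_0 by (simpl; ring). rewrite cone_pt_base by (left; reflexivity). apply Hpsi.
      * intros t. rewrite cone_pt_base by auto. apply Hpsi.
Qed.

(** A null-homotopy [H] of [phi] on [Y] is extended over the cone by lengthening the cone lines:
    after the original line, the trace of [f x] under [H] up to time [s] is appended. At time 1 all
    of [Y] lies at the base point, so the result factors through the suspension. *)
Lemma exact_at_coneJ eps al (X Y W : PFrol) (f : X -> Y) :
  braking eps al -> psmooth X Y f -> exact_at W (coneJ f) (coneK f).
Proof.
  intros Hal Hf phi Hphi. pose proof (braking_flat_step eps al Hal) as Hst.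
  pose proof (flat_step_first eps al Hal) as F1. pose proof (flat_step_second eps al Hal) as F2.
  pose proof (flat_step_0 _ F1) as a0. pose proof (flat_step_1 _ F2) as a1. cbv beta in a0, a1.
  split.
  - intros [H [HH [H0 [H1 Hb]]]].
    set (path := fun (s t : Iset) (x : X) =>
      if Rle_dec (proj1_sig t) (1/2) then phi (cone_pt f (toI (al (2 * proj1_sig t))) x)
      else H (toI (proj1_sig s * al (2 * proj1_sig t - 1)), f x)).
    assert (P0 : forall s t x, proj1_sig t = 0 \/ x = ppt X -> path s t x = ppt W).
    { intros s t x Hx. unfold path. destruct Rle_dec as [|Hgt].
      - rewrite cone_pt_base; [apply Hphi|]. destruct Hx as [E|E]; [left|right; exact E].
        rewrite E, a0. apply toI_val. lra.
      - destruct Hx as [E| ->]; [lra|]. rewrite (proj2 Hf). apply Hb. }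
    assert (P1 : forall s t x, proj1_sig t = 1 -> path s t x = H (s, f x)).
    { intros s t x E. unfold path. destruct Rle_dec; [lra|]. rewrite E, a1, Rmult_1_r, toI_id. reflexivity. }
    assert (PS : forall s t x, curv Ifr s -> curv boldI t -> curv X x -> curv W (fun r => path (s r) (t r) (x r))).
    { intros s t x Hs Ht Hx.
      apply (curv_glue eps al W t (fun r => phi (cone_pt f (toI (al (2 * proj1_sig (t r)))) (x r)))
        (fun r => H (toI (proj1_sig (s r) * al (2 * proj1_sig (t r) - 1)), f (x r))) (eps / 2)); auto.
      - apply (proj1 (smooth_map_curv _ _ _) (proj1 Hphi) (fun r => cone_pt f (toI (al (2 * proj1_sig (t r)))) (x r))).
        apply cone_pt_curv; [|exact Hx]. apply Ifr_curv_boldI, (flat_step_toI _ t F1 Ht).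
      - apply (prodF_map_curv Ifr Y W H (fun r => toI (proj1_sig (s r) * al (2 * proj1_sig (t r) - 1))) (fun r => f (x r)) HH).
        + apply toI_curv.
          * apply smooth_mult; [apply Ifr_curv_val, Hs|apply (flat_step_curv _ t F2 Ht)].
          * intros r. exact (unit_mult _ _ (proj2_sig (s r)) (braking_range eps al _ Hal)).
        + apply (proj1 (smooth_map_curv _ _ _) (proj1 Hf) x Hx).
      - destruct Hal; lra.
      - intros r Hr. destruct (braking_middle eps al _ Hal Hr) as [E1 E2].
        transitivity (phi (coneJ f (f (x r)))).
        + f_equal. apply cone_pt_end. rewrite E1. apply toI_val. lra.
        + rewrite <- H0. f_equal. f_equal. symmetry. apply toI_0. rewrite E2. ring. }
    (* The stage [s = 0] of [path]: the appended piece is constant, so this is [phi] with its cone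
       coordinate squeezed into the first half. It still has to be joined to [phi] itself, by
       interpolating the coordinates. *)
    destruct (cone_map_exists eps al X Y W f (fun t x => phi (cone_pt f (toI (al (2 * proj1_sig t))) x)) (fun y => phi (coneJ f y)) Hal)
      as [phi' [Hphi' [HP' HJ']]].
    { intros t x E. f_equal. apply cone_pt_end. rewrite E, (flat_step_1 _ F1). apply toI_val. lra. }
    { intros t x E. rewrite cone_pt_base; [apply Hphi|]. destruct E as [E|E]; [left|right; exact E].
      rewrite E, a0. apply toI_val. lra. }
    { intros t x Ht Hx.
      apply (proj1 (smooth_map_curv _ _ _) (proj1 Hphi) (fun r => cone_pt f (toI (al (2 * proj1_sig (t r)))) (x r))).
      apply cone_pt_curv; [|exact Hx]. apply Ifr_curv_boldI, (flat_step_toI _ t F1 Ht). }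
    { intros y Hy. apply (proj1 (smooth_map_curv _ _ _) (proj1 Hphi) (fun r => coneJ f (y r))), coneJ_curv, Hy. }
    destruct (sig_map_exists eps al X W (path I1) Hal) as [psi [Hpsi HPpsi]].
    { intros t x [[E|E]|E]; [apply P0; auto| |apply P0; auto]. rewrite P1 by exact E. apply H1. }
    { intros t x Ht Hx. apply (PS (fun _ => I1)); [apply curv_const|exact Ht|exact Hx]. }
    exists psi. split; [exact Hpsi|]. apply (phtpy_trans eps al _ W _ phi'); [exact Hal| |].
    + apply (phtpy_cone eps al X Y W f
        (fun s t x => phi (cone_pt f (toI ((1 - proj1_sig s) * proj1_sig t + proj1_sig s * al (2 * proj1_sig t))) x))
        (fun _ y => phi (coneJ f y))); [exact Hal| | | | | | | |].
      * intros s t x E. f_equal. apply cone_pt_end. rewrite E, (flat_step_1 _ F1).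
        replace ((1 - proj1_sig s) * 1 + proj1_sig s * 1) with 1 by ring. apply toI_val. lra.
      * intros s t x E. rewrite cone_pt_base; [apply Hphi|]. destruct E as [E|E]; [left|right; exact E].
        rewrite E, a0. replace ((1 - proj1_sig s) * 0 + proj1_sig s * 0) with 0 by ring. apply toI_val. lra.
      * intros s t x Hs Ht Hx.
        apply (proj1 (smooth_map_curv _ _ _) (proj1 Hphi) (fun r => cone_pt f (toI ((1 - proj1_sig (s r)) * proj1_sig (t r) + proj1_sig (s r) * al (2 * proj1_sig (t r)))) (x r))).
        apply cone_pt_curv; [|exact Hx]. apply (interpolation_curv eps al (fun x => al (2 * x))); assumption.
      * intros s y Hs Hy. apply (proj1 (smooth_map_curv _ _ _) (proj1 Hphi) (fun r => coneJ f (y r))), coneJ_curv, Hy.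
      * intros t x. now rewrite toI_interp_0.
      * reflexivity.
      * intros t x. rewrite toI_interp_1. apply HP'.
      * apply HJ'.
    + apply (phtpy_cone eps al X Y W f path (fun s y => H (s, y))); [exact Hal|exact P1|exact P0|exact PS| | | | |].
      * intros s y Hs Hy. apply (prodF_map_curv Ifr Y W H s y HH Hs Hy).
      * intros t x. rewrite HP'. unfold path. destruct Rle_dec as [|Hgt]; [reflexivity|].
        rewrite (toI_0 (proj1_sig I0 * _)) by (simpl; ring). rewrite H0. f_equal. apply cone_pt_end.
        replace (al (2 * proj1_sig t)) with 1; [apply toI_val; lra|].
        symmetry. destruct Hal as [He [_ [_ [_ [_ O]]]]]. apply O. lra.
      * intros y. rewrite HJ', H0. reflexivity.
      * intros t x. rewrite coneK_pt. apply HPpsi.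
      * intros y. rewrite coneK_J, H1. apply Hpsi.
  - intros [psi [Hpsi Hh]].
    apply (phtpy_ext Y W (fun y => phi (coneJ f y)) _ (fun y => psi (coneK f (coneJ f y)))); [reflexivity| |].
    + intros y. rewrite coneK_J. apply Hpsi.
    + apply (phtpy_precomp Y (coneF f) W (coneJ f) phi (fun q => psi (coneK f q))); [|exact Hh].
      apply coneJ_psmooth, Hf.
Qed.

(** View [H (s, cone_pt f t x)] on the square of the pairs [(s, t)]: the edges [s = 1] and [t = 0]
    go to the base point. [phi] is read along the edge [s = 0], and [psi] after the suspension of
    [f] along the edge [t = 1]; both are deformed into the diagonal [m] from [(1, 0)] to [(0, 1)].
    Traversing the edge [t = 1] backwards absorbs the orientation reversal familiar from the Puppe
    sequence. *)
Lemma exact_at_coneK eps al (X Y W : PFrol) (f : X -> Y) :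
  braking eps al -> psmooth X Y f -> exact_at W (coneK f) (Sigm f).
Proof.
  intros Hal Hf phi Hphi. pose proof (braking_flat_step eps al Hal) as Hst.
  pose proof (flat_step_0 al Hst) as a0. pose proof (flat_step_1 al Hst) as a1.
  pose proof (fun x => braking_range eps al x Hal) as ar.
  assert (HJb : coneJ f (ppt Y) = ppt (coneF f)) by (apply coneJ_psmooth, Hf).
  split.
  - intros [H [HH [H0 [H1 Hb]]]].
    assert (H0e : forall x, H (I0, cone_pt f I1 x) = ppt W).
    { intros x. rewrite H0, coneK_pt, sig_pt_base by (left; right; reflexivity). apply Hphi. }
    assert (Hcone : forall s x, H (s, cone_pt f I0 x) = ppt W).
    { intros s x. rewrite cone_pt_base by (left; reflexivity). apply Hb. }
    assert (Hpt : forall s t, H (s, cone_pt f t (ppt X)) = ppt W).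
    { intros s t. rewrite cone_pt_base by auto. apply Hb. }
    assert (Hturn : forall t, curv boldI t -> curv Ifr (fun r => toI (1 - al (proj1_sig (t r))))).
    { intros t Ht. apply toI_curv.
      - apply smooth_minus; [apply smooth_const|apply flat_step_curv; assumption].
      - intros r. specialize (ar (proj1_sig (t r))). lra. }
    destruct (sig_map_exists eps al Y W (fun t y => H (toI (1 - al (proj1_sig t)), coneJ f y)) Hal) as [psi [Hpsi HP]].
    { intros t y [Et| ->]; [|rewrite HJb; apply Hb]. destruct (endpts_cases t Et) as [-> | ->]; simpl proj1_sig.
      - rewrite a0, toI_1 by ring. apply H1.
      - rewrite a1, toI_0 by ring. rewrite H0, coneK_J. apply Hphi. }
    { intros t y Ht Hy. apply (prodF_map_curv Ifr (coneF f) W H (fun r => toI (1 - al (proj1_sig (t r)))) (fun r => coneJ f (y r)) HH);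
        [apply Hturn, Ht|apply coneJ_curv, Hy]. }
    exists psi. split; [exact Hpsi|].
    set (m := fun (t : Iset) (x : X) => H (toI (1 - al (proj1_sig t)), cone_pt f (toI (al (proj1_sig t))) x)).
    assert (Hm : forall t x, sig_lift m (sig_pt t x) = m t x).
    { intros t x. apply (sig_lift_pt m (ppt W)). clear t x.
      intros t x [Et| ->]; [|apply Hpt]. unfold m. destruct (endpts_cases t Et) as [-> | ->]; simpl proj1_sig.
      - rewrite a0, (toI_0 0) by ring. apply Hcone.
      - rewrite a1, (toI_0 (1 - 1)), (toI_1 1) by ring. apply H0e. }
    apply (phtpy_trans eps al _ W _ (sig_lift m)); [exact Hal| |].
    (* A straight line from the edge [s = 0] to the diagonal. It starts from the unbraked
       coordinate, hence the use of [interpolation_curv]. *)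
    + apply (phtpy_sig eps al X W (fun s t x => H (toI (proj1_sig s * (1 - al (proj1_sig t))),
        cone_pt f (toI ((1 - proj1_sig s) * proj1_sig t + proj1_sig s * al (proj1_sig t))) x))); [exact Hal| | | |].
      * intros s t x [Et| ->]; [|apply Hpt]. destruct (endpts_cases t Et) as [-> | ->]; simpl proj1_sig.
        -- rewrite a0, (toI_0 (_ * 0 + _ * 0)) by ring. apply Hcone.
        -- rewrite a1, (toI_0 (_ * (1 - 1))), (toI_1 (_ * 1 + _ * 1)) by ring. apply H0e.
      * intros s t x Hs Ht Hx. apply (prodF_map_curv Ifr (coneF f) W H
          (fun r => toI (proj1_sig (s r) * (1 - al (proj1_sig (t r)))))
          (fun r => cone_pt f (toI ((1 - proj1_sig (s r)) * proj1_sig (t r) + proj1_sig (s r) * al (proj1_sig (t r)))) (x r)) HH).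
        -- apply toI_curv.
           ++ apply smooth_mult; [apply Ifr_curv_val, Hs|]. apply smooth_minus; [apply smooth_const|apply flat_step_curv; assumption].
           ++ intros r. exact (unit_mult _ _ (proj2_sig (s r)) (unit_opp _ (ar _))).
        -- apply cone_pt_curv; [|exact Hx]. apply (interpolation_curv eps al al); assumption.
      * intros t x. rewrite toI_interp_0, (toI_0 (proj1_sig I0 * _)) by (simpl; ring). rewrite H0, coneK_pt. reflexivity.
      * intros t x. rewrite toI_interp_1, Hm. unfold m. do 2 f_equal. f_equal. simpl proj1_sig. ring.
    + apply (phtpy_sig eps al X W (fun s t x => H (toI (1 - al (proj1_sig t)),
        cone_pt f (toI (proj1_sig s + (1 - proj1_sig s) * al (proj1_sig t))) x))); [exact Hal| | | |].
      * intros s t x [Et| ->]; [|apply Hpt]. destruct (endpts_cases t Et) as [-> | ->]; simpl proj1_sig.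
        -- rewrite a0, (toI_1 (1 - 0)) by ring. apply H1.
        -- rewrite a1, (toI_0 (1 - 1)), (toI_1 (_ + _ * 1)) by ring. apply H0e.
      * intros s t x Hs Ht Hx. apply (prodF_map_curv Ifr (coneF f) W H
          (fun r => toI (1 - al (proj1_sig (t r))))
          (fun r => cone_pt f (toI (proj1_sig (s r) + (1 - proj1_sig (s r)) * al (proj1_sig (t r)))) (x r)) HH); [apply Hturn, Ht|].
        apply cone_pt_curv; [|exact Hx]. apply Ifr_curv_boldI, toI_curv.
        -- apply smooth_plus; [apply Ifr_curv_val, Hs|]. apply smooth_mult; [|apply flat_step_curv; assumption].
           apply smooth_minus; [apply smooth_const|apply Ifr_curv_val, Hs].
        -- intros r. exact (unit_interp _ _ (proj2_sig (s r)) (ar _)).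
      * intros t x. rewrite Hm. unfold m. do 4 f_equal. simpl proj1_sig. ring.
      * intros t x. rewrite Sigm_pt by apply Hf. rewrite HP. do 2 f_equal. symmetry. apply cone_pt_end.
        replace (proj1_sig I1 + (1 - proj1_sig I1) * al (proj1_sig t)) with 1 by (simpl; ring). apply toI_val. lra.
  - intros [psi [Hpsi Hh]].
    assert (Hend : forall t y, endpts t -> psi (sig_pt t y) = ppt W).
    { intros t y Et. rewrite sig_pt_base by auto. apply Hpsi. }
    assert (Hpt : forall t, psi (sig_pt t (f (ppt X))) = ppt W).
    { intros t. rewrite sig_pt_base by (right; apply Hf). apply Hpsi. }
    assert (Hcv : forall t y, curv boldI t -> curv Y y -> curv W (fun r => psi (sig_pt (t r) (y r)))).
    { intros t y Ht Hy. apply (proj1 (smooth_map_curv _ _ _) (proj1 Hpsi) (fun r => sig_pt (t r) (y r))), sig_pt_curv; assumption. }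
    assert (Hfc : forall x, curv X x -> curv Y (fun r => f (x r))) by (apply smooth_map_curv, Hf).
    assert (e0 : endpts I0) by (left; reflexivity). assert (e1 : endpts I1) by (right; reflexivity).
    set (chi := cone_lift f (fun p => psi (sig_pt (toI (al (proj1_sig (fst p)))) (f (snd p)))) (fun _ => ppt W)).
    assert (Hc1 : forall (t : Iset) x, proj1_sig t = 1 -> psi (sig_pt (toI (al (proj1_sig t))) (f x)) = ppt W).
    { intros t x E. rewrite E, a1, toI_1 by ring. apply Hend, e1. }
    assert (Hc0 : forall (t : Iset) x, proj1_sig t = 0 \/ x = ppt X -> psi (sig_pt (toI (al (proj1_sig t))) (f x)) = ppt W).
    { intros t x [E| ->]; [|apply Hpt]. rewrite E, a0, toI_0 by ring. apply Hend, e0. }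
    assert (HchiP : forall t x, chi (cone_pt f t x) = psi (sig_pt (toI (al (proj1_sig t))) (f x))).
    { intros t x. apply (cone_lift_pt f (fun p => psi (sig_pt (toI (al (proj1_sig (fst p)))) (f (snd p)))) (fun _ => ppt W) (ppt W) Hc1 Hc0). }
    assert (HchiJ : forall y, chi (coneJ f y) = ppt W).
    { intros y. apply (cone_lift_J f (fun p => psi (sig_pt (toI (al (proj1_sig (fst p)))) (f (snd p)))) (fun _ => ppt W) (ppt W) Hc1 Hc0). }
    apply (phtpy_trans eps al _ W _ (fun q => psi (Sigm f (coneK f q)))); [exact Hal| |].
    { apply (phtpy_precomp (coneF f) (SigP X) W (coneK f) phi (fun p => psi (Sigm f p))); [|exact Hh].
      apply (coneK_psmooth eps al), Hal. }
    apply (phtpy_trans eps al _ W _ chi); [exact Hal| |].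
    + apply (phtpy_cone eps al X Y W f
        (fun s t x => psi (sig_pt (toI ((1 - proj1_sig s) * proj1_sig t + proj1_sig s * al (proj1_sig t))) (f x)))
        (fun _ _ => ppt W)); [exact Hal| | | | | | | |].
      * intros s t x E. rewrite E, a1, toI_1 by ring. apply Hend, e1.
      * intros s t x [E| ->]; [|apply Hpt]. rewrite E, a0, toI_0 by ring. apply Hend, e0.
      * intros s t x Hs Ht Hx.
        apply (Hcv (fun r => toI ((1 - proj1_sig (s r)) * proj1_sig (t r) + proj1_sig (s r) * al (proj1_sig (t r)))) (fun r => f (x r))).
        -- apply (interpolation_curv eps al al); assumption.
        -- apply Hfc, Hx.
      * intros s y _ _. apply curv_const.
      * intros t x. rewrite toI_interp_0, coneK_pt, Sigm_pt by apply Hf. reflexivity.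
      * intros y. rewrite coneK_J. change (ppt (SigP X)) with (@sig_pt X I0 (ppt X)). rewrite Sigm_pt by apply Hf. apply Hpt.
      * intros t x. rewrite toI_interp_1. apply HchiP.
      * apply HchiJ.
    (* [Y] sweeps the suspension from coordinate 1, where it is constant, to coordinate 0, and the
       cone lines are shortened by the same factor so that they end at [f x] at every time. *)
    + apply (phtpy_cone eps al X Y W f
        (fun s t x => psi (sig_pt (toI ((1 - proj1_sig s) * al (proj1_sig t))) (f x)))
        (fun s y => psi (sig_pt (toI (1 - proj1_sig s)) y))); [exact Hal| | | | | | | |].
      * intros s t x E. rewrite E, a1, Rmult_1_r. reflexivity.
      * intros s t x [E| ->]; [|apply Hpt]. rewrite E, a0, toI_0 by ring. apply Hend, e0.
      * intros s t x Hs Ht Hx.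
        apply (Hcv (fun r => toI ((1 - proj1_sig (s r)) * al (proj1_sig (t r)))) (fun r => f (x r))); [|apply Hfc, Hx].
        apply Ifr_curv_boldI, toI_curv.
        -- apply smooth_mult; [|apply flat_step_curv; assumption]. apply smooth_minus; [apply smooth_const|apply Ifr_curv_val, Hs].
        -- intros r. exact (unit_mult _ _ (unit_opp _ (proj2_sig (s r))) (ar _)).
      * intros s y Hs Hy. apply (Hcv (fun r => toI (1 - proj1_sig (s r))) y); [|exact Hy].
        apply Ifr_curv_boldI, toI_curv.
        -- apply smooth_minus; [apply smooth_const|apply Ifr_curv_val, Hs].
        -- intros r. exact (unit_opp _ (proj2_sig (s r))).
      * intros t x. rewrite HchiP. do 2 f_equal. f_equal. simpl proj1_sig. ring.
      * intros y. rewrite HchiJ, toI_1 by (simpl; ring). symmetry. apply Hend, e1.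
      * intros t x. rewrite toI_0 by (simpl; ring). symmetry. apply Hend, e0.
      * intros y. rewrite toI_0 by (simpl; ring). symmetry. apply Hend, e0.
Qed.

(** * Loop spaces and suspension *)

Definition is_loop (W : PFrol) (ga : Iset -> W) : Prop :=
  smooth_map boldI W ga /\ ga I0 = ppt W /\ ga I1 = ppt W.

Lemma const_loop (W : PFrol) : is_loop W (fun _ => ppt W).
Proof.
  split; [|auto]. apply smooth_map_curv. intros c _. apply curv_const.
Qed.

(** The function-space structure, generated by applying test functionals to a loop read along a
    curve of [boldI] and through a structure function of [W]. It makes a map into the loops smooth
    as soon as its adjoint is, while evaluation is smooth by [weakly_smooth_diag]. *)
Definition loopF (W : PFrol) : Frol :=
  genF {ga : Iset -> W | is_loop W ga}
    (fun Xi => exists c f Phi, curv boldI c /\ fns W f /\ Ffun Phi /\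
       forall ga, Xi ga = Phi (fun x => f (proj1_sig ga (c x)))).

Definition loopP (W : PFrol) : PFrol := mkP (loopF W) (exist _ _ (const_loop W)).

Lemma loop_ext (W : PFrol) (ga de : loopP W) : (forall t, proj1_sig ga t = proj1_sig de t) -> ga = de.
Proof. destruct ga, de. intros E. apply subset_eq_compat, functional_extensionality, E. Qed.

Lemma smooth_map_loopP (B : Frol) (W : PFrol) (h : B -> loopP W) :
  (forall b t, curv B b -> curv boldI t -> curv W (fun r => proj1_sig (h (b r)) (t r))) ->
  smooth_map B (loopP W) h.
Proof.
  intros Hh. apply smooth_map_curv. intros b Hb Xi [c [f [Phi [Hc [Hf [HPhi E]]]]]].
  apply (smooth_ext (fun t => Phi (fun x => f (proj1_sig (h (b t)) (c x))))); [intros t; symmetry; apply E|].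
  apply (HPhi (fun t x => f (proj1_sig (h (b t)) (c x)))). intros a1 a2 Ha1 Ha2.
  apply (curv_fns W (fun r => proj1_sig (h (b (a1 r))) (c (a2 r)))); [|exact Hf].
  apply (Hh (fun r => b (a1 r)) (fun r => c (a2 r))); apply curv_comp; assumption.
Qed.

Lemma loop_eval_curv eps al (W : PFrol) (ga : R -> loopP W) t :
  braking eps al -> curv (loopP W) ga -> curv boldI t -> curv W (fun r => proj1_sig (ga r) (t r)).
Proof.
  intros Hal Hga Ht. apply curv_ax. intros f Hf.
  apply (weakly_smooth_diag eps al (fun s x => f (proj1_sig (ga s) (t x)))); [exact Hal|]. split.
  - intros s. apply (curv_fns W (fun x => proj1_sig (ga s) (t x))); [|exact Hf].
    apply (proj1 (smooth_map_curv _ _ _) (proj1 (proj2_sig (ga s))) t Ht).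
  - intros Phi HPhi. apply (Hga (fun de => Phi (fun x => f (proj1_sig de (t x))))).
    exists t, f, Phi. auto.
Qed.

Lemma loop_endpts (W : PFrol) (ga : loopP W) t : endpts t -> proj1_sig ga t = ppt W.
Proof.
  intros Ht. destruct ga as [ga [Hs [H0 H1]]]. destruct (endpts_cases t Ht) as [-> | ->]; assumption.
Qed.

Definition adjoint {A W : PFrol} (f : SigP A -> W) (g : A -> loopP W) : Prop :=
  forall t a, f (sig_pt t a) = proj1_sig (g a) t.

Lemma sig_loop (A W : PFrol) (f : SigP A -> W) a : psmooth (SigP A) W f -> is_loop W (fun t => f (sig_pt t a)).
Proof.
  intros [Hf Hb]. split; [|split].
  - apply smooth_map_curv. intros t Ht. apply (proj1 (smooth_map_curv _ _ _) Hf (fun r => sig_pt (t r) a)).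
    apply sig_pt_curv; [exact Ht|apply curv_const].
  - rewrite sig_pt_base by (left; left; reflexivity). exact Hb.
  - rewrite sig_pt_base by (left; right; reflexivity). exact Hb.
Qed.

Lemma adjoint_exists (A W : PFrol) (f : SigP A -> W) :
  psmooth (SigP A) W f -> exists g, psmooth A (loopP W) g /\ adjoint f g.
Proof.
  intros Hf. exists (fun a => exist _ _ (sig_loop A W f a Hf)). split; [|intros t a; reflexivity]. split.
  - apply smooth_map_loopP. intros a t Ha Ht.
    apply (proj1 (smooth_map_curv _ _ _) (proj1 Hf) (fun r => sig_pt (t r) (a r))), sig_pt_curv; assumption.
  - apply loop_ext. intros t. simpl. rewrite sig_pt_base by auto. apply Hf.
Qed.

Lemma adjoint_inverse eps al (A W : PFrol) (g : A -> loopP W) :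
  braking eps al -> psmooth A (loopP W) g -> exists f, psmooth (SigP A) W f /\ adjoint f g.
Proof.
  intros Hal [Hg Hb]. destruct (sig_map_exists eps al A W (fun t a => proj1_sig (g a) t) Hal) as [f [Hf HP]].
  - intros t a [Ht| ->]; [apply loop_endpts, Ht|]. rewrite Hb. reflexivity.
  - intros t a Ht Ha. apply (loop_eval_curv eps al W (fun r => g (a r)) t Hal); [|exact Ht].
    apply (proj1 (smooth_map_curv _ _ _) Hg a Ha).
  - exists f. split; [exact Hf|]. exact HP.
Qed.

Lemma adjoint_phtpy eps al (A W : PFrol) (f f' : SigP A -> W) (g g' : A -> loopP W) :
  braking eps al -> adjoint f g -> adjoint f' g' ->
  (phtpy (SigP A) W f f' <-> phtpy A (loopP W) g g').
Proof.
  intros Hal E E'. split.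
  - intros [H [HH [H0 [H1 Hb]]]].
    assert (HL : forall p : Iset * A, is_loop W (fun t => H (fst p, sig_pt t (snd p)))).
    { intros [s a]. split; [|split].
      - apply smooth_map_curv. intros t Ht.
        apply (prodF_map_curv Ifr (SigP A) W H (fun _ => s) (fun r => sig_pt (t r) a) HH); [apply curv_const|].
        apply sig_pt_curv; [exact Ht|apply curv_const].
      - rewrite sig_pt_base by (left; left; reflexivity). apply Hb.
      - rewrite sig_pt_base by (left; right; reflexivity). apply Hb. }
    exists (fun p => exist _ _ (HL p)). split; [|split; [|split]].
    + apply smooth_map_loopP. intros b t Hpb Ht. apply prodF_curv in Hpb. destruct Hpb as [Hs Ha].
      apply (prodF_map_curv Ifr (SigP A) W H (fun r => fst (b r)) (fun r => sig_pt (t r) (snd (b r))) HH Hs).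
      apply (sig_pt_curv A t (fun r => snd (b r)) Ht Ha).
    + intros a. apply loop_ext. intros t. rewrite <- E. apply H0.
    + intros a. apply loop_ext. intros t. rewrite <- E'. apply H1.
    + intros s. apply loop_ext. intros t. simpl. rewrite sig_pt_base by auto. apply Hb.
  - intros [H [HH [H0 [H1 Hb]]]].
    apply (phtpy_sig eps al A W (fun s t a => proj1_sig (H (s, a)) t)); [exact Hal| | | |].
    + intros s t a [Ht| ->]; [apply loop_endpts, Ht|]. rewrite Hb. reflexivity.
    + intros s t a Hs Ht Ha. apply (loop_eval_curv eps al W (fun r => H (s r, a r)) t Hal); [|exact Ht].
      apply (prodF_map_curv Ifr A (loopP W) H s a HH Hs Ha).
    + intros t a. rewrite H0. apply E.
    + intros t a. rewrite H1. apply E'.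
Qed.

(** * Exactness after suspension *)

Lemma exact_at_Sigm eps al (X Y Z W : PFrol) (g : X -> Y) (h : Y -> Z) :
  braking eps al -> g (ppt X) = ppt Y -> h (ppt Y) = ppt Z ->
  exact_at (loopP W) g h -> exact_at W (Sigm g) (Sigm h).
Proof.
  intros Hal Hg Hh Hex phi Hphi. destruct (adjoint_exists Y W phi Hphi) as [phi' [Hphi' Ad]].
  assert (Ag : adjoint (fun x => phi (Sigm g x)) (fun x => phi' (g x))).
  { intros t x. rewrite Sigm_pt by exact Hg. apply Ad. }
  assert (A0 : adjoint (fun _ : SigP X => ppt W) (fun _ : X => ppt (loopP W))) by (intros t x; reflexivity).
  assert (Ah : forall (psi : SigP Z -> W) (psi' : Z -> loopP W), adjoint psi psi' -> adjoint (fun y => psi (Sigm h y)) (fun y => psi' (h y))).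
  { intros psi psi' Ap t y. rewrite Sigm_pt by exact Hh. apply Ap. }
  rewrite (adjoint_phtpy eps al X W _ _ _ _ Hal Ag A0). rewrite (Hex phi' Hphi'). split.
  - intros [psi' [Hpsi' Hp]]. destruct (adjoint_inverse eps al Z W psi' Hal Hpsi') as [psi [Hpsi Ap]].
    exists psi. split; [exact Hpsi|].
    apply (adjoint_phtpy eps al Y W _ _ _ _ Hal Ad (Ah _ _ Ap)), Hp.
  - intros [psi [Hpsi Hp]]. destruct (adjoint_exists Z W psi Hpsi) as [psi' [Hpsi' Ap]].
    exists psi'. split; [exact Hpsi'|].
    apply (adjoint_phtpy eps al Y W _ _ _ _ Hal Ad (Ah _ _ Ap)), Hp.
Qed.

(** Every suspension trades [W] for its loop space, so exactness is assumed for all targets. As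
    [Sig_n] suspends the innermost space first, the induction varies the spaces and maps as well. *)
Lemma exact_at_Sig_nm eps al (X Y Z : PFrol) (g : X -> Y) (h : Y -> Z) n :
  braking eps al -> g (ppt X) = ppt Y -> h (ppt Y) = ppt Z ->
  (forall W, exact_at W g h) -> forall W, exact_at W (Sig_nm n g) (Sig_nm n h).
Proof.
  intros Hal. revert X Y Z g h; induction n as [|n IH]; intros X Y Z g h Hg Hh Hex W; [apply Hex|].
  assert (Hb : forall (A B : PFrol) (k : A -> B), k (ppt A) = ppt B -> Sigm k (ppt (SigP A)) = ppt (SigP B)).
  { intros A B k Hk. change (ppt (SigP A)) with (@sig_pt A I0 (ppt A)). rewrite Sigm_pt, Hk by exact Hk. reflexivity. }
  apply (IH (SigP X) (SigP Y) (SigP Z) (Sigm g) (Sigm h)); [apply Hb, Hg|apply Hb, Hh|].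
  intros W'. apply (exact_at_Sigm eps al); [exact Hal|exact Hg|exact Hh|apply Hex].
Qed.

Lemma pcofibration_braking (A X : PFrol) (i : A -> X) : pcofibration i -> exists eps al, braking eps al.
Proof.
  intros [_ Hi]. set (pt := mkP (genF unit (fun _ => False)) tt).
  assert (Hsm : forall (B : Frol) (f : B -> pt), smooth_map B pt f).
  { intros B f. apply smooth_map_curv. intros c _ g []. }
  (* With one point as target all data are forced, so the conclusion reduces to the existence of the
     braking function. *)
  destruct (Hi pt (fun _ => tt) (fun _ => tt)) as [eps [al [F [Hal _]]]]; try reflexivity.
  - split; [apply Hsm|reflexivity].
  - apply Hsm.
  - eauto.
Qed.

Theorem theorem6 (W X : PFrol) (P : X -> Prop) (hP : P (ppt X)) :
  pcofibration (incl X P hP) ->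
  forall n : nat,
    exact_at W (Sig_nm n (incl X P hP)) (Sig_nm n (coneJ (incl X P hP))) /\
    exact_at W (Sig_nm n (coneJ (incl X P hP))) (Sig_nm n (coneK (incl X P hP))) /\
    exact_at W (Sig_nm n (coneK (incl X P hP))) (Sig_nm (S n) (incl X P hP)).
Proof.
  intros Hcof n. destruct (pcofibration_braking _ _ _ Hcof) as [eps [al Hal]].
  destruct Hcof as [Hi _]. set (i := incl X P hP) in *.
  pose proof (proj2 Hi) as Hib. pose proof (proj2 (coneJ_psmooth _ _ i Hib)) as HJ.
  pose proof (proj2 (coneK_psmooth eps al _ _ i Hal)) as HK.
  split; [|split].
  - apply (exact_at_Sig_nm eps al); [exact Hal|exact Hib|exact HJ|].
    intros W'. apply (exact_at_cone eps al); assumption.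
  - apply (exact_at_Sig_nm eps al); [exact Hal|exact HJ|exact HK|].
    intros W'. apply (exact_at_coneJ eps al); assumption.
  (* [Sig_nm (S n) i] unfolds to [Sig_nm n (Sigm i)], so this term is the [n]-fold suspension of the
     pair [coneK i], [Sigm i]. *)
  - apply (exact_at_Sig_nm eps al (coneF i) (SigP (subP X P hP)) (SigP X) (coneK i) (Sigm i) n); [exact Hal|exact HK| |].
    + change (ppt (SigP (subP X P hP))) with (@sig_pt (subP X P hP) I0 (ppt (subP X P hP))).
      rewrite Sigm_pt, Hib by exact Hib. reflexivity.
    + intros W'. apply (exact_at_coneK eps al); assumption.
Qed.
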